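(* Let $V$ be an $\mathbb{F}_2$-vector space, let $B$ be an infinite Boolean ring, and let $A\subseteq B$ be a subring such that $|A|\ge 8$. Let $m<0$ be a negative integer. Then $$\mathrm{HH}^{k,m}(V_*\sqcap A_*,\,V_*\sqcap B_* )=0$$ for every $k\ge0$ such that $k\ne 1-m$. In particular, $$\mathrm{HH}^{n,2-n}(V_*\sqcap B_*,\,V_*\sqcap B_* )=0\quad\text{for all } n\ge3.$$ Hence the graded algebra $V_*\sqcap B_*$ is intrinsically formal.
   Context: A ring $B$ (commutative, with unit; subrings contain the unit) is Boolean if $x^2=x$ for all $x\in B$. Its associated Boolean graded algebra is the graded $\mathbb{F}_2$-algebra $B_*=\bigoplus_{n\ge0}B_n$ with $B_0=\mathbb{F}_2$ and $B_n=B$ for $n\ge1$, where for $m,n\geq 1$ the multiplication $B_m\times B_n\to B_{m+n}$ is the multiplication of $B$. For an $\mathbb{F}_2$-vector space $V$, the associated dual algebra is the graded $\mathbb{F}_2$-algebra $V_*$ with $V_0=\mathbb{F}_2$, $V_1=V$ and $V_j=0$ for $j\ge2$. For non-negatively graded $\mathbb{F}_2$-algebras $P,Q$ with $P_0=Q_0=\mathbb{F}_2$, the connected sum $P\sqcap Q$ is the graded algebra with $(P\sqcap Q)_0=\mathbb{F}_2$, $(P\sqcap Q)_i=P_i\oplus Q_i$ for $i>0$, with the multiplications of $P$ and $Q$ and with all products of a positive-degree element of $P$ and a positive-degree element of $Q$ (in either order) equal to zero. The inclusion $A\subseteq B$ makes $V_*\sqcap B_*$ a graded $V_*\sqcap A_*$-bimodule.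 Graded Hochschild cohomology: for a graded $\mathbb{F}_2$-algebra $Q$, a graded $Q$-bimodule $M$ and $s\in\mathbb{Z}$, let $M[s]$ be the graded bimodule with $M[s]_n=M_{n+s}$. Then $\mathrm{HH}^{n,s}(Q,M)$ is the $n$-th cohomology of the cochain complex whose $n$-th term is the space of degree-preserving $\mathbb{F}_2$-linear maps $Q^{\otimes n}\to M[s]$ (tensor products over $\mathbb{F}_2$), with differential $$(d f)(a_1\otimes\cdots\otimes a_{n+1})=a_1f(a_2\otimes\cdots\otimes a_{n+1})+\sum_{i=1}^n f(a_1\otimes\cdots\otimes a_ia_{i+1}\otimes\cdots\otimes a_{n+1})+f(a_1\otimes\cdots\otimes a_n)a_{n+1}.$$ A graded $\mathbb{F}_2$-algebra $Q$ is intrinsically formal if every differential graded $\mathbb{F}_2$-algebra $C$ with $H^*(C)\cong Q$ is formal, i.e. there is a diagram $C\leftarrow T\to H^*(C)$ of quasi-isomorphisms of differential graded algebras, $H^*(C)$ having zero differential. *)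

(* Defs.v *)
From HB Require Import structures.
From mathcomp Require Import all_boot all_order all_algebra ring_quotient.
From mathcomp Require Import generic_quotient.
From mathcomp Require Import boolp classical_sets functions cardinality.

Set Implicit Arguments.
Unset Strict Implicit.
Unset Printing Implicit Defensive.

Import GRing.Theory.
Local Open Scope ring_scope.
Local Open Scope quotient_scope.

Section Cohomology.
Variables (R : pzRingType) (U V W : lmodType R).
Variables (f : {linear U -> V}) (g : {linear V -> W}).

Definition is_cocycle : {pred V} := fun x => g x == 0.

Fact is_cocycle_submod : submod_closed is_cocycle.
Proof.
split=> [|a x y]; rewrite !unfold_in ?linear0 // => /eqP gx /eqP gy.
by rewrite linearP gx gy scaler0 addr0.
Qed.
HB.instance Definition _ :=
  GRing.isSubmodClosed.Build R V is_cocycle is_cocycle_submod.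

Record cocycle := Cocycle {
  cocycle_val :> V;
  cocycle_valP : cocycle_val \in is_cocycle }.
HB.instance Definition _ := [isSub for cocycle_val].
HB.instance Definition _ := [Choice of cocycle by <:].
HB.instance Definition _ := [SubChoice_isSubLmodule of cocycle by <:].

Definition is_coboundary : {pred cocycle} :=
  fun z => `[< exists u, f u = val z >].

Fact is_coboundary_submod : submod_closed is_coboundary.
Proof.
split=> [|a x y]; first by apply/asboolP; exists 0; rewrite linear0.
move=> /asboolP[u fu] /asboolP[v fv]; apply/asboolP; exists (a *: u + v).
by rewrite linearP fu fv.
Qed.
HB.instance Definition _ :=
  GRing.isSubmodClosed.Build R cocycle is_coboundary is_coboundary_submod.

(* The cohomology at V of U -f-> V -g-> W: cocycles modulo those which are
   coboundaries. *)
Definition cohomology : Type := Quotient.quot is_coboundary.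
HB.instance Definition _ := GRing.Zmodule.on cohomology.

Definition cohom_class (z : cocycle) : cohomology :=
  \pi_(Quotient.quot is_coboundary) z.
Definition cohom_repr (x : cohomology) : cocycle :=
  repr (x : Quotient.quot is_coboundary).

Lemma cohom_reprK x : cohom_class (cohom_repr x) = x.
Proof. exact: reprK. Qed.

Lemma cohom_class_eq z z' :
  (cohom_class z = cohom_class z') <-> (exists u, f u = val z - val z').
Proof.
split=> [e|[u fu]].
  have : z - z' \in is_coboundary by rewrite Quotient.idealrBE; apply/eqP.
  by move/asboolP=> [u fu]; exists u; rewrite fu raddfB.
apply/eqP; rewrite -Quotient.idealrBE; apply/asboolP; exists u.
by rewrite fu raddfB.
Qed.

Fact cohom_class_additive : zmod_morphism cohom_class.
Proof. exact: (raddfB (\pi_(Quotient.quot is_coboundary))). Qed.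
HB.instance Definition _ :=
  GRing.isZmodMorphism.Build cocycle cohomology cohom_class
    cohom_class_additive.

Definition cohom_scale (a : R) (x : cohomology) : cohomology :=
  cohom_class (a *: cohom_repr x).

Lemma cohom_scale_class a z : cohom_scale a (cohom_class z) = cohom_class (a *: z).
Proof.
have /cohom_class_eq[u fu] := cohom_reprK (cohom_class z).
by apply/cohom_class_eq; exists (a *: u); rewrite linearZ fu /= scalerBr.
Qed.

Fact cohom_scaleA a b x : cohom_scale a (cohom_scale b x) = cohom_scale (a * b) x.
Proof. by rewrite -[x]cohom_reprK !cohom_scale_class scalerA. Qed.
Fact cohom_scale1 : left_id 1 cohom_scale.
Proof. by move=> x; rewrite -[x]cohom_reprK cohom_scale_class scale1r. Qed.
Fact cohom_scaleDr : right_distributive cohom_scale +%R.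
Proof.
move=> a x y; rewrite -[x]cohom_reprK -[y]cohom_reprK -raddfD.
by rewrite !cohom_scale_class scalerDr raddfD.
Qed.
Fact cohom_scaleDl x : {morph cohom_scale^~ x : a b / a + b}.
Proof.
by move=> a b; rewrite -[x]cohom_reprK !cohom_scale_class scalerDl raddfD.
Qed.
HB.instance Definition _ := GRing.Zmodule_isLmodule.Build R cohomology
  cohom_scaleA cohom_scale1 cohom_scaleDr cohom_scaleDl.

Fact cohom_class_scalable : scalable cohom_class.
Proof. by move=> a z; rewrite -cohom_scale_class. Qed.
HB.instance Definition _ :=
  GRing.isScalable.Build R cocycle cohomology *:%R cohom_class
    cohom_class_scalable.

End Cohomology.

Notation F2 := 'F_2.

Lemma addF2 (V : lmodType F2) (x : V) : x + x = 0.
Proof.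
rewrite -[x]scale1r -scalerDl (_ : 1 + 1 = 0) ?scale0r //.
exact/val_inj.
Qed.

Section LinearFacts.
Variables (V W : lmodType F2) (f : V -> W) (lf : linear f).
Lemma lin_fun0 : f 0 = 0.
Proof. by have := lf (-1) 0 0; rewrite scaler0 addr0 scaleN1r addNr. Qed.
Lemma lin_funB x y : f (x - y) = f x - f y.
Proof. by rewrite addrC -scaleN1r lf scaleN1r addrC. Qed.
End LinearFacts.

(* Graded F_2-algebras, graded by int.  The product of degrees i and j takes
   values in any degree k equipped with a proof of i + j = k; by uniqueness of
   such proofs this is a product P_i x P_j -> P_(i+j), and it avoids casts. *)
Record galg := GAlg {
  gr :> int -> lmodType F2;
  gone : gr 0;
  gmul : forall (i j k : int), i + j = k -> gr i -> gr j -> gr k;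
  gmul_linr : forall (i j k : int) (e : i + j = k) a, linear (gmul e a);
  gmul_linl : forall (i j k : int) (e : i + j = k) b, linear (fun a => gmul e a b);
  gmulA : forall (i j k ij jk l : int) (e1 : i + j = ij) (e2 : ij + k = l)
      (e3 : j + k = jk) (e4 : i + jk = l) a b c,
    gmul e2 (gmul e1 a b) c = gmul e4 a (gmul e3 b c);
  gmul1l : forall (i : int) (e : 0 + i = i) a, gmul e gone a = a;
  gmul1r : forall (i : int) (e : i + 0 = i) a, gmul e a gone = a }.

Record gmor (P Q : galg) := GMor {
  gmap :> forall i, {linear P i -> Q i};
  gmap1 : gmap 0 (gone P) = gone Q;
  gmapM : forall (i j k : int) (e : i + j = k) a b,
    gmap k (gmul e a b) = gmul e (gmap i a) (gmap j b) }.

Definition gisomorphic (P Q : galg) :=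
  exists f : gmor P Q, forall i, bijective (f i).

Record gbimod (Q : galg) := GBimod {
  bgr :> int -> lmodType F2;
  lact : forall (i j k : int), i + j = k -> Q i -> bgr j -> bgr k;
  ract : forall (i j k : int), i + j = k -> bgr i -> Q j -> bgr k;
  lact_linr : forall (i j k : int) (e : i + j = k) a, linear (lact e a);
  lact_linl : forall (i j k : int) (e : i + j = k) x, linear (fun a => lact e a x);
  ract_linr : forall (i j k : int) (e : i + j = k) x, linear (ract e x);
  ract_linl : forall (i j k : int) (e : i + j = k) a, linear (fun x => ract e x a);
  lactA : forall (i j k ij jk l : int) (e1 : i + j = ij) (e2 : ij + k = l)
      (e3 : j + k = jk) (e4 : i + jk = l) a b x,
    lact e2 (gmul e1 a b) x = lact e4 a (lact e3 b x);
  ractA : forall (i j k ij jk l : int) (e1 : i + j = ij) (e2 : ij + k = l)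
      (e3 : j + k = jk) (e4 : i + jk = l) x a b,
    ract e2 (ract e1 x a) b = ract e4 x (gmul e3 a b);
  lractA : forall (i j k ij jk l : int) (e1 : i + j = ij) (e2 : ij + k = l)
      (e3 : j + k = jk) (e4 : i + jk = l) a x b,
    ract e2 (lact e1 a x) b = lact e4 a (ract e3 x b);
  lact1 : forall (i : int) (e : 0 + i = i) x, lact e (gone Q) x = x;
  ract1 : forall (i : int) (e : i + 0 = i) x, ract e x (gone Q) = x }.

Definition regular_bimod (Q : galg) : gbimod Q :=
  @GBimod Q Q (@gmul Q) (@gmul Q) (@gmul_linr Q) (@gmul_linl Q) (@gmul_linr Q)
    (@gmul_linl Q) (@gmulA Q) (@gmulA Q) (@gmulA Q) (@gmul1l Q) (@gmul1r Q).

Section Restriction.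
Variables (P Q : galg) (f : gmor P Q) (M : gbimod Q).

Let rlact (i j k : int) (e : i + j = k) (a : P i) (x : M j) : M k := lact e (f i a) x.
Let rract (i j k : int) (e : i + j = k) (x : M i) (a : P j) : M k := ract e x (f j a).

Definition restrict_bimod : gbimod P.
Proof.
exists (bgr M) rlact rract; rewrite /rlact /rract.
- by move=> *; apply: lact_linr.
- by move=> i j k e x c a b; rewrite linearP lact_linl.
- by move=> i j k e x c a b; rewrite linearP ract_linr.
- by move=> *; apply: ract_linl.
- by move=> *; rewrite gmapM; apply: lactA.
- by move=> *; rewrite gmapM; apply: ractA.
- by move=> *; apply: lractA.
- by move=> *; rewrite gmap1 lact1.
- by move=> *; rewrite gmap1 ract1.
Defined.

End Restriction.

Definition hmg (P : int -> lmodType F2) : Type := {i : int & P i}.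

Definition hmul (Q : galg) (x y : hmg Q) : hmg Q :=
  Tagged (gr Q) (gmul erefl (tagged x) (tagged y)).

Definition hdeg (P : int -> lmodType F2) n (a : 'I_n -> hmg P) : int :=
  \sum_i tag (a i).

Fact addr_shuffle (V : zmodType) (a b c d e f : V) :
  (a + b) + (c + d) + (e + f) = (a + c + e) + (b + d + f).
Proof. by rewrite (addrACA a b c d) (addrACA (a + c)). Qed.

Section Hochschild.
Variables (Q : galg) (M : gbimod Q).

(* A degree-preserving linear map from the n-th tensor power of Q to M[s] is
   given by its values on pure tensors of homogeneous elements: a family of
   maps, linear in each argument, sending (a_0, ..., a_(n-1)) into the component
   of M of degree deg a_0 + ... + deg a_(n-1) + s. *)
Definition precochain n (s : int) : Type :=
  forall (a : 'I_n -> hmg Q) (t : int), hdeg a + s = t -> M t.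

Definition multilinear n s (f : precochain n s) : Prop :=
  forall (a : 'I_n -> hmg Q) (i : 'I_n) (j : int) (c : F2) (x y : Q j)
    (t : int) e e1 e2,
    f [eta a with i |-> Tagged (gr Q) (c *: x + y)] t e =
    c *: f [eta a with i |-> Tagged (gr Q) x] t e1
    + f [eta a with i |-> Tagged (gr Q) y] t e2.

Record cochain n s := Cochain {
  cochain_fun :> forall (a : 'I_n -> hmg Q) (t : int), hdeg a + s = t -> M t;
  cochainP : multilinear cochain_fun }.

Lemma cochain_eq n s (f g : cochain n s) :
  (forall a t e, f a t e = g a t e) -> f = g.
Proof.
case: f g => [f fP] [g gP] /= fg.
have {}fg : f = g.
  apply: functional_extensionality_dep => a.
  apply: functional_extensionality_dep => t.
  by apply: functional_extensionality_dep => e.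
by case: g / fg gP => gP; rewrite (Prop_irrelevance fP gP).
Qed.

Section CochainSpace.
Variables (n : nat) (s : int).
Implicit Types f g : cochain n s.

HB.instance Definition _ := gen_eqMixin (cochain n s).
HB.instance Definition _ := gen_choiceMixin (cochain n s).

Definition cochain0 : cochain n s.
Proof.
by exists (fun _ _ _ => 0) => a i j c x y t e e1 e2 /=; rewrite scaler0 addr0.
Defined.

Definition cochainN f : cochain n s.
Proof.
exists (fun a t e => - f a t e) => a i j c x y t e e1 e2 /=.
by rewrite (cochainP f e e1 e2) opprD scalerN.
Defined.

Definition cochainD f g : cochain n s.
Proof.
exists (fun a t e => f a t e + g a t e) => a i j c x y t e e1 e2 /=.
by rewrite (cochainP f e e1 e2) (cochainP g e e1 e2) scalerDr addrACA.
Defined.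

Definition cochainZ (b : F2) f : cochain n s.
Proof.
exists (fun a t e => b *: f a t e) => a i j c x y t e e1 e2 /=.
by rewrite (cochainP f e e1 e2) scalerDr !scalerA mulrC.
Defined.

Fact cochain_addA : associative cochainD.
Proof. by move=> f g h; apply: cochain_eq => a t e /=; rewrite addrA. Qed.
Fact cochain_addC : commutative cochainD.
Proof. by move=> f g; apply: cochain_eq => a t e /=; rewrite addrC. Qed.
Fact cochain_add0 : left_id cochain0 cochainD.
Proof. by move=> f; apply: cochain_eq => a t e /=; rewrite add0r. Qed.
Fact cochain_addN : left_inverse cochain0 cochainN cochainD.
Proof. by move=> f; apply: cochain_eq => a t e /=; rewrite addNr. Qed.
HB.instance Definition _ := GRing.isZmodule.Build (cochain n s)
  cochain_addA cochain_addC cochain_add0 cochain_addN.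

Fact cochain_scaleA b c f : cochainZ b (cochainZ c f) = cochainZ (b * c) f.
Proof. by apply: cochain_eq => a t e /=; rewrite scalerA. Qed.
Fact cochain_scale1 : left_id 1 cochainZ.
Proof. by move=> f; apply: cochain_eq => a t e /=; rewrite scale1r. Qed.
Fact cochain_scaleDr : right_distributive cochainZ +%R.
Proof. by move=> b f g; apply: cochain_eq => a t e /=; rewrite scalerDr. Qed.
Fact cochain_scaleDl f : {morph cochainZ^~ f : b c / b + c}.
Proof. by move=> b c; apply: cochain_eq => a t e /=; rewrite scalerDl. Qed.
HB.instance Definition _ := GRing.Zmodule_isLmodule.Build F2 (cochain n s)
  cochain_scaleA cochain_scale1 cochain_scaleDr cochain_scaleDl.

End CochainSpace.

Section Differential.
Variables (n : nat) (s : int).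
Implicit Types (f : precochain n s) (a : 'I_n.+1 -> hmg Q).

Definition htail a : 'I_n -> hmg Q := fun j => a (lift ord0 j).
Definition hinit a : 'I_n -> hmg Q := fun j => a (widen_ord (leqnSn n) j).

(* (a_0, ..., a_i a_(i+1), ..., a_n) *)
Definition hmerge (i : 'I_n) a : 'I_n -> hmg Q := fun j =>
  if (j < i)%N then a (widen_ord (leqnSn n) j)
  else if j == i then hmul (a (widen_ord (leqnSn n) j)) (a (lift ord0 j))
  else a (lift ord0 j).

Lemma htail_deg a t : hdeg a + s = t -> tag (a ord0) + (hdeg (htail a) + s) = t.
Proof. by move=> <-; rewrite /hdeg big_ord_recl addrA. Qed.

Lemma hinit_deg a t : hdeg a + s = t -> hdeg (hinit a) + s + tag (a ord_max) = t.
Proof. by move=> <-; rewrite /hdeg big_ord_recr addrAC. Qed.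

Lemma hmerge_at i a :
  hmerge i a i = hmul (a (widen_ord (leqnSn n) i)) (a (lift ord0 i)).
Proof. by rewrite /hmerge ltnn eqxx. Qed.

Lemma hmerge_off i a j : j != i -> hmerge i a j = a (lift (lift ord0 i) j).
Proof.
move=> ji; rewrite /hmerge (negPf ji); case: ltnP => [lt_ji|le_ij]; congr a;
  apply/val_inj; rewrite /= /bump /=; first by rewrite !add1n leqNgt ltnS ltnW.
have lt_ij : (i < j)%N by rewrite ltn_neqAle eq_sym ji.
by rewrite !add1n lt_ij.
Qed.

Lemma hmerge_deg i a t : hdeg a + s = t -> hdeg (hmerge i a) + s = t.
Proof.
move=> <-; rewrite /hdeg; congr (_ + _).
rewrite (bigD1_ord (lift ord0 i)) //= [RHS]addrC (bigD1 i) //= hmerge_at /=.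
rewrite [in RHS](bigD1 i) //= (_ : lift (lift ord0 i) i = widen_ord (leqnSn n) i).
  rewrite [RHS]addrAC; congr (_ + _).
  by apply: eq_bigr => j ji; rewrite hmerge_off.
by apply/val_inj; rewrite /= /bump /= !add1n ltnn.
Qed.

(* The differential on cochains, numbering the arguments from 0. *)
Definition hdiff_fun f : precochain n.+1 s := fun a t e =>
  lact (htail_deg e) (tagged (a ord0)) (f (htail a) _ erefl)
  + \sum_(i < n) f (hmerge i a) t (hmerge_deg i e)
  + ract (hinit_deg e) (f (hinit a) _ erefl) (tagged (a ord_max)).

Lemma precochain_congr m r (g : precochain m r) b b' t e e' :
  b = b' -> g b t e = g b' t e'.
Proof. by move=> eb; case: b' / eb e' => e'; rewrite (Prop_irrelevance e e'). Qed.

Let lterm f (x : hmg Q) (b : 'I_n -> hmg Q) t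
    (e : tag x + (hdeg b + s) = t) : M t :=
  lact e (tagged x) (f b _ erefl).
Let rterm f (b : 'I_n -> hmg Q) (x : hmg Q) t
    (e : hdeg b + s + tag x = t) : M t :=
  ract e (f b _ erefl) (tagged x).

Let ltermE f x b t d (e : tag x + (hdeg b + s) = t) (e' : hdeg b + s = d)
  (e'' : tag x + d = t) : lterm f e = lact e'' (tagged x) (f b d e').
Proof.
by case: d / e' e'' => e''; rewrite /lterm (Prop_irrelevance e'' e).
Qed.
Let rtermE f x b t d (e : hdeg b + s + tag x = t) (e' : hdeg b + s = d)
  (e'' : d + tag x = t) : rterm f e = ract e'' (f b d e') (tagged x).
Proof.
by case: d / e' e'' => e''; rewrite /rterm (Prop_irrelevance e'' e).
Qed.

Let lterm_congr f x x' b b' t (e : tag x + (hdeg b + s) = t)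
  (e' : tag x' + (hdeg b' + s) = t) : x = x' -> b = b' -> lterm f e = lterm f e'.
Proof.
move=> ex eb; case: x' / ex e'; case: b' / eb => e'.
by rewrite (Prop_irrelevance e e').
Qed.
Let rterm_congr f x x' b b' t (e : hdeg b + s + tag x = t)
  (e' : hdeg b' + s + tag x' = t) : x = x' -> b = b' -> rterm f e = rterm f e'.
Proof.
move=> ex eb; case: x' / ex e'; case: b' / eb => e'.
by rewrite (Prop_irrelevance e e').
Qed.

Lemma hdeg_with m (a : 'I_m -> hmg Q) i x x' : tag x = tag x' ->
  hdeg [eta a with i |-> x] = hdeg [eta a with i |-> x'] :> int.
Proof. by move=> e; apply: eq_bigr => j _ /=; case: ifP. Qed.

Lemma upd_eta m (b : 'I_m -> hmg Q) i z k :
  [eta b with i |-> z] k = if k == i then z else b k.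
Proof. by []. Qed.

Lemma htail_upd0 a z : htail [eta a with ord0 |-> z] = htail a.
Proof. by apply: functional_extensionality_dep => j. Qed.
Lemma htail_updS a i z :
  htail [eta a with lift ord0 i |-> z] = [eta htail a with i |-> z].
Proof.
apply: functional_extensionality_dep => j.
by rewrite upd_eta /htail upd_eta (inj_eq lift_inj).
Qed.

Lemma widen_lift_max (i : 'I_n) : widen_ord (leqnSn n) i = lift ord_max i.
Proof. by apply/val_inj; rewrite /= /bump leqNgt ltn_ord. Qed.
Lemma hinit_upd0 a z : hinit [eta a with ord_max |-> z] = hinit a.
Proof.
apply: functional_extensionality_dep => j.
by rewrite /hinit upd_eta widen_lift_max eq_sym (negPf (neq_lift _ _)).
Qed.
Lemma hinit_updS a i z :
  hinit [eta a with lift ord_max i |-> z] = [eta hinit a with i |-> z].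
Proof.
apply: functional_extensionality_dep => j.
by rewrite upd_eta /hinit upd_eta widen_lift_max (inj_eq lift_inj).
Qed.

Lemma widen_lift_lift (i : 'I_n) : widen_ord (leqnSn n) i = lift (lift ord0 i) i.
Proof. by apply/val_inj; rewrite /= /bump /= !add1n ltnn. Qed.
Lemma hmerge_updl a l z : hmerge l [eta a with widen_ord (leqnSn n) l |-> z] =
  [eta hmerge l a with l |-> hmul z (a (lift ord0 l))].
Proof.
apply: functional_extensionality_dep => j; rewrite upd_eta.
case: eqVneq => [->|jl].
  by rewrite hmerge_at !upd_eta eqxx widen_lift_lift (negPf (neq_lift _ _)).
by rewrite !hmerge_off // upd_eta widen_lift_lift (inj_eq lift_inj) (negPf jl).
Qed.
Lemma hmerge_updr a l z : hmerge l [eta a with lift ord0 l |-> z] =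
  [eta hmerge l a with l |-> hmul (a (widen_ord (leqnSn n) l)) z].
Proof.
apply: functional_extensionality_dep => j; rewrite upd_eta.
case: eqVneq => [->|jl].
  by rewrite hmerge_at !upd_eta eqxx widen_lift_lift eq_sym (negPf (neq_lift _ _)).
by rewrite !hmerge_off // upd_eta eq_sym (negPf (neq_lift _ _)).
Qed.
Lemma hmerge_updo a l i z : i != l ->
  hmerge l [eta a with lift (lift ord0 l) i |-> z] = [eta hmerge l a with i |-> z].
Proof.
move=> il; apply: functional_extensionality_dep => j; rewrite upd_eta.
case: eqVneq => [->|ji]; first by rewrite hmerge_off // upd_eta eqxx.
case: (eqVneq j l) => [->|jl].
  rewrite !hmerge_at !upd_eta widen_lift_lift (inj_eq lift_inj) eq_sym (negPf il).
  by rewrite (negPf (neq_lift _ _)).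
by rewrite !hmerge_off // upd_eta (inj_eq lift_inj) (negPf ji).
Qed.

Section Multilinearity.
Variables (f : precochain n s) (fP : multilinear f).
Variables (a : 'I_n.+1 -> hmg Q) (i : 'I_n.+1) (j : int) (c : F2) (x y : Q j).
Let z := c *: x + y.
Let U (u : Q j) : 'I_n.+1 -> hmg Q := [eta a with i |-> Tagged (gr Q) u].

Let llin t e e1 e2 : @lterm f (U z ord0) (htail (U z)) t e =
  c *: @lterm f (U x ord0) (htail (U x)) t e1
  + @lterm f (U y ord0) (htail (U y)) t e2.
Proof.
have UE u k : U u k = if k == i then Tagged (gr Q) u else a k by [].
case: (unliftP ord0 i) => [i'|] ei.
  have t0 u : U u ord0 = a ord0 by rewrite UE ei.
  have tl u : htail (U u) = [eta htail a with i' |-> Tagged (gr Q) u].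
    by rewrite /U ei htail_updS.
  pose b (u : Q j) : 'I_n -> hmg Q := [eta htail a with i' |-> Tagged (gr Q) u].
  have bd u : hdeg (b u) + s = hdeg (b z) + s.
    by congr (_ + _); apply: hdeg_with.
  have E u : tag (a ord0) + (hdeg (b u) + s) = t.
    by rewrite bd; move: e; rewrite tl t0.
  have g u e0 : @lterm f (U u ord0) (htail (U u)) t e0 =
      @lterm f (a ord0) (b u) t (E u) by exact: lterm_congr.
  rewrite !g (ltermE f (E z) erefl (E z)) (ltermE f (E x) (bd x) (E z)).
  rewrite (ltermE f (E y) (bd y) (E z)).
  by rewrite (fP erefl (bd x) (bd y)) lact_linr.
have t0 u : U u ord0 = Tagged (gr Q) u by rewrite UE ei eqxx.
have tl u : htail (U u) = htail a by rewrite /U ei htail_upd0.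
have E : j + (hdeg (htail a) + s) = t by move: e; rewrite tl t0.
have g u e0 : @lterm f (U u ord0) (htail (U u)) t e0 =
    @lterm f (Tagged (gr Q) u) (htail a) t E by exact: lterm_congr.
by rewrite !g /lterm lact_linl.
Qed.

Let rlin t e e1 e2 : @rterm f (hinit (U z)) (U z ord_max) t e =
  c *: @rterm f (hinit (U x)) (U x ord_max) t e1
  + @rterm f (hinit (U y)) (U y ord_max) t e2.
Proof.
have UE u k : U u k = if k == i then Tagged (gr Q) u else a k by [].
case: (unliftP ord_max i) => [i'|] ei.
  have t0 u : U u ord_max = a ord_max.
    by rewrite UE ei (negPf (neq_lift _ _)).
  have tl u : hinit (U u) = [eta hinit a with i' |-> Tagged (gr Q) u].
    by rewrite /U ei hinit_updS.
  pose b (u : Q j) : 'I_n -> hmg Q := [eta hinit a with i' |-> Tagged (gr Q) u].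
  have bd u : hdeg (b u) + s = hdeg (b z) + s.
    by congr (_ + _); apply: hdeg_with.
  have E u : hdeg (b u) + s + tag (a ord_max) = t.
    by rewrite bd; move: e; rewrite tl t0.
  have g u e0 : @rterm f (hinit (U u)) (U u ord_max) t e0 =
      @rterm f (b u) (a ord_max) t (E u) by exact: rterm_congr.
  rewrite !g (rtermE f (E z) erefl (E z)) (rtermE f (E x) (bd x) (E z)).
  rewrite (rtermE f (E y) (bd y) (E z)).
  by rewrite (fP erefl (bd x) (bd y)) ract_linl.
have t0 u : U u ord_max = Tagged (gr Q) u by rewrite UE ei eqxx.
have tl u : hinit (U u) = hinit a by rewrite /U ei hinit_upd0.
have E : hdeg (hinit a) + s + j = t by move: e; rewrite tl t0.
have g u e0 : @rterm f (hinit (U u)) (U u ord_max) t e0 =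
    @rterm f (hinit a) (Tagged (gr Q) u) t E by exact: rterm_congr.
by rewrite !g /rterm ract_linr.
Qed.

Let mlin l t e e1 e2 : @f (hmerge l (U z)) t e =
  c *: @f (hmerge l (U x)) t e1 + @f (hmerge l (U y)) t e2.
Proof.
have [i' [k [v [vlin vE]]]] : exists i' k (v : Q j -> Q k), linear v /\
    forall u, hmerge l (U u) = [eta hmerge l a with i' |-> Tagged (gr Q) (v u)].
  case: (unliftP (lift ord0 l) i) => [i'|] ei; last first.
    set b := a (widen_ord (leqnSn n) l); exists l, _, (gmul erefl (tagged b)).
    by split=> [|u]; [exact: gmul_linr | rewrite /U ei hmerge_updr].
  have [il|il] := eqVneq i' l; last first.
    exists i', j, id; split=> // u; rewrite /U ei hmerge_updo //.
  set b := a (lift ord0 l).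
  exists l, _, (fun u => gmul erefl u (tagged b)).
  by split=> [|u]; [exact: gmul_linl | rewrite /U ei il -widen_lift_lift hmerge_updl].
pose b (u : Q j) : 'I_n -> hmg Q := [eta hmerge l a with i' |-> Tagged (gr Q) (v u)].
have E u : hdeg (b u) + s = t.
  rewrite -e vE; congr (_ + _); exact: hdeg_with.
have g u e0 : @f (hmerge l (U u)) t e0 = @f (b u) t (E u).
  exact: precochain_congr.
rewrite !g; have bz : b z = [eta hmerge l a with i' |->
    Tagged (gr Q) (c *: v x + v y)] by rewrite /b vlin.
have E' : hdeg [eta hmerge l a with i' |-> Tagged (gr Q) (c *: v x + v y)] + s = t.
  by rewrite -bz.
by rewrite (precochain_congr _ _ E' bz) (fP E' (E x) (E y)).
Qed.

Lemma hdiff_multilinear_at t e e1 e2 : hdiff_fun f (a := U z) (t := t) e =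
  c *: hdiff_fun f (a := U x) (t := t) e1 + hdiff_fun f (a := U y) (t := t) e2.
Proof.
have S : \sum_(l < n) @f (hmerge l (U z)) t (hmerge_deg l e) =
    c *: (\sum_(l < n) @f (hmerge l (U x)) t (hmerge_deg l e1))
    + \sum_(l < n) @f (hmerge l (U y)) t (hmerge_deg l e2).
  by rewrite scaler_sumr -big_split; apply: eq_bigr => l _; exact: mlin.
have L := llin (htail_deg e) (htail_deg e1) (htail_deg e2).
have R := rlin (hinit_deg e) (hinit_deg e1) (hinit_deg e2).
rewrite /hdiff_fun S [X in X + _ + _ = _]L [X in _ + X = _]R !scalerDr.
exact: addr_shuffle.
Qed.

End Multilinearity.

Lemma hdiff_multilinear f : multilinear f -> multilinear (hdiff_fun f).
Proof. by move=> fP a i j c x y t e e1 e2; exact: hdiff_multilinear_at. Qed.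

Definition hdiff (f : cochain n s) : cochain n.+1 s :=
  Cochain (hdiff_multilinear (cochainP f)).

Fact hdiff_linear : linear hdiff.
Proof.
move=> c f g; apply: cochain_eq => a t e /=; rewrite /hdiff_fun /=.
rewrite lact_linr ract_linl big_split -scaler_sumr !scalerDr /=.
exact: addr_shuffle.
Qed.
HB.instance Definition _ :=
  GRing.isLinear.Build F2 (cochain n s) (cochain n.+1 s) *:%R hdiff hdiff_linear.

End Differential.

End Hochschild.

(* HH^(n,s)(Q, M); in cohomological degree 0 the incoming map is zero. *)
Definition HH (n : nat) (s : int) (Q : galg) (M : gbimod Q) : lmodType F2 :=
  match n with
  | 0 => cohomology (\0 : {linear 'rV[F2]_0 -> cochain M 0 s}) (@hdiff Q M 0 s)
  | n'.+1 => cohomology (@hdiff Q M n' s) (@hdiff Q M n'.+1 s)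
  end.

(* Differential graded algebras, cohomologically graded over int.  The sign in
   the Leibniz rule disappears in characteristic 2. *)
Record dga := DGA {
  dga_alg :> galg;
  dif : forall (i k : int), i + 1 = k -> {linear dga_alg i -> dga_alg k};
  difK : forall (i j k : int) (e1 : i + 1 = j) (e2 : j + 1 = k) x,
    dif e2 (dif e1 x) = 0;
  difM : forall (i j k i' j' k' : int) (e : i + j = k) (ei : i + 1 = i')
      (ej : j + 1 = j') (ek : k + 1 = k') (e1 : i' + j = k') (e2 : i + j' = k')
      a b,
    dif ek (gmul e a b) = gmul e1 (dif ei a) b + gmul e2 a (dif ej b) }.

Record dgmor (C D : dga) := DGMor {
  dgmap :> gmor C D;
  dgmap_dif : forall (i k : int) (e : i + 1 = k) x,
    dgmap k (dif C e x) = dif D e (dgmap i x) }.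

Section CohomologyAlgebra.
Variable C : dga.

Definition dif_in (k : int) : {linear C (k - 1) -> C k} := dif C (subrK 1 k).
Definition dif_out (k : int) : {linear C k -> C (k + 1)} := dif C erefl.

Definition dgcocycle (k : int) : lmodType F2 := cocycle (dif_out k).
Definition dgcohom (k : int) : lmodType F2 := cohomology (dif_in k) (dif_out k).
Definition dgclass k : {linear dgcocycle k -> dgcohom k} :=
  @cohom_class F2 _ _ _ (dif_in k) (dif_out k).
Definition dgrepr k (x : dgcohom k) : dgcocycle k := cohom_repr x.

Lemma dgreprK k (x : dgcohom k) : dgclass k (dgrepr x) = x.
Proof. exact: cohom_reprK. Qed.

Lemma dgcocycleP k (z : dgcocycle k) j (e : k + 1 = j) :
  dif C e (cocycle_val z) = 0.
Proof. by case: j / e; apply/eqP; exact: (cocycle_valP z). Qed.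

Lemma dgclass_eq k (z z' : dgcocycle k) : dgclass k z = dgclass k z' <->
  exists (i : int) (e : i + 1 = k) u, dif C e u = cocycle_val z - cocycle_val z'.
Proof.
split=> [/cohom_class_eq[u eu]|[i [e [u eu]]]]; first by exists (k - 1), (subrK 1 k), u; exact: eu.
have ei : i = k - 1 by rewrite -e addrK.
subst i; apply/cohom_class_eq; exists u; rewrite -[RHS]eu.
by congr (dif C _ u); apply: Prop_irrelevance.
Qed.

Lemma dgcocycle_eq k (z z' : dgcocycle k) :
  cocycle_val z = cocycle_val z' -> z = z'.
Proof. exact: (@val_inj _ _ (cocycle (dif_out k))). Qed.

Definition dgcocycle1 : dgcocycle 0.
Proof.
exists (gone C); apply/eqP.
have := difM (add0r 0) (erefl (0 + 1)) erefl erefl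
  (addr0 (0 + 1)) (add0r (0 + 1)) (gone C) (gone C).
rewrite !gmul1l gmul1r => /(congr1 (+%R^~ (- dif_out 0 (gone C)))).
by rewrite addrK subrr.
Defined.

Definition dgcocycleM (i j k : int) (e : i + j = k) (x : dgcocycle i) (y : dgcocycle j) :
  dgcocycle k.
Proof.
exists (gmul e (cocycle_val x) (cocycle_val y)); apply/eqP.
have e1 : i + 1 + j = k + 1 by rewrite addrAC e.
have e2 : i + (j + 1) = k + 1 by rewrite addrA e.
rewrite [LHS](difM e erefl erefl erefl e1 e2) !dgcocycleP.
by rewrite (lin_fun0 (gmul_linl e1 _)) (lin_fun0 (gmul_linr e2 _)) addr0.
Defined.

Definition dgcohomM (i j k : int) (e : i + j = k) (x : dgcohom i) (y : dgcohom j) :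
  dgcohom k := dgclass k (dgcocycleM e (dgrepr x) (dgrepr y)).

Lemma dgcohomM_class (i j k : int) (e : i + j = k) x y :
  dgcohomM e (dgclass i x) (dgclass j y) = dgclass k (dgcocycleM e x y).
Proof.
have /dgclass_eq[i' [ei [u eu]]] := dgreprK (dgclass i x).
have /dgclass_eq[j' [ej [v ev]]] := dgreprK (dgclass j y).
set x' := dgrepr _ in eu *; set y' := dgrepr _ in ev *.
rewrite /dgcohomM -/x' -/y'; transitivity (dgclass k (dgcocycleM e x y')).
  have e1 : i' + j = k - 1 by rewrite -e -ei addrAC addrK.
  have e2 : i' + (j + 1) = k by rewrite addrA e1 subrK.
  apply/dgclass_eq; exists _, (subrK 1 k), (gmul e1 u (cocycle_val y')).
  rewrite (difM e1 ei erefl (subrK 1 k) e e2) dgcocycleP.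
  rewrite (lin_fun0 (gmul_linr e2 _)) addr0 eu.
  exact: (lin_funB (gmul_linl e (cocycle_val y'))).
have e1 : i + j' = k - 1 by rewrite -e -ej addrA addrK.
have e2 : i + 1 + j' = k by rewrite addrAC e1 subrK.
apply/dgclass_eq; exists _, (subrK 1 k), (gmul e1 (cocycle_val x) v).
rewrite (difM e1 erefl ej (subrK 1 k) e2 e) dgcocycleP.
rewrite (lin_fun0 (gmul_linl e2 _)) add0r ev.
exact: (lin_funB (gmul_linr e (cocycle_val x))).
Qed.

(* The graded algebra H^*(C). *)
Definition cohomology_algebra : galg.
Proof.
exists dgcohom (dgclass 0 dgcocycle1) dgcohomM.
- move=> i j k e x c y z; rewrite -[x]dgreprK -[y]dgreprK -[z]dgreprK.
  rewrite -linearP !dgcohomM_class -linearP; congr (dgclass _ _).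
  by apply: dgcocycle_eq; exact: gmul_linr.
- move=> i j k e x c y z; rewrite -[x]dgreprK -[y]dgreprK -[z]dgreprK.
  rewrite -linearP !dgcohomM_class -linearP; congr (dgclass _ _).
  by apply: dgcocycle_eq; exact: gmul_linl.
- move=> i j k ij jk l e1 e2 e3 e4 x y z.
  rewrite -[x]dgreprK -[y]dgreprK -[z]dgreprK !dgcohomM_class; congr (dgclass _ _).
  by apply: dgcocycle_eq; exact: gmulA.
- move=> i e x; rewrite -[x]dgreprK dgcohomM_class; congr (dgclass _ _).
  by apply: dgcocycle_eq; exact: gmul1l.
- move=> i e x; rewrite -[x]dgreprK dgcohomM_class; congr (dgclass _ _).
  by apply: dgcocycle_eq; exact: gmul1r.
Defined.

End CohomologyAlgebra.

Definition zero_dga (Q : galg) : dga.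
Proof.
exists Q (fun i k _ => \0 : {linear Q i -> Q k}); first by [].
move=> i j k i' j' k' e ei ej ek e1 e2 a b /=.
by rewrite (lin_fun0 (gmul_linl e1 _)) (lin_fun0 (gmul_linr e2 _)) addr0.
Defined.

Section InducedMap.
Variables (C D : dga) (f : dgmor C D).

Definition dgcocycle_map k (z : dgcocycle C k) : dgcocycle D k.
Proof.
exists (f k (cocycle_val z)); apply/eqP.
by rewrite -[LHS]dgmap_dif dgcocycleP linear0.
Defined.

Definition cohomology_map k (x : dgcohom C k) : dgcohom D k :=
  dgclass D k (dgcocycle_map (dgrepr x)).

Lemma cohomology_map_class k (z : dgcocycle C k) :
  cohomology_map (dgclass C k z) = dgclass D k (dgcocycle_map z).
Proof.
have /dgclass_eq[i [e [u eu]]] := dgreprK (dgclass C k z).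
apply/dgclass_eq; exists i, e, (f i u).
by rewrite -dgmap_dif eu raddfB.
Qed.

Definition quasi_iso := forall k, bijective (@cohomology_map k).

End InducedMap.

Definition formal (C : dga) :=
  exists (T : dga) (f : dgmor T C) (g : dgmor T (zero_dga (cohomology_algebra C))),
    quasi_iso f /\ quasi_iso g.

Definition intrinsically_formal (Q : galg) :=
  forall C : dga, gisomorphic (cohomology_algebra C) Q -> formal C.

(* A non-negatively graded F_2-algebra P with P_0 = F_2 is determined by its
   positive part, a graded algebra without unit; pgr n stands for P_(n+1). *)
Record posalg := PosAlg {
  pgr :> nat -> lmodType F2;
  pmul : forall m n k, (m.+1 + n.+1 = k.+1)%N -> pgr m -> pgr n -> pgr k;
  pmul_linr : forall m n k (e : (m.+1 + n.+1 = k.+1)%N) a, linear (pmul e a);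
  pmul_linl : forall m n k (e : (m.+1 + n.+1 = k.+1)%N) b,
    linear (fun a => pmul e a b);
  pmulA : forall m n p mn np l (e1 : (m.+1 + n.+1 = mn.+1)%N)
      (e2 : (mn.+1 + p.+1 = l.+1)%N) (e3 : (n.+1 + p.+1 = np.+1)%N)
      (e4 : (m.+1 + np.+1 = l.+1)%N) a b c,
    pmul e2 (pmul e1 a b) c = pmul e4 a (pmul e3 b c) }.

Record posmor (P P' : posalg) := PosMor {
  pmap :> forall n, {linear P n -> P' n};
  pmapM : forall m n k (e : (m.+1 + n.+1 = k.+1)%N) a b,
    pmap k (pmul e a b) = pmul e (pmap m a) (pmap n b) }.

Section Unitalization.
Variable P : posalg.

Definition ugr (i : int) : lmodType F2 :=
  match i with
  | Posz 0 => F2^o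
  | Posz n.+1 => P n
  | Negz _ => 'rV[F2]_0
  end.

Definition umul0 (i j : int) : ugr i -> ugr j -> ugr (i + j) :=
  match i, j return ugr i -> ugr j -> ugr (i + j) with
  | Posz 0, Posz n => fun a b => (a : F2) *: b
  | Posz m.+1, Posz 0 => fun a b =>
      ecast k (ugr k) (esym (addr0 (Posz m.+1))) ((b : F2) *: a)
  | Posz m.+1, Posz n.+1 => @pmul P m n (m + n.+1) erefl
  | _, _ => fun _ _ => 0
  end.

Definition umul (i j k : int) (e : i + j = k) (a : ugr i) (b : ugr j) : ugr k :=
  ecast l (ugr l) e (umul0 a b).

Definition uone : ugr 0 := (1 : F2).

Lemma ugr_negz0 n (x : ugr (Negz n)) : x = 0.
Proof. exact: thinmx0. Qed.

Lemma ucast_symK (i j : int) (e : i = j) (x : ugr j) :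
  ecast l (ugr l) e (ecast l (ugr l) (esym e) x) = x.
Proof. by case: j / e x. Qed.

Lemma umul_0l (j : int) (e : 0 + j = j) (a : F2) b : umul e (a : ugr 0) b = a *: b.
Proof.
case: j e b => [n|n] e b; last by rewrite [LHS]ugr_negz0 [RHS]ugr_negz0.
by rewrite /umul (Prop_irrelevance e erefl).
Qed.

Lemma umul_0r (j : int) (e : j + 0 = j) b (a : F2) : umul e b (a : ugr 0) = a *: b.
Proof.
case: j e b => [[|m]|n] e b; last by rewrite [LHS]ugr_negz0 [RHS]ugr_negz0.
  by rewrite umul_0l; exact: mulrC.
rewrite /umul /=; set e' := esym _.
by rewrite [e'](Prop_irrelevance e' (esym e)) ucast_symK.
Qed.

Lemma umul_pos m n k (e : Posz m.+1 + Posz n.+1 = Posz k.+1)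
    (e' : (m.+1 + n.+1 = k.+1)%N) (a : P m) (b : P n) :
  umul (i := m.+1) (j := n.+1) e a b = pmul e' a b.
Proof.
have ek : (m + n.+1)%N = k by case: e'.
subst k; rewrite /umul (Prop_irrelevance e erefl) /=.
by rewrite (Prop_irrelevance e' erefl).
Qed.

Lemma umul_negl n (j k : int) (e : Negz n + j = k) (a : ugr (Negz n)) (b : ugr j) :
  umul e a b = 0.
Proof. by case: k / e; case: j b => [[|m]|m] b. Qed.

Lemma umul_negr (i : int) n (k : int) (e : i + Negz n = k) (a : ugr i) (b : ugr (Negz n)) :
  umul e a b = 0.
Proof. by case: k / e; case: i a => [[|m]|m] a. Qed.

Lemma umul_linr (i j k : int) (e : i + j = k) a : linear (umul e a).
Proof.
case: i e a => [[|m]|m] e a c x y; last by rewrite !umul_negl scaler0 addr0.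
  have ek : j = k by rewrite -e add0r.
  case: k / ek e => e; rewrite !(umul_0l e a) scalerDr !scalerA; congr (_ *: _ + _).
  exact: mulrC.
case: j e x y => [[|n]|n] e x y; last by rewrite !umul_negr scaler0 addr0.
  have ek : Posz m.+1 = k by rewrite -e addr0.
  by case: k / ek e => e; rewrite !umul_0r scalerDl scalerA.
case: k e => [[|k]|k] e; [discriminate e| |discriminate e].
have e' : (m.+1 + n.+1 = k.+1)%N := congr1 absz e.
by rewrite !(umul_pos e e') pmul_linr.
Qed.

Lemma umul_linl (i j k : int) (e : i + j = k) b : linear (fun a => umul e a b).
Proof.
case: j e b => [[|n]|n] e b c x y; last by rewrite !umul_negr scaler0 addr0.
  have ek : i = k by rewrite -e addr0.
  case: k / ek e => e; rewrite !(umul_0r e _ b) scalerDr !scalerA; congr (_ *: _ + _).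
  exact: mulrC.
case: i e x y => [[|m]|m] e x y; last by rewrite !umul_negl scaler0 addr0.
  have ek : Posz n.+1 = k by rewrite -e add0r.
  by case: k / ek e => e; rewrite !umul_0l scalerDl scalerA.
case: k e => [[|k]|k] e; [discriminate e| |discriminate e].
have e' : (m.+1 + n.+1 = k.+1)%N := congr1 absz e.
by rewrite !(umul_pos e e') pmul_linl.
Qed.

Lemma umulA (i j k ij jk l : int) (e1 : i + j = ij) (e2 : ij + k = l)
    (e3 : j + k = jk) (e4 : i + jk = l) a b c :
  umul e2 (umul e1 a b) c = umul e4 a (umul e3 b c).
Proof.
have lin0l i' j' k' (e : i' + j' = k') y : umul e 0 y = 0.
  exact: (lin_fun0 (umul_linl e y)).
have lin0r i' j' k' (e : i' + j' = k') x : umul e x 0 = 0.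
  exact: (lin_fun0 (umul_linr e x)).
have linZl i' j' k' (e : i' + j' = k') r x y :
    umul e (r *: x) y = r *: umul e x y.
  by have := umul_linl e y r x 0; rewrite !addr0 lin0l addr0.
have linZr i' j' k' (e : i' + j' = k') r x y :
    umul e x (r *: y) = r *: umul e x y.
  by have := umul_linr e x r y 0; rewrite !addr0 lin0r addr0.
case: i e1 e4 a => [[|m]|m] e1 e4 a; last by rewrite !umul_negl lin0l.
  have E1 : j = ij by rewrite -e1 add0r.
  have E2 : jk = l by rewrite -e4 add0r.
  case: ij / E1 e1 e2 => e1 e2; case: l / E2 e2 e4 => e2 e4; rewrite !umul_0l linZl; congr (_ *: umul _ _ _).
  exact: Prop_irrelevance.
case: k e2 e3 c => [[|p]|p] e2 e3 c; last by rewrite !umul_negr lin0r.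
  have E1 : ij = l by rewrite -e2 addr0.
  have E2 : j = jk by rewrite -e3 addr0.
  case: jk / E2 e3 e4 => e3 e4; case: l / E1 e2 e4 => e2 e4; rewrite !umul_0r linZr; congr (_ *: umul _ _ _).
  exact: Prop_irrelevance.
case: j e1 e3 b => [[|n]|n] e1 e3 b.
- have E1 : Posz m.+1 = ij by rewrite -e1 addr0.
  have E2 : Posz p.+1 = jk by rewrite -e3 add0r.
  case: ij / E1 e1 e2 => e1 e2; case: jk / E2 e3 e4 => e3 e4; rewrite umul_0l umul_0r linZl linZr; congr (_ *: umul _ _ _).
  exact: Prop_irrelevance.
- case: ij e1 e2 => [[|ij]|ij] e1 e2; [discriminate e1| |discriminate e1].
  case: jk e3 e4 => [[|jk]|jk] e3 e4; [discriminate e3| |discriminate e3].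
  case: l e2 e4 => [[|l]|l] e2 e4; [discriminate e2| |discriminate e2].
  have e1' : (m.+1 + n.+1 = ij.+1)%N := congr1 absz e1.
  have e2' : (ij.+1 + p.+1 = l.+1)%N := congr1 absz e2.
  have e3' : (n.+1 + p.+1 = jk.+1)%N := congr1 absz e3.
  have e4' : (m.+1 + jk.+1 = l.+1)%N := congr1 absz e4.
  rewrite (umul_pos e1 e1') (umul_pos e2 e2') (umul_pos e3 e3').
  by rewrite (umul_pos e4 e4'); apply: pmulA.
- by rewrite umul_negr umul_negl lin0l lin0r.
Qed.

Definition unitalization : galg.
Proof.
exists ugr uone umul.
- exact: umul_linr.
- exact: umul_linl.
- exact: umulA.
- by move=> i e a; rewrite umul_0l scale1r.
- by move=> i e a; rewrite umul_0r scale1r.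
Defined.

End Unitalization.

Section UnitalizationMap.
Variables (P P' : posalg) (f : posmor P P').

Definition umap (i : int) : {linear ugr P i -> ugr P' i} :=
  match i return {linear ugr P i -> ugr P' i} with
  | Posz 0 => idfun
  | Posz n.+1 => f n
  | Negz _ => idfun
  end.

Lemma umap_cast (i j : int) (e : i = j) (x : ugr P i) :
  umap j (ecast l (ugr P l) e x) = ecast l (ugr P' l) e (umap i x).
Proof. by case: j / e. Qed.

Definition unitalization_map : gmor (unitalization P) (unitalization P').
Proof.
exists umap; first by [].
move=> i j k e a b /=; case: k / e; rewrite /umul /=.
case: i a => [[|m]|m] a; case: j b => [[|n]|n] b /=; rewrite ?linear0 //.
- by rewrite linearZ.
- by rewrite [LHS](umap_cast (esym (addr0 (Posz m.+1)))) /= linearZ.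
- exact: pmapM.
Defined.

End UnitalizationMap.

Section ConnectedSum.
Variables P Q : posalg.

Definition csum_mul m n k (e : (m.+1 + n.+1 = k.+1)%N)
    (a : P m * Q m) (b : P n * Q n) : P k * Q k :=
  (pmul e a.1 b.1, pmul e a.2 b.2).

Definition connected_sum : posalg.
Proof.
exists (fun n => (P n * Q n)%type) csum_mul.
- by move=> m n k e a c x y; congr pair; apply: pmul_linr.
- move=> m n k e b c x y.
  by congr pair; [apply: (pmul_linl e b.1)|apply: (pmul_linl e b.2)].
- by move=> *; congr pair; apply: pmulA.
Defined.

End ConnectedSum.

Section ConnectedSumMap.
Variables (P P' Q Q' : posalg) (f : posmor P P') (g : posmor Q Q').

Definition csum_fun n (a : connected_sum P Q n) : connected_sum P' Q' n :=
  (f n a.1, g n a.2).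

Fact csum_fun_linear n : linear (@csum_fun n).
Proof. by move=> c x y; rewrite /csum_fun !linearP. Qed.
HB.instance Definition _ n := GRing.isLinear.Build F2 (connected_sum P Q n)
  (connected_sum P' Q' n) *:%R (@csum_fun n) (@csum_fun_linear n).

Definition connected_sum_map :
  posmor (connected_sum P Q) (connected_sum P' Q').
Proof.
exists (fun n => @csum_fun n) => m n k e a b.
by congr pair; apply: pmapM.
Defined.

End ConnectedSumMap.

Definition posmor_id (P : posalg) : posmor P P :=
  @PosMor P P (fun n => idfun) (fun _ _ _ _ _ _ => erefl).

Definition dual_gr (V : lmodType F2) (n : nat) : lmodType F2 :=
  if n is 0 then V else 'rV[F2]_0.

Definition dual_posalg (V : lmodType F2) : posalg.
Proof.
exists (dual_gr V) (fun m n k _ _ _ => 0) => //.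
- by move=> m n k e a c x y; rewrite scaler0 addr0.
- by move=> m n k e a c x y; rewrite scaler0 addr0.
Defined.

HB.mixin Record isBooleanRing B of GRing.ComPzRing B := {
  boolr_sqr : forall x : B, x ^+ 2 = x }.

#[short(type="booleanRingType")]
HB.structure Definition BooleanRing := {B of GRing.ComPzRing B & isBooleanRing B}.

Section BooleanVect.
Variable B : booleanRingType.

Lemma boolr_addrr (x : B) : x + x = 0.
Proof.
have := boolr_sqr (x + x); rewrite sqrrD -expr2 !boolr_sqr addrAC.
by rewrite -[RHS]addr0 => /addrI.
Qed.

(* A Boolean ring has characteristic 2, hence is an F_2-vector space. *)
Definition boolr_vect : Type := B.
HB.instance Definition _ := GRing.Zmodule.on boolr_vect.

Definition boolr_scale (a : F2) (x : boolr_vect) : boolr_vect := x *+ a.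

Let mulrn_mod2 (x : boolr_vect) n : x *+ (n %% 2) = x *+ n.
Proof.
have x2 : x *+ 2 = 0 by exact: boolr_addrr.
by rewrite [in RHS](divn_eq n 2) mulrnDr mulnC mulrnA x2 mul0rn add0r.
Qed.

Fact boolr_scaleA a b x : boolr_scale a (boolr_scale b x) = boolr_scale (a * b) x.
Proof. by rewrite /boolr_scale -mulrnA mulnC -[LHS]mulrn_mod2. Qed.
Fact boolr_scale1 : left_id 1 boolr_scale.
Proof. by []. Qed.
Fact boolr_scaleDr : right_distributive boolr_scale +%R.
Proof. by move=> a x y; rewrite /boolr_scale mulrnDl. Qed.
Fact boolr_scaleDl x : {morph boolr_scale^~ x : a b / a + b}.
Proof. by move=> a b; rewrite /boolr_scale -mulrnDr -[RHS]mulrn_mod2. Qed.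
HB.instance Definition _ := GRing.Zmodule_isLmodule.Build F2 boolr_vect
  boolr_scaleA boolr_scale1 boolr_scaleDr boolr_scaleDl.

Definition boolr_mul (m n k : nat) (e : (m.+1 + n.+1 = k.+1)%N)
  (x y : boolr_vect) : boolr_vect := (x : B) * (y : B).

Definition boolean_posalg : posalg.
Proof.
exists (fun _ => boolr_vect) boolr_mul; rewrite /boolr_mul.
- move=> m n k e a c x y; rewrite [LHS]mulrDr; congr (_ + _).
  exact: (mulrnAr (a : B)).
- move=> m n k e a c x y; rewrite [LHS]mulrDl; congr (_ + _).
  exact: (mulrnAl (x : B)).
- by move=> *; rewrite -[LHS]mulrA.
Defined.

End BooleanVect.

Section Subring.
Variables (B : booleanRingType) (A : subringClosed B).

Record subring := Subring {
  subring_val :> B;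
  subring_valP : subring_val \in A }.
HB.instance Definition _ := [isSub for subring_val].
HB.instance Definition _ := [Choice of subring by <:].
HB.instance Definition _ :=
  GRing.SubChoice_isSubComPzRing.Build B _ subring (subringClosedP A).

Fact subring_sqr (x : subring) : x ^+ 2 = x.
Proof. by apply: val_inj; rewrite rmorphXn /= boolr_sqr. Qed.
HB.instance Definition _ := isBooleanRing.Build subring subring_sqr.

Definition subring_incl (x : boolr_vect subring) : boolr_vect B :=
  subring_val x.

Fact subring_incl_linear : linear subring_incl.
Proof.
move=> c x y; rewrite /subring_incl [LHS](rmorphD (val : subring -> B)).
by congr (_ + _); rewrite [LHS](rmorphMn (val : subring -> B)).
Qed.
HB.instance Definition _ := GRing.isLinear.Build F2 (boolr_vect subring)
  (boolr_vect B) *:%R subring_incl subring_incl_linear.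

Definition boolean_incl : posmor (boolean_posalg subring) (boolean_posalg B).
Proof.
by exists (fun n => subring_incl : {linear boolr_vect subring -> boolr_vect B}).
Defined.

End Subring.

(* V_* \sqcap B_*; the inclusion of A in B makes it a bimodule over
   V_* \sqcap A_*. *)
Definition VB (V : lmodType F2) (B : booleanRingType) : galg :=
  unitalization (connected_sum (dual_posalg V) (boolean_posalg B)).

Definition VB_incl (V : lmodType F2) (B : booleanRingType) (A : subringClosed B) :
    gmor (VB V (subring A)) (VB V B) :=
  unitalization_map
    (connected_sum_map (posmor_id (dual_posalg V)) (boolean_incl A)).

Definition VB_bimod (V : lmodType F2) (B : booleanRingType)
    (A : subringClosed B) : gbimod (VB V (subring A)) :=
  restrict_bimod (VB_incl V A) (regular_bimod (VB V B)).

(* Main.v *)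
Require Import Defs.
From HB Require Import structures.
From mathcomp Require Import all_boot all_order all_algebra.
From mathcomp Require Import boolp classical_sets functions cardinality zify.

(* Hochschild cochains are functions of words whose letters are homogeneous
   elements of positive degree; units are removed by a homotopy.  The algebra
   V_* \sqcap A_* is Koszul: an explicit homotopy contracts the part of the
   differential that merges adjacent letters onto words of letters of degree 1,
   and a perturbation argument takes the bimodule action into account, because
   the action raises the degree.  Let c = k + m be the degree of the values of a
   k-cocycle on words of k letters of degree 1; the theorem excludes c = 1.  If
   c < 0 these values vanish for degree reasons, and if c = 0 they vanish because
   A has too many elements.  If c > 1 all values lie in B, and the cocycle is a
   boundary: over a finite Boolean subalgebra the orthogonal idempotents given by
   its atoms produce a contraction, and the finite subalgebras are treated all at
   once by writing the contraction as a linear functional of finitely many values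
   of the cochain and choosing a linear section of the dual differential.

   For formality, let H^*(C) be isomorphic to Q = V_* \sqcap B_*.  Cocycles
   representing the letters extend to an A-infinity morphism from Q to C, that is,
   a solution of a Maurer-Cartan equation, by induction on the length of words:
   the obstructions are the Hochschild cocycles with values in B that were just
   shown to be boundaries.  Twisting the bar resolution by this solution gives a
   C-Q-bimodule X which is quasi-isomorphic to C and, via a generator x0, to Q.
   The triangular matrices with diagonal entries in Q and C and corner in X form
   a differential graded algebra which projects quasi-isomorphically to both. *)

Set Implicit Arguments.
Unset Strict Implicit.
Unset Printing Implicit Defensive.

Import GRing.Theory.
Local Open Scope ring_scope.

(** * Sums and linear sections in characteristic two *)

(** For a finite Boolean ring the associated graded algebra is a connected sum of polynomial rings
    F_2[t], one for each atom, and a polynomial ring in one variable has cohomological dimension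
    one; this is why word functions of length at least two with values in B have no cohomology. In
    length one there is the Euler derivation, which multiplies an element by its degree.

    The passage to an infinite ring is the real obstacle: primitives found over finite subalgebras
    depend on the subalgebra, and making them compatible would meet derived limits. The question is
    therefore dualized. Whether a functional of finitely many values factors through the
    differential involves finitely many letters, hence one finite subalgebra, and all the
    factorizations can then be chosen at once and additively.

    The bound 8 comes from the case c = 0: the cocycle condition forces multiples of an arbitrary
    element of A into the span of 1 and a single letter. This span has at most four elements, and a
    Boolean ring with more than four elements has at least eight. *)

Inductive sum2 := Sum2Var of nat | Sum2Add of sum2 & sum2 | Sum2Zero.

Section Sum2.
Variable V : lmodType F2.

Fixpoint sum2_eval (env : seq V) t : V := match t with
  | Sum2Var i => nth 0 env i
  | Sum2Add t1 t2 => sum2_eval env t1 + sum2_eval env t2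
  | Sum2Zero => 0 end.

Fixpoint sum2_parity t (i : nat) : bool := match t with
  | Sum2Var j => i == j
  | Sum2Add t1 t2 => sum2_parity t1 i (+) sum2_parity t2 i
  | Sum2Zero => false end.

(** In characteristic two only the parity of the number of occurrences of a variable matters;
    variables beyond the end of [env] have the default value [0]. *)
Lemma sum2_evalE env t : sum2_eval env t =
  \sum_(i < size env) if sum2_parity t i then nth 0 env i else 0.
Proof.
elim: t => [j|t1 IH1 t2 IH2|] /=; last by rewrite big1.
  have [ltj|lej] := ltnP j (size env); last first.
    rewrite nth_default // big1 // => i _; case: eqP => // e.
    by move: (ltn_ord i); rewrite e ltnNge lej.
  rewrite (bigD1 (Ordinal ltj)) //= eqxx big1 ?addr0 // => i.
  by rewrite -val_eqE /= => /negPf ->.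
rewrite IH1 IH2 -big_split; apply: eq_bigr => i _.
by case: sum2_parity; case: sum2_parity; rewrite /= ?addr0 ?add0r // addF2.
Qed.

Lemma sum2_eq env t1 t2 :
  all (fun i => sum2_parity t1 i == sum2_parity t2 i) (iota 0 (size env)) ->
  sum2_eval env t1 = sum2_eval env t2.
Proof.
move=> /allP E; rewrite !sum2_evalE; apply: eq_bigr => i _.
by rewrite (eqP (E i _)) // mem_iota ltn_ord.
Qed.

End Sum2.

Ltac sum2_index x env := lazymatch env with
  | ?y :: ?s => match constr:(tt) with
    | _ => let _ := constr:(erefl x : x = y) in constr:(0%N)
    | _ => let n := sum2_index x s in constr:(n.+1) end
  | _ => fail end.
Ltac sum2_env t env := lazymatch t with
  | ?a + ?b => let env := sum2_env a env in sum2_env b env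
  | 0 => env
  | _ => match constr:(tt) with
    | _ => let _ := sum2_index t env in env
    | _ => constr:(t :: env) end end.
Ltac sum2_quote t env := lazymatch t with
  | ?a + ?b => let qa := sum2_quote a env in let qb := sum2_quote b env in
    constr:(Sum2Add qa qb)
  | 0 => constr:(Sum2Zero)
  | _ => let n := sum2_index t env in constr:(Sum2Var n) end.

(* Decides equality of sums in an F_2-vector space, up to associativity,
   commutativity and cancellation of pairs. *)
Ltac char2 := lazymatch goal with |- @eq ?V ?a ?b =>
  let env := sum2_env a (@nil V) in let env := sum2_env b env in
  let qa := sum2_quote a env in let qb := sum2_quote b env in
  exact: (@sum2_eq _ env qa qb (erefl true)) end.

Section AddOn.
Variables (U W : zmodType).
Definition additive_on (S : set W) (f : W -> U) :=
  forall x y, S x -> S y -> f (x + y) = f x + f y.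
End AddOn.

Section Sections.
Variables (U W : lmodType F2) (P : set U) (D : U -> W).
Hypothesis P0 : P 0.
Hypothesis PD : forall x y, P x -> P y -> P (x + y).
Hypothesis D_add : {morph D : x y / x + y}.

Let D0 : D 0 = 0.
Proof. by apply: (addrI (D 0)); rewrite -D_add !addr0. Qed.

Definition partial_section (G : set (W * U)) :=
  [/\ forall p, G p -> P p.2 /\ D p.2 = p.1,
      forall p q, G p -> G q -> G (p + q)
    & forall u, G (0, u) -> u = 0].

(** A maximal graph reaches every [D u] with [u] in [P]: a missed one is added by adjoining a single
    coset, since the sum of two new pairs is an old one in characteristic two. The result is applied
    to functionals of cochains, to representatives of cohomology classes and to primitives, wherever
    choices have to stay additive. *)
Lemma linear_section_exists : exists s : W -> U,
  additive_on [set D u | u in P] s /\ (forall u, P u -> P (s (D u)) /\ D (s (D u)) = D u).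
Proof.
have [F FP Ftot|G [[GP GD G0] Gmax]] := @Zorn_bigcup _ partial_section.
  split.
  - by move=> p [X FX Xp]; have [/(_ _ Xp)] := FP _ FX.
  - move=> p q [X FX Xp] [Y FY Yq].
    case: (Ftot X Y FX FY) => XY; [exists Y|exists X] => //;
      [have [_ GD _] := FP _ FY|have [_ GD _] := FP _ FX]; apply: GD => //;
      exact: XY.
  - by move=> u [X FX Xu]; have [_ _] := FP _ FX; apply.
(* Joining the zero pair to [G] gives a subspace even when [G] is empty. *)
pose H p := G p \/ p = 0.
have HP p : H p -> P p.2 /\ D p.2 = p.1 by case=> [/GP|->].
have HD p q : H p -> H q -> H (p + q).
  move=> [Gp|->] [Gq|->]; rewrite ?addr0 ?add0r; [left; exact: GD|by left|by left|by right].
have H0 u : H (0, u) -> u = 0 by case=> [/G0|[->]].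
have total u : P u -> exists u', H (D u, u').
  move=> Pu; apply: contrapT => nou.
  pose G' p := exists q, H q /\ (p = q \/ p = q + (D u, u)).
  apply: (Gmax G').
    split=> [p Gp|sG]; first by exists p; split; left.
    by apply: nou; exists u; left; apply: sG; exists 0; rewrite add0r; split; right.
  have du x : H x -> x.1 + D u <> 0.
    move=> Hx e; apply: nou; exists x.2; have -> : D u = x.1.
      by rewrite -[LHS]add0r -(addF2 x.1) -addrA e addr0.
    by case: (x) Hx.
  split.
  - move=> p [q [Hq [->|->]]]; have [Pq Dq] := HP _ Hq; split=> //=; first exact: PD.
    by rewrite D_add Dq.
  - move=> p q [p' [Hp' ep]] [q' [Hq' eq]]; exists (p' + q'); split; first exact: HD.
    case: ep => ->; case: eq => ->; [by left|by right; rewrite addrA|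
      by right; rewrite addrAC|left].
    by rewrite addrACA (_ : (D u, u) + _ = 0) ?addr0 //; congr pair; exact: addF2.
  - move=> v [q [Hq [e|e]]]; first by apply: H0; rewrite e.
    by case: (du _ Hq); rewrite (_ : q.1 + D u = (q + (D u, u)).1) // -e.
have [|s sP] := @choice _ _ (fun w u => (exists u', H (w, u')) -> H (w, u)).
  move=> w.
  by have [[u Hu]|nu] := pselect (exists u, H (w, u)); [exists u|exists 0 => /nu].
exists s; split=> [_ _ [u Pu <-] [v Pv <-]|u Pu]; last first.
  by have [] := HP _ (sP _ (total u Pu)).
have Hu := sP _ (total u Pu); have Hv := sP _ (total v Pv).
have Huv := sP _ (total _ (PD Pu Pv)).
have : H (D (u + v) + D u + D v, s (D (u + v)) + s (D u) + s (D v)).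
  exact: HD (HD _ _ Huv Hu) Hv.
rewrite D_add (_ : D u + D v + D u + D v = 0) => [/H0 e|]; last char2.
by rewrite -[LHS]addr0 -e; char2.
Qed.
End Sections.

(** * Hochschild differentials on words *)

Lemma morphD0 (U W : zmodType) (f : U -> W) : {morph f : x y / x + y} -> f 0 = 0.
Proof. by move=> fD; apply: (addrI (f 0)); rewrite -fD !addr0. Qed.

Lemma F2_cases (c : F2) : c = 0 \/ c = 1.
Proof. by case: c => [[|[|i]]] // lt2; [left|right]; apply/val_inj. Qed.

Lemma F2_linear (U W : lmodType F2) (f : U -> W) :
  {morph f : x y / x + y} -> linear f.
Proof.
move=> fD c x y; rewrite fD; case: (F2_cases c) => ->; last by rewrite !scale1r.
by rewrite !scale0r (morphD0 fD).
Qed.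

Lemma split_ends (L : Type) n (w : seq L) : size w = n.+1 ->
  exists l u v m, [/\ w = l :: u, w = rcons v m, size u = n & size v = n].
Proof.
case: w => // l u [su]; exists l, u, (belast l u), (last l u).
by rewrite -lastI size_belast.
Qed.

Section RightHochschild.
Variables (L : Type) (mul : L -> L -> L).
Hypothesis mulA : forall x y z, mul x (mul y z) = mul (mul x y) z.

Section OneModule.
Variables (Y : lmodType F2) (ra : L -> Y -> Y).
Hypothesis raD : forall x, {morph ra x : y z / y + z}.
Implicit Types F G : seq L -> Y.

(** The Hochschild differential without its left action term, which allows recursion on the first
    letter. With the zero action only the merging of adjacent letters remains; this is the
    [mergesum] of the later sections. *)
Fixpoint rdiff F w : Y := match w with
  | x :: w' => match w' with
    | y :: r => F (mul x y :: r) + rdiff (fun v => F (x :: v)) w'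
    | [::] => ra x (F [::]) end
  | [::] => 0 end.

Lemma rdiff_nil F : rdiff F [::] = 0.
Proof. by []. Qed.
Lemma rdiff1 F x : rdiff F [:: x] = ra x (F [::]).
Proof. by []. Qed.
Lemma rdiff_cons2 F x y r : rdiff F [:: x, y & r] =
  F (mul x y :: r) + rdiff (fun v => F (x :: v)) (y :: r).
Proof. by []. Qed.
Arguments rdiff : simpl never.

Lemma eq_rdiff F G w : (forall v, (size v).+1 = size w -> F v = G v) ->
  rdiff F w = rdiff G w.
Proof.
elim: w F G => [|x [|y r] IH] F G E; rewrite ?rdiff_nil ?rdiff1 ?E // !rdiff_cons2.
by rewrite E //; congr (_ + _); apply: IH => v ev; apply: E; rewrite /= ev.
Qed.

Lemma rdiffD F G w : rdiff (fun v => F v + G v) w = rdiff F w + rdiff G w.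
Proof.
elim: w F G => [|x [|y r] IH] F G; rewrite ?rdiff_nil ?rdiff1 ?addr0 ?raD //.
by rewrite !rdiff_cons2 IH; char2.
Qed.

Lemma rdiff0 w : rdiff (fun=> 0) w = 0.
Proof.
have := rdiffD (fun=> 0) (fun=> 0) w.
by rewrite (@eq_rdiff _ (fun=> 0)) => [|v _]; rewrite ?addF2.
Qed.

Lemma rdiff_eq0 F w : (forall v, (size v).+1 = size w -> F v = 0) ->
  rdiff F w = 0.
Proof. by move=> F0; rewrite (eq_rdiff F0) rdiff0. Qed.

Hypothesis raM : forall x y z, ra (mul x y) z = ra y (ra x z).

(** The single term of [rdiff F (x :: v)] in which [x] takes part. As a function of [v] it satisfies
    [rdiff_shift], which is associativity, and this makes the square of [rdiff] vanish by
    induction. *)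
Let shift F x v := if v is y :: r then F (mul x y :: r) else ra x (F [::]).

Let rdiff_cons F x v :
  rdiff F (x :: v) = shift F x v + rdiff (fun u => F (x :: u)) v.
Proof. by case: v => [|y r] //=; rewrite rdiff_nil addr0. Qed.

Let rdiff_shift F x y r : rdiff (shift F x) (y :: r) = rdiff F (mul x y :: r).
Proof. by case: r => [|z r]; rewrite ?rdiff1 ?rdiff_cons2 /= ?raM ?mulA. Qed.

Lemma rdiff_rdiff F w : rdiff (rdiff F) w = 0.
Proof.
elim: w F => [|x [|y r] IH] F //; first exact: morphD0.
rewrite rdiff_cons2.
rewrite (eq_rdiff (fun v _ => rdiff_cons F x v)) rdiffD rdiff_shift.
by rewrite [X in _ + (_ + X)](IH (fun u => F (x :: u))) addr0 addF2.
Qed.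

End OneModule.
Arguments rdiff : simpl never.

Lemma rdiff_morph (Y Y' : lmodType F2) ra ra' (h : Y -> Y') :
  {morph h : x y / x + y} -> (forall x y, h (ra x y) = ra' x (h y)) ->
  forall F w, rdiff ra' (h \o F) w = h (rdiff ra F w).
Proof.
move=> hD hra F w; elim: w F => [|x [|y r] IH] F; rewrite ?rdiff_nil ?rdiff1 ?hra ?(morphD0 hD) //.
by rewrite !rdiff_cons2 hD -IH.
Qed.

Section Bimodule.
Variables (Y : lmodType F2) (la ra : L -> Y -> Y).
Hypothesis laD : forall x, {morph la x : y z / y + z}.
Hypothesis raD : forall x, {morph ra x : y z / y + z}.
Implicit Types F G : seq L -> Y.

Definition wdiff F w : Y :=
  (if w is x :: w' then la x (F w') else 0) + rdiff ra F w.

Lemma eq_diff F G w : (forall v, (size v).+1 = size w -> F v = G v) ->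
  wdiff F w = wdiff G w.
Proof.
move=> E; rewrite /wdiff (eq_rdiff _ E); congr (_ + _).
by case: w E => // x w E; rewrite E.
Qed.

Lemma diffD F G w : wdiff (fun v => F v + G v) w = wdiff F w + wdiff G w.
Proof.
rewrite /wdiff rdiffD //; case: w => [|x w] /=; first by char2.
by rewrite laD; char2.
Qed.

Lemma diff0 w : wdiff (fun=> 0) w = 0.
Proof.
have := diffD (fun=> 0) (fun=> 0) w.
by rewrite (@eq_diff _ (fun=> 0)) => [|v _]; rewrite ?addF2.
Qed.

Lemma diff_sum n (F : nat -> seq L -> Y) w :
  wdiff (fun v => \sum_(i < n) F i v) w = \sum_(i < n) wdiff (F i) w.
Proof.
elim: n => [|n IH].
  by rewrite big_ord0 -[RHS](diff0 w); apply: eq_diff => v _; rewrite big_ord0.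
rewrite big_ord_recr /= -IH -(diffD (fun v => \sum_(i < n) F i v) (F n)).
by apply: eq_diff => v _; rewrite big_ord_recr.
Qed.

Hypothesis laM : forall x y z, la (mul x y) z = la x (la y z).
Hypothesis raM : forall x y z, ra (mul x y) z = ra y (ra x z).
Hypothesis laraC : forall x y z, la x (ra y z) = ra y (la x z).

Lemma diff_diff F w : wdiff (wdiff F) w = 0.
Proof.
pose lF w := if w is x :: w' then la x (F w') else 0.
have dE v : wdiff F v = lF v + rdiff ra F v by [].
rewrite {1}/wdiff (@eq_rdiff _ _ _ (fun v => lF v + rdiff ra F v)) // rdiffD //.
rewrite rdiff_rdiff // addr0; case: w => [|x [|y r]]; first by rewrite addr0.
  by rewrite /wdiff rdiff_nil rdiff1 !addr0 (morphD0 (@laD _)) (morphD0 (raD _)) addr0.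
rewrite rdiff_cons2 /= laM dE /= laD.
by rewrite -(rdiff_morph (laD x) (laraC x) F (y :: r)); char2.
Qed.

End Bimodule.
End RightHochschild.
Arguments rdiff : simpl never.

Section Multilinear.
Variables (L : Type) (add : L -> L -> L -> Prop).

(** [add a b c] means that [c] is the sum of [a] and [b]. It is a relation because letters of
    different degrees have no sum; over F_2 additivity in each letter is multilinearity. *)
Definition multiadditive (Y : zmodType) (F : seq L -> Y) :=
  forall u a b c v, add a b c -> F (u ++ c :: v) = F (u ++ a :: v) + F (u ++ b :: v).

Lemma multiadditive_cons (Y : zmodType) (F : seq L -> Y) x :
  multiadditive F -> multiadditive (fun w => F (x :: w)).
Proof. by move=> FM u a b c v; apply: (FM (x :: u)). Qed.

Lemma multiadditiveD (Y : lmodType F2) (F G : seq L -> Y) :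
  multiadditive F -> multiadditive G -> multiadditive (fun w => F w + G w).
Proof. by move=> FM GM u a b c v h; rewrite (FM _ _ _ _ _ h) (GM _ _ _ _ _ h); char2. Qed.

Lemma multiadditive_zero (Y : lmodType F2) (F : seq L -> Y) u a v :
  multiadditive F -> add a a a -> F (u ++ a :: v) = 0.
Proof. by move=> FM h; rewrite (FM _ _ _ _ _ h) addF2. Qed.

Variable mul : L -> L -> L.
Hypothesis addMl : forall x a b c, add a b c -> add (mul x a) (mul x b) (mul x c).
Hypothesis addMr : forall x a b c, add a b c -> add (mul a x) (mul b x) (mul c x).
Variables (Y : lmodType F2) (la ra : L -> Y -> Y).
Hypothesis laD : forall x, {morph la x : y z / y + z}.
Hypothesis raD : forall x, {morph ra x : y z / y + z}.
Hypothesis la_add : forall a b c y, add a b c -> la c y = la a y + la b y.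
Hypothesis ra_add : forall a b c y, add a b c -> ra c y = ra a y + ra b y.

Lemma multiadditive_rdiff (F : seq L -> Y) :
  multiadditive F -> multiadditive (rdiff mul ra F).
Proof.
move=> FM u a b c v h; elim: u F FM => [|x [|y u] IH] F FM.
- case: v => [|y r]; rewrite !(rdiff1, rdiff_cons2) /=; first exact: ra_add.
  rewrite (FM [::] _ _ _ r (addMr y h)) /=.
  rewrite (@eq_rdiff _ _ _ _ _ (fun v => F (a :: v) + F (b :: v))) => [|w _].
    by rewrite rdiffD //=; char2.
  exact: (FM [::]).
- have := IH _ (multiadditive_cons x FM); rewrite /= !rdiff_cons2 => ->.
  by rewrite (FM [::] _ _ _ v (addMl x h)) /=; char2.
- have := IH _ (multiadditive_cons x FM); rewrite /= !(rdiff_cons2 _ _ _ x) => ->.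
  by rewrite (FM (mul x y :: u) _ _ _ v h) /=; char2.
Qed.

Lemma multiadditive_diff (F : seq L -> Y) :
  multiadditive F -> multiadditive (wdiff mul la ra F).
Proof.
move=> FM u a b c v h; rewrite /wdiff (multiadditive_rdiff FM _ _ h).
case: u => [|x u] /=; first by rewrite (la_add _ h); char2.
by rewrite (FM _ _ _ _ _ h) laD; char2.
Qed.

End Multilinear.

(** * Removing units *)

Section UnitNormalization.
Variables (L : Type) (mul : L -> L -> L).
Variables (Y : lmodType F2) (la ra : L -> Y -> Y).
Hypothesis laD : forall x, {morph la x : y z / y + z}.
Hypothesis raD : forall x, {morph ra x : y z / y + z}.

Definition omul (x y : option L) := match x, y with
  | Some a, Some b => Some (mul a b)
  | Some _, None => x
  | None, _ => y end.
Definition oact (act : L -> Y -> Y) (x : option L) y := if x is Some a then act a y else y.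

Lemma oactD act : (forall x, {morph act x : y z / y + z}) ->
  forall x, {morph oact act x : y z / y + z}.
Proof. by move=> actD [x|] y z //=; rewrite actD. Qed.

Implicit Types F G : seq (option L) -> Y.
Let ola := oact la.
Let ora := oact ra.
Let olaD := oactD laD.
Let oraD := oactD raD.

Notation odiff := (wdiff omul ola ora).
Notation ordiff := (rdiff omul ora).

(** Doubles the first unit of the word. Exactly three terms of the differential of the doubled word
    involve one of the copies, and each gives the word back; three being odd, this contracts the
    words that contain a unit. *)
Fixpoint unit_homotopy F w := match w with
  | None :: w' => F (None :: None :: w')
  | Some x :: w' => unit_homotopy (fun v => F (Some x :: v)) w'
  | [::] => 0 end.

Arguments unit_homotopy : simpl nomatch.
Notation K := unit_homotopy.

Lemma eq_unit_homotopy F G w : (forall v, size v = (size w).+1 -> F v = G v) ->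
  K F w = K G w.
Proof.
elim: w F G => [//|[x|] w IH] F G E /=; last exact: E.
by apply: IH => v ev; apply: E; rewrite /= ev.
Qed.

Lemma unit_homotopyD F G w : K (fun v => F v + G v) w = K F w + K G w.
Proof. by elim: w F G => [|[x|] w IH] F G //=; rewrite addr0. Qed.

Lemma unit_homotopy_rdiff F x w :
  ordiff (K F) (x :: w) + K (ordiff F) (x :: w) =
  if x is Some _ then F (x :: w) + (if all isSome w then F (x :: w) else 0)
  else K F w.
Proof.
elim: w F x => [|y r IH] F [x|]; rewrite ?rdiff1 ?rdiff_cons2 /=.
- rewrite addF2 (morphD0 (raD x)); exact: addr0.
- by rewrite rdiff_cons2 rdiff1 /= add0r addF2.
- have -> : K (fun v => ordiff F (Some x :: v)) (y :: r) =
    K (fun v => (if v is z :: u then F (omul (Some x) z :: u) else ora (Some x) (F [::]))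
      + ordiff (fun u => F (Some x :: u)) v) (y :: r).
    by apply: eq_unit_homotopy => -[|z u] _; rewrite ?rdiff_nil ?addr0 // rdiff_cons2.
  rewrite unit_homotopyD addrACA [X in _ + X](IH (fun u => F (Some x :: u)) y).
  by case: y => [y|] /=; [rewrite addF2 add0r|rewrite addr0; char2].
- rewrite !rdiff_cons2 /=.
  have E u : K (fun v => F [:: None, None & v]) u = K (fun v => F [:: None, None & v]) u by [].
  case: y => [y|] /=; char2.
Qed.

Lemma unit_homotopyP F w :
  odiff (K F) w + K (odiff F) w = F w + (if all isSome w then F w else 0).
Proof.
case: w => [|x w] /=; first by rewrite /wdiff rdiff_nil !addr0 addF2.
pose lF v := if v is z :: u then ola z (F u) else 0.
have -> : K (odiff F) (x :: w) = K lF (x :: w) + K (ordiff F) (x :: w).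
  exact: unit_homotopyD.
rewrite /wdiff addrACA unit_homotopy_rdiff; case: x => [x|] /=; last char2.
rewrite {}/lF; have -> : K (fun v => la x (F v)) w = la x (K F w).
  by elim: w F => [|[y|] w IH] F //=; rewrite (morphD0 (laD x)).
by rewrite addF2 add0r.
Qed.

(** An isolated unit is merged once with its left and once with its right neighbour, and the two
    terms cancel. An initial unit has no left neighbour, which leaves [F w]; the left action
    compensates it in the full differential. *)
Lemma rdiff_normalized F : (forall w, ~~ all isSome w -> F w = 0) ->
  forall x w, ~~ all isSome (x :: w) ->
  ordiff F (x :: w) = if x is Some _ then 0 else F w.
Proof.
move=> F0 x w; elim: w F F0 x => [|y r IH] F F0 [x|] //= h.
  rewrite rdiff_cons2 IH => [|v hv|]; [|by rewrite F0 //= hv|exact: h].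
  by case: y h => [y|] h /=; [rewrite F0 ?addr0|rewrite addF2].
rewrite rdiff_cons2 /= rdiff_eq0 ?addr0 // => v _; exact: F0.
Qed.

Lemma diff_normalized F : (forall w, ~~ all isSome w -> F w = 0) ->
  forall w, ~~ all isSome w -> odiff F w = 0.
Proof.
move=> F0 [|x w] // h; rewrite /wdiff rdiff_normalized //.
by case: x h => [x|] h /=; rewrite ?addF2 // addr0 F0 // (morphD0 (laD x)).
Qed.

Lemma diff_unit_free F w :
  odiff F (map Some w) = wdiff mul la ra (fun v => F (map Some v)) w.
Proof.
rewrite /wdiff; congr (_ + _); first by case: w.
elim: w F => [|x [|y r] IH] F //.
by rewrite !rdiff_cons2 -(IH (fun v => F (Some x :: v))).
Qed.

Section Add.
Variable add : L -> L -> L -> Prop.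

(** The unit is the only nonzero element of degree 0 over F_2, so it takes part in no additivity
    relation. *)
Definition oadd (a b c : option L) := match a, b, c with
  | Some a, Some b, Some c => add a b c
  | _, _, _ => False end.

Lemma multiadditive_unit_homotopy F : multiadditive oadd F -> multiadditive oadd (K F).
Proof.
move=> FM u a b c v h; elim: u F FM => [|[x|] u IH] F FM /=; last first.
- exact: (FM [:: None, None & u] _ _ _ v h).
- exact: (IH _ (multiadditive_cons (Some x) FM)).
case: a b c h => [a|] // [b|] // [c|] //= h.
elim: v F FM => [|[x|] v IH] F FM /=; first by rewrite addr0.
  pose G a v := F (Some a :: v).
  have E a' : K (fun v0 => F [:: Some a', Some x & v0]) v =
    K (fun w => F (Some a' :: w)) (Some x :: v) by [].
  have -> : K (fun v0 => F [:: Some c, Some x & v0]) v =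
     K (fun v0 => F [:: Some a, Some x & v0] + F [:: Some b, Some x & v0]) v.
    by apply: eq_unit_homotopy => w _; exact: (FM [::] (Some a) (Some b) (Some c)).
  exact: unit_homotopyD.
exact: (FM [::] (Some a) (Some b) (Some c)).
Qed.

End Add.
End UnitNormalization.

(** * Letters and the Koszul contraction *)

Section Letters.
Variables (V : lmodType F2) (A : booleanRingType).

(* The letter [(e, (v, a))] stands for an element of degree [e + 1] of
   [V_* \sqcap A_*]; its component [v] is ignored unless [e = 0]. *)
Definition letter : Type := (nat * (V * A))%type.
Implicit Types l m n : letter.

Definition lval l : (V * A)%type := if l.1 is 0 then l.2 else (0, l.2.2).
Definition lmul l m : letter := ((l.1 + m.1).+1, (0, l.2.2 * m.2.2)).
Definition ladd l m n := [/\ l.1 = n.1, m.1 = n.1 & lval n = lval l + lval m].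
Definition lone (e : nat) : letter := (e, (0, 1)).
Definition lhead l : letter := (0, lval l).
Definition lraise (e : nat) l : letter := (e + l.1, l.2)%N.
Definition lprod l m : letter := (0, (0, l.2.2 * m.2.2)).

Lemma lmulA l m n : lmul l (lmul m n) = lmul (lmul l m) n.
Proof. by rewrite /lmul /= addnS addSn addnA mulrA. Qed.

Lemma lval2 l : (lval l).2 = l.2.2.
Proof. by case: l => [[|e] [v a]]. Qed.

Lemma ladd2 l m n : ladd l m n -> n.2.2 = l.2.2 + m.2.2.
Proof. by case=> _ _ /(congr1 snd); rewrite lval2 => -> /=; rewrite !lval2. Qed.

Lemma lmul_addr x l m n : ladd l m n -> ladd (lmul x l) (lmul x m) (lmul x n).
Proof.
move=> h; have [el em _] := h; split; rewrite /= ?el ?em //.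
by congr pair; rewrite /= ?addr0 // (ladd2 h) mulrDr.
Qed.

Lemma lmul_addl x l m n : ladd l m n -> ladd (lmul l x) (lmul m x) (lmul n x).
Proof.
move=> h; have [el em _] := h; split; rewrite /= ?el ?em //.
by congr pair; rewrite /= ?addr0 // (ladd2 h) mulrDl.
Qed.

Lemma lhead_add l m n : ladd l m n -> ladd (lhead l) (lhead m) (lhead n).
Proof. by case. Qed.

Lemma lraise_add e l m n : ladd l m n -> ladd (lraise e l) (lraise e m) (lraise e n).
Proof.
move=> h; have [el em en] := h; split; rewrite /= ?el ?em //.
case: e => [|e]; first by rewrite /lval /= !add0n; exact: en.
by congr pair; rewrite /= ?addr0 // (ladd2 h).
Qed.

Lemma lprod_addl x l m n : ladd l m n -> ladd (lprod l x) (lprod m x) (lprod n x).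
Proof.
by move=> h; split=> //; congr pair; rewrite /= ?addr0 // (ladd2 h) mulrDl.
Qed.

Lemma lprod_addr x l m n : ladd l m n -> ladd (lprod x l) (lprod x m) (lprod x n).
Proof.
by move=> h; split=> //; congr pair; rewrite /= ?addr0 // (ladd2 h) mulrDr.
Qed.

Lemma ladd_zero e : ladd (e, 0) (e, 0) (e, 0).
Proof. by split=> //; rewrite /lval /=; case: e => [|e]; congr pair; rewrite ?addr0. Qed.

Variable Y : lmodType F2.
Implicit Types F G : seq letter -> Y.
Notation multiadd := (multiadditive ladd).

Lemma multiadd_zero F u e v : multiadd F -> F (u ++ (e, 0) :: v) = 0.
Proof. by move=> FM; rewrite (multiadditive_zero _ _ FM) //; apply: ladd_zero. Qed.

Lemma multiadd_lval F u l m v : multiadd F -> l.1 = m.1 -> lval l = lval m ->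
  F (u ++ l :: v) = F (u ++ m :: v).
Proof.
move=> FM e1 e2; rewrite (FM u (l.1, 0) m l) ?multiadd_zero ?add0r //; split=> //.
by rewrite e2; case: (l.1) => [|e]; rewrite /lval /= ?add0r //; case: (if _ is _ then _ else _) => *; congr pair; rewrite add0r.
Qed.

Notation mergesum := (rdiff lmul (fun=> fun=> 0 : Y)).

Let zeroD : forall x : letter, {morph (fun=> 0 : Y) : y z / (y : Y) + z}.
Proof. by move=> x y z; rewrite addr0. Qed.

Definition lsplit F l v : Y := if l.1 is e.+1 then F [:: lhead l, lone e & v] else 0.

(** A letter of degree above 1 is the product of its head in degree 1 and a unit [lone e]; [lsplit]
    undoes this product. The recursive calls continue with the first letters [lhead l],
    [lraise l.1 m] and [lprod l m], [lone (l.1 + m.1)]. Both pairs have the same product, so their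
    sum is a quadratic relation, and both move the excess degree to the right. *)
Fixpoint koszul_homotopy_cons F l w := match w with
  | [::] => lsplit F l [::]
  | m :: r => lsplit F l w
    + koszul_homotopy_cons (fun v => F (lhead l :: v)) (lraise l.1 m) r
    + koszul_homotopy_cons (fun v => F (lprod l m :: v)) (lone (l.1 + m.1)) r
  end.

Definition koszul_homotopy F w :=
  if w is l :: r then koszul_homotopy_cons F l r else 0.

(** On two letters a, b of degree 1 this evaluates [F] on a ⊗ b + ab ⊗ 1, the projection onto the
    kernel of the multiplication. All excess degree arrives at the last letter, so the value is zero
    as soon as some letter has degree above 1. *)
Fixpoint koszul_proj_cons F l w := match w with
  | [::] => if l.1 is 0 then F [:: l] else 0
  | m :: r => koszul_proj_cons (fun v => F (lhead l :: v)) (lraise l.1 m) r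
    + koszul_proj_cons (fun v => F (lprod l m :: v)) (lone (l.1 + m.1)) r
  end.

(* The restriction of a cochain to the Koszul complex. *)
Definition koszul_proj F w := if w is l :: r then koszul_proj_cons F l r else 0.

Notation T := koszul_homotopy_cons.

Lemma eq_koszul_homotopy_cons F G l w :
  (forall v, size v = (size w).+2 -> F v = G v) -> T F l w = T G l w.
Proof.
elim: w F G l => [|m r IH] F G l E /=.
  by rewrite /lsplit; case: l.1 => // e; rewrite E.
rewrite (IH (fun v => F (lhead l :: v)) (fun v => G (lhead l :: v))) => [|v ev]; last first.
  by rewrite /= E //= ev.
rewrite (IH (fun v => F (lprod l m :: v)) (fun v => G (lprod l m :: v))) => [|v ev]; last first.
  by rewrite /= E //= ev.
by rewrite /lsplit; case: l.1 => // e; rewrite E.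
Qed.

Lemma koszul_homotopy_consD F G l w : T (fun v => F v + G v) l w = T F l w + T G l w.
Proof.
have sD F' G' v : lsplit (fun v => F' v + G' v) l v = lsplit F' l v + lsplit G' l v.
  by rewrite /lsplit; case: l.1 => [|e]; rewrite ?addr0.
elim: w F G l sD => [|m r IH] F G l sD /=; first by rewrite sD.
rewrite sD !IH => [|F' G' v|F' G' v]; first by char2.
  by rewrite /lsplit; case: (lone _).1 => [|e]; rewrite ?addr0.
by rewrite /lsplit; case: (lraise _ _).1 => [|e]; rewrite ?addr0.
Qed.

Let shift F x v := if v is y :: u then F (lmul x y :: u) else 0.

(** [shift F x] sees the next letter only through its product with [x], and this product is also
    that of [lprod x l] and a unit. *)
Lemma koszul_homotopy_shift F x l w : x.1 = 0%N ->
  T (shift F x) l w = T (shift F (lprod x l)) (lone l.1) w.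
Proof.
move=> x0; have E1 : lmul x (lhead l) = lmul (lprod x l) (lhead (lone l.1)).
  by rewrite /lmul /= x0 !lval2 mulr1.
have E2 m : lmul x (lprod l m) = lmul (lprod x l) (lprod (lone l.1) m).
  by rewrite /lmul /= x0 mul1r mulrA.
have S v : lsplit (shift F x) l v = lsplit (shift F (lprod x l)) (lone l.1) v.
  by rewrite /lsplit /=; case: l.1 E1 => //= e ->.
by case: w => [|m r] //=; rewrite S E1 E2.
Qed.

Lemma koszul_homotopy_cons_lval F l l' w : l.1 = l'.1 -> lval l = lval l' ->
  T F l w = T F l' w.
Proof.
move=> e1 e2; have eh : lhead l = lhead l' by rewrite /lhead e2.
have e3 : l.2.2 = l'.2.2 by rewrite -!lval2 e2.
by case: w => [|m r]; rewrite /= /lsplit ?e1 ?eh // /lprod e3.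
Qed.

(** The first merge joins the two halves of [l] again, the second joins the unit half with [m]; all
    further merges happen to the right of the split. *)
Lemma lsplit_mergesum F l m r : multiadd F ->
  lsplit (mergesum F) l (m :: r) =
  (if l.1 is e.+1 then F [:: l, m & r] + F [:: lhead l, lraise l.1 m & r] else 0)
  + mergesum (lsplit F l) (m :: r).
Proof.
move=> FM; case: l => -[|e] x; first by rewrite rdiff0 ?addr0.
rewrite -[LHS]/(mergesum F [:: lhead (e.+1, x), lone e, m & r]) !(rdiff_cons2 _ _ _ (_, _)) addrA.
congr (_ + _ + _).
  by apply: (multiadd_lval [::]); rewrite //= /lval /= mulr1.
apply: (multiadd_lval [:: _]); rewrite //= /lval /= ?addSn ?addnS //.
by rewrite mul1r.
Qed.

(** Induction applies to the two continuations [F1] and [F2] of the recursion. The terms left over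
    merge across the first letter, and they cancel because both continuations have the same product
    there. *)
Lemma koszul_homotopyP F w : multiadd F ->
  mergesum (koszul_homotopy F) w + koszul_homotopy (mergesum F) w =
  F w + (if w is [::] then F [::] else koszul_proj F w).
Proof.
case: w => [|l w] FM; first by rewrite rdiff_nil addr0 addF2.
rewrite /koszul_homotopy /koszul_proj.
elim: w F l FM => [|m r IH] F l FM.
  rewrite rdiff1 add0r /= /lsplit; case: l => -[|e] [v a] /=; first by rewrite addF2.
  rewrite rdiff_cons2 rdiff1 !addr0 -[LHS]/(F ([::] ++ _ :: [::])).
  by apply: (multiadd_lval [::]); rewrite // /lval /= mulr1.
pose F1 v := F (lhead l :: v); pose F2 v := F (lprod l m :: v).
pose q1 := lraise l.1 m; pose q2 := lone (l.1 + m.1).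
have FM1 : multiadd F1 := multiadditive_cons _ FM.
have FM2 : multiadd F2 := multiadditive_cons _ FM.
have I1 := IH F1 q1 FM1; have I2 := IH F2 q2 FM2.
have cons_rdiff x w : T (fun v => mergesum F (x :: v)) w r = 
   T (shift F x) w r + T (mergesum (fun v => F (x :: v))) w r.
  rewrite -koszul_homotopy_consD; apply: eq_koszul_homotopy_cons => -[|y u] // _.
rewrite rdiff_cons2 [T (mergesum F) l _]/= !cons_rdiff -/F1 -/F2 -/q1 -/q2.
have -> : T (shift F (lhead l)) q1 r = T (shift F (lprod l m)) (lone q1.1) r.
  by rewrite koszul_homotopy_shift // /lprod /= lval2.
have -> : T (shift F (lprod l m)) q2 r = T (shift F (lprod l m)) (lone q1.1) r by [].
rewrite [koszul_proj_cons F l _]/= -/F1 -/F2 -/q1 -/q2.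
have addr_transp (a b c d : Y) : a + b = c + d -> b = c + d + a by move=> <-; char2.
rewrite (addr_transp _ _ _ _ I1) (addr_transp _ _ _ _ I2).
rewrite lsplit_mergesum //.
have -> : (if l.1 is e.+1 then F [:: l, m & r] + F [:: lhead l, lraise l.1 m & r] else 0)
    = F [:: l, m & r] + F1 (q1 :: r).
  rewrite /F1 /q1; case: l {I1 I2 F1 F2 FM1 FM2 q1 q2 cons_rdiff} => -[|e] x //=.
  by rewrite /lraise add0n -surjective_pairing addF2.
case: r {IH} I1 I2 cons_rdiff => [|n r] I1 I2 cons_rdiff.
  by rewrite !rdiff1 -[T F (lmul l m) [::]]/(F2 [:: q2]); char2.
pose F3 v := F (lprod (lmul l m) n :: v).
have -> : T F (lmul l m) (n :: r) = F2 (q2 :: n :: r)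
    + T F2 (lmul q2 n) r + T F3 (lone (l.1 + m.1 + n.1).+1) r.
  rewrite -[LHS]/(F2 (q2 :: n :: r) + T F2 (lraise (l.1 + m.1).+1 n) r
    + T F3 (lone ((l.1 + m.1).+1 + n.1)) r) addSn; congr (_ + _ + _).
  by apply: koszul_homotopy_cons_lval; rewrite //= /lval /= mul1r.
rewrite !rdiff_cons2.
have -> : mergesum (fun v => T F l (m :: v)) (n :: r) =
    mergesum (fun v => lsplit F l (m :: v)) (n :: r)
    + mergesum (T F1 q1) (n :: r) + mergesum (T F2 q2) (n :: r).
  by rewrite -!rdiffD.
have -> : T F l (lmul m n :: r) = lsplit F l (lmul m n :: r)
    + T F1 (lmul q1 n) r + T F3 (lone (l.1 + m.1 + n.1).+1) r.
  rewrite -[LHS]/(_ + T F1 (lraise l.1 (lmul m n)) r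
    + T (fun v => F (lprod l (lmul m n) :: v)) (lone (l.1 + (m.1 + n.1).+1)) r).
  rewrite /lraise addnS addnA; congr (_ + _ + _).
  by rewrite /F3 /lprod /= mulrA.
rewrite -/F1 -/F2 -/q1 -/q2; char2.
Qed.

End Letters.

Section Rcons.
Variables (L : Type) (mul : L -> L -> L) (Y : lmodType F2) (ra : L -> Y -> Y).

Lemma rdiff_rcons F u x : rdiff mul ra F (rcons u x) =
  rdiff mul (fun=> fun=> 0) F (rcons u x) + ra x (F u).
Proof.
elim: u F => [|y u IH] F; first by rewrite !rdiff1 add0r.
case: u IH => [|z u] IH; rewrite !rcons_cons !rdiff_cons2.
  by rewrite !rdiff1 addr0.
by have := IH (fun v => F (y :: v)); rewrite rcons_cons => ->; rewrite addrA.
Qed.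

Lemma wdiff_ends (la : L -> Y -> Y) F w l u v m : w = l :: u -> w = rcons v m ->
  wdiff mul la ra F w = la l (F u) + (rdiff mul (fun=> fun=> 0) F w + ra m (F v)).
Proof. by move=> wl wm; rewrite /wdiff wm rdiff_rcons -wm wl. Qed.

End Rcons.

Section Koszul.
Variables (V : lmodType F2) (A : booleanRingType) (Y : lmodType F2).
Local Notation letter := (letter V A).
Local Notation lmul := (@lmul V A).
Local Notation ladd := (@ladd V A).
Implicit Types (F G : seq letter -> Y) (l m : letter).
Notation multiadd := (multiadditive ladd).
Notation T := koszul_homotopy_cons.
Notation mergesum := (rdiff lmul (fun=> fun=> 0 : Y)).

Definition excess (w : seq letter) : nat := sumn (map fst w).

Lemma excess_cons l w : excess (l :: w) = (l.1 + excess w)%N.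
Proof. by []. Qed.

Lemma excess_rcons l w : excess (rcons w l) = (excess w + l.1)%N.
Proof. by rewrite /excess map_rcons sumn_rcons. Qed.

Section Closure.
Variable P : Y -> Prop.
Hypothesis P0 : P 0.
Hypothesis PD : forall x y, P x -> P y -> P (x + y).

(** [P] is any subgroup of values. With [P] the zero subgroup the lemma records which words the
    operator reads, namely one letter longer and of excess smaller by one; with [P] a graded piece
    it gives homogeneity. The next two lemmas have the same double use. *)
Lemma koszul_homotopy_closed F w :
  (forall u, size u = (size w).+1 -> (excess u).+1 = excess w -> P (F u)) ->
  P (koszul_homotopy F w).
Proof.
case: w => [//|l w] /=; elim: w F l => [|m r IH] F l PF /=.
  by rewrite /lsplit; case: l PF => -[|e] x PF //; apply: PF.
apply: (PD); first apply: (PD).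
- by rewrite /lsplit; case: l PF => -[|e] x PF //; apply: PF.
- by apply: IH => u su eu; apply: PF; rewrite ?excess_cons /= ?su // eu !excess_cons addnA.
- by apply: IH => u su eu; apply: PF; rewrite ?excess_cons /= ?su // eu !excess_cons addnA.
Qed.

Lemma koszul_proj_closed F w :
  (forall u, size u = size w -> excess u = 0%N -> excess w = 0%N -> P (F u)) ->
  P (koszul_proj F w).
Proof.
case: w => [//|l w] /=; elim: w F l => [|m r IH] F l PF /=.
  by case: l PF => -[|e] x PF //; apply: PF.
apply: PD; apply: IH => u su eu ew; apply: PF;
  rewrite ?excess_cons /= ?su // ?eu //; move: ew; rewrite !excess_cons /=; lia.
Qed.

Lemma mergesum_closed F w :
  (forall u, (size u).+1 = size w -> excess u = (excess w).+1 -> P (F u)) ->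
  P (mergesum F w).
Proof.
elim: w F => [|x [|y r] IH] F PF; rewrite ?rdiff_nil ?rdiff1 // rdiff_cons2.
apply: PD; first by apply: PF; rewrite // !excess_cons /=; lia.
by apply: IH => u su eu; apply: PF; rewrite /= ?su // excess_cons eu !excess_cons; lia.
Qed.

End Closure.

Lemma koszul_proj_consD F G l w :
  koszul_proj_cons (fun v => F v + G v) l w = koszul_proj_cons F l w + koszul_proj_cons G l w.
Proof.
elim: w F G l => [|m r IH] F G l /=; first by case: l.1; rewrite ?addr0.
by rewrite !IH; char2.
Qed.

Lemma eq_koszul_proj_cons F G l w :
  (forall v, size v = (size w).+1 -> F v = G v) ->
  koszul_proj_cons F l w = koszul_proj_cons G l w.
Proof.
elim: w F G l => [|m r IH] F G l E /=; first by rewrite E.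
rewrite (IH (fun v => F (lhead l :: v)) (fun v => G (lhead l :: v))) => [|v ev]; last first.
  by rewrite /= E //= ev.
rewrite (IH (fun v => F (lprod l m :: v)) (fun v => G (lprod l m :: v))) // => v ev.
by rewrite /= E //= ev.
Qed.

(** At each place the two branches of the projection have the same product, so every merge
    cancels. *)
Lemma koszul_proj_mergesum F w : koszul_proj (mergesum F) w = 0.
Proof.
case: w => [//|l w] /=; elim: w F l => [|m r IH] F l /=; first by case: l.1.
pose shift x v := if v is y :: u then F (lmul x y :: u) else 0.
have shiftE x l' v : x.1 = 0%N ->
    koszul_proj_cons (shift x) l' v = koszul_proj_cons (shift (lprod x l')) (lone _ _ l'.1) v.
  move=> x0; case: v => [|y v] /=.
    by case: l' => -[|e] y //=; rewrite /lmul /= x0 mulr1.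
  congr (_ + _); apply: eq_koszul_proj_cons => z _ /=; congr (F (_ :: _)).
    by rewrite /lmul /= x0 !lval2 mulr1.
  by rewrite /lmul /= x0 mul1r mulrA.
have cons_rdiff x l' : koszul_proj_cons (fun v => mergesum F (x :: v)) l' r =
    koszul_proj_cons (shift x) l' r.
  transitivity (koszul_proj_cons (shift x) l' r
    + koszul_proj_cons (mergesum (fun v => F (x :: v))) l' r).
    by rewrite -koszul_proj_consD; apply: eq_koszul_proj_cons => -[|y u].
  by rewrite [X in _ + X](IH (fun v => F (x :: v)) l') addr0.
rewrite !cons_rdiff shiftE //.
have -> : lprod (lhead l) (lraise l.1 m) = lprod l m by rewrite /lprod /= lval2.
exact: addF2.
Qed.

Lemma multiadd_koszul_homotopy F : multiadd F -> multiadd (koszul_homotopy F).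
Proof.
have head F' a b c w : multiadd F' -> ladd a b c -> T F' c w = T F' a w + T F' b w.
  move=> FM h; have [ea eb _] := h.
  have spl v : lsplit F' c v = lsplit F' a v + lsplit F' b v.
    rewrite /lsplit ea eb; case: c.1 => [|e]; rewrite ?addr0 //.
    exact: (FM [::] _ _ _ _ (lhead_add h)).
  case: w => [|m r] /=; first exact: spl.
  rewrite spl ea eb.
  rewrite (@eq_koszul_homotopy_cons _ _ _ (fun v => F' (lhead c :: v))
    (fun v => F' (lhead a :: v) + F' (lhead b :: v))) => [|v _]; last first.
    exact: (FM [::] _ _ _ _ (lhead_add h)).
  rewrite (@eq_koszul_homotopy_cons _ _ _ (fun v => F' (lprod c m :: v))
    (fun v => F' (lprod a m :: v) + F' (lprod b m :: v))) => [|v _]; last first.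
    exact: (FM [::] _ _ _ _ (lprod_addl m h)).
  by rewrite !koszul_homotopy_consD; char2.
move=> FM [|l u] a b c v h /=; first exact: head.
elim: u F l FM => [|m u IH] F l FM /=; last first.
  rewrite (IH _ _ (multiadditive_cons _ FM)) (IH _ _ (multiadditive_cons _ FM)).
  rewrite {1 2 3}/lsplit.
  case: l.1 => [|e]; first by char2.
  by rewrite (FM [:: lhead l, lone _ _ e, m & u] _ _ _ v h) /=; char2.
have [ea eb _] := h; rewrite ea eb.
rewrite (head _ _ _ _ _ (multiadditive_cons _ FM) (lraise_add l.1 h)).
rewrite (@eq_koszul_homotopy_cons _ _ _ (fun v => F (lprod l c :: v))
    (fun v => F (lprod l a :: v) + F (lprod l b :: v))) => [|w _]; last first.
  exact: (FM [::] _ _ _ _ (lprod_addr l h)).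
rewrite koszul_homotopy_consD {1 2 3}/lsplit; case: l.1 => [|e]; first by char2.
by rewrite (FM [:: lhead l; lone _ _ e] _ _ _ v h) /=; char2.
Qed.

End Koszul.

(** * Perturbing the Koszul contraction by the bimodule action *)

Section Perturbation.
Variables (V : lmodType F2) (A : booleanRingType) (Y : lmodType F2).
Local Notation letter := (letter V A).
Local Notation lmul := (@lmul V A).
Local Notation ladd := (@ladd V A).
Implicit Types (F G : seq letter -> Y) (l m : letter).
Notation multiadd := (multiadditive ladd).
Notation mergesum := (rdiff lmul (fun=> fun=> 0 : Y)).
Notation S := koszul_homotopy.

Variables la ra : letter -> Y -> Y.
Hypothesis laD : forall x, {morph la x : y z / y + z}.
Hypothesis raD : forall x, {morph ra x : y z / y + z}.
Hypothesis laM : forall x y z, la (lmul x y) z = la x (la y z).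
Hypothesis raM : forall x y z, ra (lmul x y) z = ra y (ra x z).
Hypothesis laraC : forall x y z, la x (ra y z) = ra y (la x z).
Hypothesis la_add : forall a b c y, ladd a b c -> la c y = la a y + la b y.
Hypothesis ra_add : forall a b c y, ladd a b c -> ra c y = ra a y + ra b y.

Notation diff := (wdiff lmul la ra).

Variable hom : nat -> Y -> Prop.
Hypothesis hom0 : forall n, hom n 0.
Hypothesis homD : forall n x y, hom n x -> hom n y -> hom n (x + y).
Hypothesis hom_la : forall n l y, hom n y -> hom (l.1.+1 + n) (la l y).
Hypothesis hom_ra : forall n l y, hom n y -> hom (l.1.+1 + n) (ra l y).

Definition weight (w : seq letter) : nat := (size w + excess w)%N.
Definition homogeneous F := forall w, hom (weight w) (F w).

Let zeroD : forall x : letter, {morph (fun=> 0 : Y) : y z / (y : Y) + z}.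
Proof. by move=> x y z; rewrite addr0. Qed.

(** In characteristic two adding [mergesum] removes the merging terms, leaving the actions of the
    first and of the last letter. *)
Definition action F w : Y := diff F w + mergesum F w.

Lemma action_closed (P : Y -> Prop) F w : P 0 -> (forall x y, P x -> P y -> P (x + y)) ->
  (forall l u, size w = (size u).+1 -> excess w = (l.1 + excess u)%N ->
     P (la l (F u)) /\ P (ra l (F u))) -> P (action F w).
Proof.
move=> P0 PD PF; case: w PF => [|l w] PF; first by rewrite /action /wdiff !addr0.
have Pl : P (la l (F w)) by have [] := PF l w erefl erefl.
have [u [x ew]] : exists u x, l :: w = rcons u x.
  by exists (belast l w), (last l w); exact: lastI.
have -> : action F (l :: w) = la l (F w) + ra x (F u).
  by rewrite /action /wdiff ew rdiff_rcons -ew; char2.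
apply: PD Pl _; have [//|//|//] := PF x u _ _; rewrite ew ?size_rcons // excess_rcons.
by rewrite addnC.
Qed.

Lemma eq_diff_excess F G w :
  (forall v, (size v).+1 = size w -> (excess v <= (excess w).+1)%N -> F v = G v) ->
  diff F w = diff G w.
Proof.
move=> E; have dE H : diff H w = action H w + mergesum H w by rewrite /action; char2.
suff : diff (fun v => F v + G v) w = 0.
  by rewrite diffD // => /(congr1 (+%R^~ (diff G w))); rewrite -addrA addF2 addr0 add0r.
have E0 v : (size v).+1 = size w -> (excess v <= (excess w).+1)%N -> F v + G v = 0.
  by move=> sv ev; rewrite E // addF2.
rewrite dE (_ : action _ w = 0) ?add0r.
  apply: (mergesum_closed (P := fun y => y = 0)) => [//|_ _ -> ->|u su eu]; rewrite ?addr0 //.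
  by apply: E0 => //; rewrite eu.
apply: (action_closed (P := fun y => y = 0)) => [//|_ _ -> ->|l u su eu]; rewrite ?addr0 //.
by rewrite E0 ?su // ?(morphD0 (laD l)) ?(morphD0 (raD l)) //; rewrite eu; lia.
Qed.

Lemma multiadd_mergesum F : multiadd F -> multiadd (mergesum F).
Proof.
apply: multiadditive_rdiff => //; [exact: lmul_addr|exact: lmul_addl|].
by move=> *; rewrite addr0.
Qed.

Lemma multiadd_diff F : multiadd F -> multiadd (diff F).
Proof. by apply: multiadditive_diff => //; [exact: lmul_addr|exact: lmul_addl]. Qed.

Lemma multiadd_action F : multiadd F -> multiadd (action F).
Proof. by move=> FM; apply: multiadditiveD; [exact: multiadd_diff|exact: multiadd_mergesum]. Qed.

Lemma homogeneous_koszul_homotopy F : homogeneous F -> homogeneous (S F).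
Proof.
move=> Fh w; apply: koszul_homotopy_closed => // [x y|u su eu]; first exact: homD.
by rewrite /weight -eu addnS -addSn -su; apply: Fh.
Qed.

Lemma homogeneous_action F : homogeneous F -> homogeneous (action F).
Proof.
move=> Fh w; apply: action_closed => // [x y|l u su eu]; first exact: homD.
have -> : weight w = (l.1.+1 + weight u)%N by rewrite /weight su eu; lia.
by split; [apply: hom_la|apply: hom_ra]; apply: Fh.
Qed.

(** The error made by using a contraction of the merging part for the whole differential. It
    preserves the length but reads only words of strictly smaller excess, since the homotopy lowers
    the excess and the action does not raise it. *)
Definition perturbation F w : Y := action (S F) w + S (action F) w.
Notation eps := perturbation.

Lemma diff_koszul_homotopy F w : multiadd F -> (0 < size w)%N ->
  diff (S F) w + S (diff F) w = F w + koszul_proj F w + eps F w.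
Proof.
case: w => [//|l w] FM _; have H := koszul_homotopyP (l :: w) FM.
have Sact : S (action F) (l :: w) = S (diff F) (l :: w) + S (mergesum F) (l :: w).
  exact: koszul_homotopy_consD.
by rewrite /eps Sact -H /action; char2.
Qed.

(** The primitive is the geometric series with terms [S (Fi i)], where [Fi i] is the [i]-th iterate
    of [eps] on [F]; its differential telescopes. *)
Theorem koszul_exact k F : (0 < k)%N -> multiadd F -> homogeneous F ->
  (forall w, size w = k.+1 -> diff F w = 0) ->
  (forall w, size w = k -> koszul_proj F w = 0) ->
  exists G, [/\ multiadd G, homogeneous G & forall w, size w = k -> diff G w = F w].
Proof.
move=> k_gt0 FM Fh dF0 RF0; pose Fi i := iter i eps F.
have FiM i : multiadd (Fi i).
  elim: i => //= i IH; apply: multiadditiveD.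
    by apply: multiadd_action; exact: multiadd_koszul_homotopy.
  by apply: multiadd_koszul_homotopy; exact: multiadd_action.
have Fih i : homogeneous (Fi i).
  elim: i => //= i IH w; apply: homD.
    by apply: homogeneous_action; exact: homogeneous_koszul_homotopy.
  by apply: homogeneous_koszul_homotopy; exact: homogeneous_action.
have Fi0 i w : size w = k -> (excess w < i)%N -> Fi i w = 0.
  elim: i w => // i IH w sw ew.
  rewrite -[LHS]/(action (S (Fi i)) w + S (action (Fi i)) w) (_ : action _ w = 0) ?add0r.
    apply: (koszul_homotopy_closed (P := fun y => y = 0)) => [//|_ _ -> ->|u su eu];
      rewrite ?addr0 //.
    apply: (action_closed (P := fun y => y = 0)) => [//|_ _ -> ->|l v sv ev];
      rewrite ?addr0 //.
    have -> : Fi i v = 0 by apply: IH; lia.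
    by rewrite (morphD0 (laD l)) (morphD0 (raD l)).
  apply: (action_closed (P := fun y => y = 0)) => [//|_ _ -> ->|l v sv ev];
    rewrite ?addr0 //.
  have -> : S (Fi i) v = 0.
    apply: (koszul_homotopy_closed (P := fun y => y = 0)) => [//|_ _ -> ->|u su eu];
      rewrite ?addr0 //.
    by apply: IH; lia.
  by rewrite (morphD0 (laD l)) (morphD0 (raD l)).
(* For [i > 0] the projection reads only words of excess 0, on which [Fi i] vanishes. *)
have RFi i w : size w = k -> koszul_proj (Fi i) w = 0.
  case: i => [|i] sw; first exact: RF0.
  apply: (koszul_proj_closed (P := fun y => y = 0)) => [//|_ _ -> ->|u su eu _];
    rewrite ?addr0 //.
  by apply: Fi0; rewrite ?su // eu.
have nnil (w : seq letter) : size w = k -> (0 < size w)%N by move=> ->.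
have S0 i w : (forall w, size w = k.+1 -> diff (Fi i) w = 0) -> size w = k ->
    S (diff (Fi i)) w = 0.
  move=> dFi sw.
  apply: (koszul_homotopy_closed (P := fun y => y = 0)) => [//|_ _ -> ->|u su _];
    rewrite ?addr0 //.
  by apply: dFi; rewrite su sw.
have step i : (forall w, size w = k.+1 -> diff (Fi i) w = 0) ->
    forall w, size w = k -> diff (S (Fi i)) w = Fi i w + Fi i.+1 w.
  move=> dFi w sw; have := diff_koszul_homotopy (FiM i) (nnil _ sw).
  by rewrite S0 // RFi // !addr0.
have dFi i w : size w = k.+1 -> diff (Fi i) w = 0.
  elim: i w => [|i IH] w sw; first exact: dF0.
  rewrite (@eq_diff _ _ _ _ _ _ (fun v => Fi i v + diff (S (Fi i)) v)) => [|v sv].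
    rewrite diffD // IH // add0r; apply: diff_diff => //; exact: lmulA.
  rewrite step; first by rewrite addrA addF2 add0r.
    by move=> u; apply: IH.
  by apply/eqP; rewrite -eqSS sv sw.
(* The omitted terms vanish: [S (Fi i)] reads words of excess [(excess w).-1], where [Fi i] is zero
   for [i >= excess w]. *)
exists (fun w => \sum_(i < excess w) S (Fi i) w); split.
- move=> u a b c v h; have [ea eb _] := h.
  have exE x : x.1 = c.1 -> excess (u ++ x :: v) = excess (u ++ c :: v).
    by move=> e; rewrite /excess !map_cat !sumn_cat /= e.
  rewrite !exE // -big_split; apply: eq_bigr => i _.
  exact: (multiadd_koszul_homotopy (FiM i)).
- move=> w; elim/big_ind: _ => // [x y|i _]; first exact: homD.
  by apply: homogeneous_koszul_homotopy.
move=> w sw; have sum_const v n : (size v).+1 = k -> (excess v <= n)%N ->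
    \sum_(i < excess v) S (Fi i) v = \sum_(i < n) S (Fi i) v.
  move=> sv len; rewrite -!(big_mkord xpredT (fun i => S (Fi i) v)).
  rewrite [RHS](@big_cat_nat _ _ _ (excess v)) //= [X in _ = _ + X]big_nat [X in _ = _ + X]big1 ?addr0 // => i /andP[lei _].
  apply: (koszul_homotopy_closed (P := fun y => y = 0)) => [//|_ _ -> ->|u su eu];
    rewrite ?addr0 //.
  by apply: Fi0; lia.
(* Merging raises the excess by one, so [(excess w).+1] bounds the excess of all words entering the
   differential at [w] and makes the number of summands uniform. *)
rewrite (eq_diff_excess (G := fun v => \sum_(i < (excess w).+1) S (Fi i) v)); last first.
  by move=> v sv ev; apply: sum_const; rewrite // sv.
rewrite (@diff_sum _ _ _ _ _ laD raD _ (fun i => S (Fi i))).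
have -> n : \sum_(i < n) diff (S (Fi i)) w = F w + Fi n w.
  elim: n => [|n IH]; first by rewrite big_ord0 addF2.
  by rewrite big_ord_recr /= IH (step n (dFi n)) //; char2.
by rewrite Fi0 ?addr0.
Qed.

End Perturbation.

(** * Word functions with values in a Boolean ring *)

Section BooleanRings.
Variable B : booleanRingType.

Lemma boolr_idem (x : B) : x * x = x.
Proof. exact: boolr_sqr. Qed.

Definition boolr_smul (x : B) (y : boolr_vect B) : boolr_vect B := x * (y : B).

Lemma boolr_smulDr x : {morph boolr_smul x : y z / y + z}.
Proof. by move=> y z; exact: mulrDr. Qed.
Lemma boolr_smulDl x y z : boolr_smul (x + y) z = boolr_smul x z + boolr_smul y z.
Proof. exact: mulrDl. Qed.
Lemma boolr_smulA x y z : boolr_smul (x * y) z = boolr_smul x (boolr_smul y z).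
Proof. by rewrite /boolr_smul mulrA. Qed.
Lemma boolr_smulC x y z : boolr_smul x (boolr_smul y z) = boolr_smul y (boolr_smul x z).
Proof. exact: mulrCA. Qed.
Lemma boolr_smul_idem x z : boolr_smul x (boolr_smul x z) = boolr_smul x z.
Proof. by rewrite -boolr_smulA boolr_idem. Qed.
Lemma boolr_smul1 z : boolr_smul 1 z = z.
Proof. exact: mul1r. Qed.
Lemma boolr_smul0l z : boolr_smul 0 z = 0.
Proof. exact: mul0r. Qed.
Lemma boolr_smul0r x : boolr_smul x 0 = 0.
Proof. exact: mulr0. Qed.
Lemma boolr_smul_sumr (I : Type) (r : seq I) (P : pred I) x (F : I -> boolr_vect B) :
  boolr_smul x (\sum_(i <- r | P i) F i) = \sum_(i <- r | P i) boolr_smul x (F i).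
Proof. exact: (big_morph _ (@boolr_smulDr x) (boolr_smul0r x)). Qed.
Lemma boolr_smul_suml (I : Type) (r : seq I) (P : pred I) (F : I -> B) x :
  boolr_smul (\sum_(i <- r | P i) F i) x = \sum_(i <- r | P i) boolr_smul (F i) x.
Proof.
exact: (big_morph (fun b => boolr_smul b x) (fun y z => boolr_smulDl y z x) (boolr_smul0l x)).
Qed.

End BooleanRings.

(** * Contraction over a finite Boolean subalgebra *)

Section Atoms.
Variables (A : booleanRingType) (n : nat) (s : 'I_n -> A).

Definition atom (c : {ffun 'I_n -> bool}) : A :=
  \prod_i (if c i then s i else 1 + s i).

(** The sum is the expansion of the product of the factors [s i + (1 + s i)], each equal to 1. *)
Lemma atom_sum : \sum_c atom c = 1.
Proof.
rewrite /atom -(bigA_distr_bigA (fun i (b : bool) => if b then s i else 1 + s i)).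
rewrite big1 // => i _; rewrite big_bool /= addrCA.
by have -> : s i + s i = 0 := boolr_addrr (s i); rewrite addr0.
Qed.

Lemma atom_absorb i c : s i * atom c = if c i then atom c else 0.
Proof.
rewrite /atom (bigD1 i) //= mulrA; case: (c i); first by rewrite boolr_idem.
by rewrite mulrDr mulr1 boolr_idem boolr_addrr mul0r.
Qed.

Lemma atom_ortho c c' : c != c' -> atom c * atom c' = 0.
Proof.
move=> /eqP cc'; have [i ci] : exists i, c i != c' i.
  apply/existsP; rewrite -[[exists _, _]]negbK negb_exists; apply/negP => /forallP E.
  by apply: cc'; apply/ffunP => i; apply/eqP; rewrite -[_ == _]negbK.
rewrite /atom (bigD1 i) //= [X in _ * X](bigD1 i) //= mulrACA.
have -> : (if c i then s i else 1 + s i) * (if c' i then s i else 1 + s i) = 0.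
  by case: (c i) (c' i) ci => -[] // _;
    rewrite ?mulrDr ?mulrDl ?mulr1 ?mul1r boolr_idem boolr_addrr.
by rewrite mul0r.
Qed.

End Atoms.

Section BooleanHochschild.
Variables (V : lmodType F2) (A B : booleanRingType) (iota : {rmorphism A -> B}).
Local Notation letter := (letter V A).
Local Notation lmul := (@lmul V A).
Local Notation ladd := (@ladd V A).
Local Notation Y := (boolr_vect B).
Implicit Types (F G : seq letter -> Y) (l m : letter).
Notation multiadd := (multiadditive ladd).
Local Notation "a ** y" := (boolr_smul (iota a) y) (at level 40).

Definition boolr_act l (y : Y) : Y := l.2.2 ** y.
Notation diff := (wdiff lmul boolr_act boolr_act).

Lemma boolr_actD l : {morph boolr_act l : y z / y + z}.
Proof. exact: boolr_smulDr. Qed.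
Lemma boolr_actM l m y : boolr_act (lmul l m) y = boolr_act l (boolr_act m y).
Proof. by rewrite /boolr_act rmorphM boolr_smulA. Qed.
Lemma boolr_actMr l m y : boolr_act (lmul l m) y = boolr_act m (boolr_act l y).
Proof. by rewrite boolr_actM /boolr_act boolr_smulC. Qed.
Lemma boolr_actC l m y : boolr_act l (boolr_act m y) = boolr_act m (boolr_act l y).
Proof. exact: boolr_smulC. Qed.
Lemma boolr_act_add a b c y : ladd a b c -> boolr_act c y = boolr_act a y + boolr_act b y.
Proof. by move=> h; rewrite /boolr_act (ladd2 h) rmorphD boolr_smulDl. Qed.

Lemma boolr_diff_diff F w : diff (diff F) w = 0.
Proof.
apply: diff_diff; [exact: lmulA|exact: boolr_actD|exact: boolr_actD|
  exact: boolr_actM|exact: boolr_actMr|exact: boolr_actC].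
Qed.

Lemma boolr_diffD F G w : diff (fun v => F v + G v) w = diff F w + diff G w.
Proof. by apply: diffD; exact: boolr_actD. Qed.

Lemma multiadd_boolr_diff F : multiadd F -> multiadd (diff F).
Proof.
apply: multiadditive_diff; [exact: lmul_addr|exact: lmul_addl|exact: boolr_actD|
  exact: boolr_actD|exact: boolr_act_add|exact: boolr_act_add].
Qed.

Lemma rdiff_sum (I : finType) (c : I -> A) (F : I -> seq letter -> Y) w :
  rdiff lmul boolr_act (fun v => \sum_i c i ** F i v) w =
  \sum_i c i ** rdiff lmul boolr_act (F i) w.
Proof.
elim: w F => [|x [|y r] IH] F.
- by rewrite rdiff_nil big1 // => i _; rewrite rdiff_nil boolr_smul0r.
- rewrite rdiff1 /boolr_act boolr_smul_sumr; apply: eq_bigr => i _.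
  by rewrite rdiff1 boolr_smulC.
- rewrite rdiff_cons2 IH -big_split; apply: eq_bigr => i _.
  by rewrite rdiff_cons2 boolr_smulDr.
Qed.

Lemma rdiff_bigsum (I : finType) (F : I -> seq letter -> Y) w :
  rdiff lmul boolr_act (fun v => \sum_i F i v) w =
  \sum_i rdiff lmul boolr_act (F i) w.
Proof.
rewrite (@eq_rdiff _ _ _ _ _ (fun v => \sum_i 1 ** F i v)) => [|v _].
  by rewrite rdiff_sum; apply: eq_bigr => i _; rewrite rmorph1 boolr_smul1.
by apply: eq_bigr => i _; rewrite rmorph1 boolr_smul1.
Qed.

Lemma diff_cons F x w : diff F (x :: w) = boolr_act x (F w) + rdiff lmul boolr_act F (x :: w).
Proof. by []. Qed.

Section FiniteHomotopy.
Variables (I : finType) (e : I -> A).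
Hypothesis e_sum : \sum_j e j = 1.
Hypothesis e_ortho : forall i j, i != j -> e i * e j = 0.

Definition epow n j : letter := (n, (0, e j)).

(** Contraction by the separability idempotent, the sum of the e_j ⊗ e_j. As letters have positive
    degree, multiplying by [epow 0 j] raises the degree; [cut_proj] below is the resulting
    defect. *)
Definition cut F w : Y := \sum_j e j ** F (epow 0 j :: w).

Definition cut_proj F w : Y := if w is x :: r then
  \sum_j e j ** (F (lmul (epow 0 j) x :: r) + x.2.2 ** F (epow 0 j :: r)) else 0.

Lemma multiadd_cut F : multiadd F -> multiadd (cut F).
Proof.
move=> FM u a b c v h; rewrite /cut -big_split; apply: eq_bigr => j _.
by rewrite /= -boolr_smulDr -(FM (_ :: u) _ _ _ v h).
Qed.

Lemma cutP F x r : diff (cut F) (x :: r) + cut (diff F) (x :: r) =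
  F (x :: r) + cut_proj F (x :: r).
Proof.
rewrite /wdiff /cut rdiff_sum {1}/boolr_act boolr_smul_sumr /cut_proj.
have E : F (x :: r) = \sum_j e j ** F (x :: r).
  by rewrite -boolr_smul_suml -rmorph_sum e_sum rmorph1 boolr_smul1.
rewrite [X in _ = X + _]E -!big_split; apply: eq_bigr => j _ /=.
rewrite rdiff_cons2 !boolr_smulDr /boolr_act /= boolr_smul_idem.
by rewrite (boolr_smulC (iota x.2.2)); char2.
Qed.

(** The contraction for a polynomial ring in one variable, applied in the summand of each
    idempotent: t^(n+1) goes to the sum of the t ⊗ t^(i+1) with i < n. *)
Definition telescope F w : Y := if w is x :: r then
  \sum_j (x.2.2 * e j) ** (\sum_(i < x.1) F [:: epow 0 j, epow i j & r]) else 0.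

Lemma multiadd_telescope F : multiadd F -> multiadd (telescope F).
Proof.
move=> FM [|x u] a b c v h /=; rewrite -big_split; apply: eq_bigr => j _.
  have [-> -> _] := h.
  by rewrite /= (ladd2 h) mulrDl rmorphD boolr_smulDl.
rewrite /= -boolr_smulDr -big_split; congr (_ ** _); apply: eq_bigr => i _.
exact: (FM [:: epow 0 j, epow i j & u]).
Qed.

(** Holds for the sums of some of the [e j], that is, for the elements of the subalgebra with these
    atoms. *)
Definition absorbed (a : A) := forall j, a * e j = 0 \/ a * e j = e j.

Lemma smul_absorbed (a : A) F n j u v : multiadd F -> absorbed a ->
  e j ** F (u ++ (n, (0, a * e j)) :: v) = (a * e j) ** F (u ++ epow n j :: v).
Proof.
move=> FM aj; case: (aj j) => ->; last by [].
by rewrite multiadd_zero // rmorph0 boolr_smul0l boolr_smul0r.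
Qed.

Lemma cut_proj_absorbed F x r : multiadd F -> absorbed x.2.2 ->
  cut_proj F (x :: r) =
  \sum_j (x.2.2 * e j) ** (F (epow x.1.+1 j :: r) + F (epow 0 j :: r)).
Proof.
move=> FM xj; apply: eq_bigr => j _; rewrite !boolr_smulDr; congr (_ + _).
  rewrite -[LHS]/(e j ** F ([::] ++ (x.1.+1, (0, e j * x.2.2)) :: r)) mulrC.
  exact: smul_absorbed.
by rewrite -boolr_smulA -rmorphM mulrC.
Qed.

Lemma absorbed_epow j : absorbed (e j).
Proof.
move=> i; case: (eqVneq i j) => [->|ij]; [right; exact: boolr_idem|left].
by rewrite e_ortho // eq_sym.
Qed.

Lemma smul_cut_proj F n j r : multiadd F ->
  e j ** cut_proj F (epow n j :: r) = e j ** (F (epow n.+1 j :: r) + F (epow 0 j :: r)).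
Proof.
move=> FM; rewrite cut_proj_absorbed //=; last exact: absorbed_epow.
rewrite boolr_smul_sumr (bigD1 j) //= big1 => [|i ij].
  by rewrite addr0 -boolr_smulA -rmorphM !boolr_idem.
by rewrite e_ortho 1?eq_sym // rmorph0 boolr_smul0l boolr_smul0r.
Qed.

Lemma smulM a b (y : Y) : (a * b) ** y = a ** (b ** y).
Proof. by rewrite rmorphM boolr_smulA. Qed.

Section Telescope.
Variables G W : seq letter -> Y.
Hypothesis GM : multiadd G.
Hypothesis diffG : forall w, diff G w = W w.
Hypothesis G_absorbed : forall x r, absorbed x.2.2 ->
  G (x :: r) = \sum_j (x.2.2 * e j) ** G (epow x.1 j :: r).

Let below j n y r : Y := \sum_(i < n) W [:: epow 0 j, epow i j, y & r].

Let rdiff_telescope j n y r : absorbed y.2.2 ->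
  e j ** (\sum_(i < n) rdiff lmul boolr_act (fun v => G [:: epow 0 j, epow i j & v]) (y :: r)) =
  e j ** (below j n y r + G [:: epow 0 j, y & r] + G [:: epow n j, y & r])
  + (y.2.2 * e j) ** (\sum_(i < n) G [:: epow 0 j, epow (y.1.+1 + i) j & r]).
Proof.
move=> yj; elim: n => [|n IH].
  by rewrite /below !big_ord0 !boolr_smul0r add0r addF2 boolr_smul0r addr0.
(* The induction step is the value of [diff G] at the word t, t^(n+1), [y], [r], multiplied by
   [e j]. *)
have := diffG [:: epow 0 j, epow n j, y & r].
rewrite diff_cons rdiff_cons2 rdiff_cons2.
rewrite (_ : lmul (epow 0 j) (epow n j) = epow n.+1 j); last by rewrite /lmul /= boolr_idem.
rewrite (_ : lmul (epow n j) y = ((y.1.+1 + n)%N, (0, y.2.2 * e j))); last first.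
  by rewrite /lmul /= mulrC addSn addnC.
move=> /(congr1 (boolr_smul (iota (e j)))); rewrite !boolr_smulDr.
have -> z : e j ** boolr_act (epow 0 j) z = e j ** z by exact: boolr_smul_idem.
have := smul_absorbed (y.1.+1 + n) j [:: epow 0 j] r GM yj.
rewrite !cat1s => -> WE.
rewrite /below !big_ord_recr !boolr_smulDr IH !boolr_smulDr -/(below j n y r) -WE.
by char2.
Qed.

(** On the right the degree of [x] enters only through the values of [W]. Up to these, adding the
    differential of the telescope makes [G] independent of the degree of its first letter. *)
Lemma telescopeP x y r : absorbed x.2.2 -> absorbed y.2.2 ->
  G [:: x, y & r] + diff (telescope G) [:: x, y & r] =
  \sum_j (x.2.2 * e j) ** (\sum_(i < x.1) W [:: epow 0 j, epow i j, y & r]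
    + G [:: epow 0 j, y & r] + y.2.2 ** G [:: epow 0 j, epow y.1 j & r]).
Proof.
move=> xj yj; rewrite diff_cons rdiff_cons2 rdiff_sum G_absorbed //.
rewrite /boolr_act boolr_smul_sumr -!big_split; apply: eq_bigr => j _ /=.
have swap (z : Y) : x.2.2 ** (y.2.2 ** (e j ** z)) = x.2.2 ** (e j ** (y.2.2 ** z)).
  by congr (_ ** _); rewrite boolr_smulC.
have -> : (\sum_(i < (x.1 + y.1).+1) G [:: epow 0 j, epow i j & r] : Y) =
    \sum_(i < y.1) G [:: epow 0 j, epow i j & r] + G [:: epow 0 j, epow y.1 j & r]
    + \sum_(i < x.1) G [:: epow 0 j, epow (y.1.+1 + i) j & r].
  have -> : (x.1 + y.1).+1 = (y.1.+1 + x.1)%N by rewrite addSn addnC.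
  by rewrite big_split_ord big_ord_recr.
rewrite rdiff_bigsum !smulM rdiff_telescope // -/(below j x.1 y r).
by rewrite !smulM !boolr_smulDr !swap; char2.
Qed.

End Telescope.

(** A cochain is normalized in two steps: [diagonal F] splits along the idempotents of its first
    letter, and [flattened F] depends on the degree of this letter only through [diff F]. Then
    [cut_proj] of [flattened F] involves only [diff F], so that a second [cut] finishes the
    contraction. *)
Definition diagonal F w : Y := F w + diff (cut F) w + cut (diff F) w.
Definition flattened F w : Y := diagonal F w + diff (telescope (diagonal F)) w.
Definition cut_cocycle F w : Y := F w + diff (cut F) w.

Definition primitive F w : Y :=
  cut F w + telescope (diagonal F) w + cut (flattened F) w.

(** Applied to [diff F], this collects the error terms of [primitiveP]. The degree of the first
    letter is raised by one because [cut_proj] compares the indices [x.1.+1] and [0]. *)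
Definition residue F w : Y := cut F w + cut (cut_cocycle F) w +
  (if w is x :: r then telescope (cut_cocycle F) ((x.1.+1, x.2) :: r) else 0).

Lemma multiadd_diagonal F : multiadd F -> multiadd (diagonal F).
Proof.
move=> FM; apply: multiadditiveD; first apply: multiadditiveD => //.
  by apply: multiadd_boolr_diff; exact: multiadd_cut.
by apply: multiadd_cut; exact: multiadd_boolr_diff.
Qed.

Lemma multiadd_flattened F : multiadd F -> multiadd (flattened F).
Proof.
move=> FM; apply: multiadditiveD; first exact: multiadd_diagonal.
by apply: multiadd_boolr_diff; apply: multiadd_telescope; exact: multiadd_diagonal.
Qed.

Lemma multiadd_primitive F : multiadd F -> multiadd (primitive F).
Proof.
move=> FM; apply: multiadditiveD; first apply: multiadditiveD.
- exact: multiadd_cut.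
- by apply: multiadd_telescope; exact: multiadd_diagonal.
- by apply: multiadd_cut; exact: multiadd_flattened.
Qed.

Lemma diff_diagonal F w : diff (diagonal F) w = cut_cocycle (diff F) w.
Proof.
rewrite [LHS](boolr_diffD (fun w => F w + diff (cut F) w) (cut (diff F))).
by rewrite boolr_diffD boolr_diff_diff /cut_cocycle; char2.
Qed.

Lemma diff_flattened F w : diff (flattened F) w = cut_cocycle (diff F) w.
Proof.
by rewrite [LHS](boolr_diffD (diagonal F)) boolr_diff_diff addr0 diff_diagonal.
Qed.

Lemma diagonal_absorbed F x r : multiadd F -> absorbed x.2.2 ->
  diagonal F (x :: r) = \sum_j (x.2.2 * e j) ** diagonal F (epow x.1 j :: r).
Proof.
have E y : diagonal F (y :: r) = cut_proj F (y :: r).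
  by rewrite /diagonal -addrA cutP; char2.
move=> FM xj; rewrite E cut_proj_absorbed //; apply: eq_bigr => j _.
by rewrite !smulM E smul_cut_proj.
Qed.

Lemma smul_flattened F j n y r : multiadd F -> absorbed y.2.2 ->
  e j ** flattened F [:: epow n j, y & r] =
  e j ** (\sum_(i < n) cut_cocycle (diff F) [:: epow 0 j, epow i j, y & r]
    + diagonal F [:: epow 0 j, y & r] + y.2.2 ** diagonal F [:: epow 0 j, epow y.1 j & r]).
Proof.
move=> FM yj; have [absD absE] := (fun x s => @diagonal_absorbed F x s FM, @absorbed_epow j).
rewrite [flattened _ _](telescopeP (multiadd_diagonal FM) (diff_diagonal F) absD (x := epow n j)) //.
rewrite boolr_smul_sumr (bigD1 j) //= [X in _ + X = _]big1 => [|i ij].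
  by rewrite addr0 smulM !boolr_smul_idem.
by rewrite e_ortho 1?eq_sym // rmorph0 boolr_smul0l boolr_smul0r.
Qed.

Lemma cut_proj_flattened F x y r : multiadd F -> absorbed x.2.2 -> absorbed y.2.2 ->
  cut_proj (flattened F) [:: x, y & r] =
  telescope (cut_cocycle (diff F)) [:: (x.1.+1, x.2), y & r].
Proof.
move=> FM xj yj; rewrite cut_proj_absorbed //; last exact: multiadd_flattened.
apply: eq_bigr => j _; rewrite !smulM boolr_smulDr !smul_flattened // -boolr_smulDr.
by rewrite big_ord0; congr (_ ** (_ ** _)); char2.
Qed.

Lemma primitiveP F x y r : multiadd F -> absorbed x.2.2 -> absorbed y.2.2 ->
  F [:: x, y & r] = diff (primitive F) [:: x, y & r] + residue (diff F) [:: x, y & r].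
Proof.
move=> FM xj yj; rewrite /residue -cut_proj_flattened //.
rewrite (boolr_diffD (fun w => cut F w + telescope (diagonal F) w) (cut (flattened F))) boolr_diffD.
have -> : cut (cut_cocycle (diff F)) [:: x, y & r] = cut (diff (flattened F)) [:: x, y & r].
  by apply: eq_bigr => j _; rewrite diff_flattened.
have := cutP (flattened F) x (y :: r).
rewrite -[flattened F _]/(F [:: x, y & r] + diff (cut F) [:: x, y & r]
  + cut (diff F) [:: x, y & r] + diff (telescope (diagonal F)) [:: x, y & r]).
move: (diff (cut (flattened F)) _) (cut (diff (flattened F)) _) (cut_proj _ _) => a b c E.
have -> : a = b + (a + b) by char2.
by rewrite E; char2.
Qed.

End FiniteHomotopy.
End BooleanHochschild.

(** * Functionals of finitely many values, and exactness over an arbitrary Boolean ring *)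

Section Finitary.
Variables (L : Type) (B : booleanRingType).
Local Notation Y := (boolr_vect B).
Local Notation cochain := (seq L -> Y).
Implicit Types (theta : cochain -> Y) (H : cochain -> cochain).

Definition finitary n theta := exists s : seq (B * seq L),
  all (fun p => size p.2 == n) s /\
  forall F, theta F = \sum_(p <- s) boolr_smul p.1 (F p.2).

Definition finitary_op m n H := forall w, size w = n -> finitary m (fun F => H F w).

Lemma finitary0 n : finitary n (fun=> 0).
Proof. by exists [::]; split=> // F; rewrite big_nil. Qed.

Lemma finitaryD n theta theta' : finitary n theta -> finitary n theta' ->
  finitary n (fun F => theta F + theta' F).
Proof.
move=> [s [ss sE]] [s' [ss' s'E]]; exists (s ++ s'); rewrite all_cat ss ss'.
by split=> // F; rewrite sE s'E big_cat.
Qed.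

Lemma finitaryZ n b theta : finitary n theta -> finitary n (fun F => boolr_smul b (theta F)).
Proof.
move=> [s [ss sE]]; exists (map (fun p => (b * p.1, p.2)) s); split.
  by rewrite all_map.
move=> F; rewrite sE big_map boolr_smul_sumr; apply: eq_bigr => p _.
by rewrite boolr_smulA.
Qed.

Lemma finitary_sum n (I : finType) (theta : I -> cochain -> Y) :
  (forall i, finitary n (theta i)) -> finitary n (fun F => \sum_i theta i F).
Proof.
move=> fin; have : finitary n (fun F => \sum_(i <- index_enum I) theta i F).
  elim: (index_enum I) => [|i r IH].
    by have [s [ss sE]] := finitary0 n; exists s; split=> // F; rewrite big_nil -sE.
  have [s [ss sE]] := finitaryD (fin i) IH.
  by exists s; split=> // F; rewrite big_cons -sE.
by [].
Qed.

Lemma finitary_eval n w : size w = n -> finitary n (fun F => F w).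
Proof.
move=> sw; exists [:: (1, w)]; split=> [|F]; first by rewrite /= sw eqxx.
by rewrite big_seq1 boolr_smul1.
Qed.

Lemma finitary_cons n x theta : finitary n theta ->
  finitary n.+1 (fun F => theta (fun v => F (x :: v))).
Proof.
move=> [s [ss sE]]; exists (map (fun p => (p.1, x :: p.2)) s); split.
  by rewrite all_map.
by move=> F; rewrite sE big_map.
Qed.

Lemma finitary_comp m n theta H : finitary n theta -> finitary_op m n H ->
  finitary m (fun F => theta (H F)).
Proof.
move=> [s [ss sE]] Hfin.
have : finitary m (fun F => \sum_(p <- s) boolr_smul p.1 (H F p.2)).
  elim: s ss {sE} => [_|p s IH /= /andP[/eqP sp /IH fins]].
    by have [s [ss sE]] := finitary0 m; exists s; split=> // F; rewrite big_nil -sE.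
  have [s' [ss' s'E]] := finitaryD (finitaryZ p.1 (Hfin _ sp)) fins.
  by exists s'; split=> // F; rewrite big_cons -s'E.
by move=> [s' [ss' s'E]]; exists s'; split=> // F; rewrite sE.
Qed.

Lemma finitary_add n theta : finitary n theta ->
  forall F G, theta (fun w => F w + G w) = theta F + theta G.
Proof.
move=> [s [_ sE]] F G; rewrite !sE -big_split; apply: eq_bigr => p _.
by rewrite boolr_smulDr.
Qed.

Lemma finitary_const0 n theta : finitary n theta -> theta (fun=> 0) = 0.
Proof. by move=> [s [_ ->]]; rewrite big1 // => p _; rewrite boolr_smul0r. Qed.

Lemma finitary_local n theta F G : finitary n theta ->
  (forall w, size w = n -> F w = G w) -> theta F = theta G.
Proof.
move=> [s [ss sE]] FG; rewrite !sE.
elim: s ss {sE} => [|p s IH] /=; first by rewrite !big_nil.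
by move=> /andP[/eqP sp /IH E]; rewrite !big_cons E FG.
Qed.

End Finitary.

Section BooleanExactness.
Variables (V : lmodType F2) (A B : booleanRingType) (iota : {rmorphism A -> B}).
Local Notation letter := (letter V A).
Local Notation lmul := (@lmul V A).
Local Notation ladd := (@ladd V A).
Local Notation Y := (boolr_vect B).
Implicit Types (F G : seq letter -> Y) (l m : letter).
Notation multiadd := (multiadditive ladd).
Local Notation act := (boolr_act iota).
Notation diff := (wdiff lmul act act).

Lemma finitary_diff n : finitary_op n n.+1 diff.
Proof.
move=> w sw; have fin_rdiff : finitary n (fun F => rdiff lmul act F w).
  elim: w n sw => [//|x [|y r] IH] n [<-].
    exact: finitaryZ (finitary_eval _ _).
  apply: finitaryD; first exact: finitary_eval.
  by apply: (@finitary_cons _ _ _ x (fun F => rdiff lmul act F (y :: r))); exact: IH.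
apply: finitaryD => //; case: w sw {fin_rdiff} => [|x w] [sw]; first exact: finitary0.
by apply: finitaryZ; exact: finitary_eval.
Qed.

Section Finite.
Variables (I : finType) (e : I -> A).

Lemma finitary_cut n : finitary_op n.+1 n (@cut V _ _ iota _ e).
Proof.
move=> w sw; apply: finitary_sum => j; apply: finitaryZ; apply: finitary_eval.
by rewrite /= sw.
Qed.

Lemma finitary_telescope n : finitary_op n.+1 n (@telescope V _ _ iota _ e).
Proof.
move=> [|x r] sr; first exact: finitary0.
apply: finitary_sum => j; apply: finitaryZ; apply: finitary_sum => i.
by apply: finitary_eval; rewrite /= -sr.
Qed.

Lemma finitary_residue n : finitary_op n.+1 n (@residue V _ _ iota _ e).
Proof.
have fc : finitary_op n.+1 n.+1 (@cut_cocycle V _ _ iota _ e).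
  move=> w sw; apply: finitaryD; first exact: finitary_eval.
  exact: finitary_comp (finitary_diff sw) (@finitary_cut _).
move=> w sw; apply: finitaryD; first apply: finitaryD.
- exact: finitary_cut.
- exact: finitary_comp (finitary_cut sw) fc.
case: w sw => [|x r] sr; first exact: finitary0.
exact: finitary_comp (@finitary_telescope n ((x.1.+1, x.2) :: r) sr) fc.
Qed.

End Finite.

(** The letters read by [theta] generate a finite Boolean subalgebra. With its atoms as idempotents,
    [primitiveP] holds at all words read by [theta]; the coboundary in it is killed, which leaves a
    functional of [diff F]. Since [primitiveP] concerns words of at least two letters, [k] exceeds
    1. *)
Lemma finitary_exact k theta : (1 < k)%N -> finitary k theta ->
  (forall G, multiadd G -> theta (diff G) = 0) ->
  exists2 theta', finitary k.+1 theta' & forall F, multiadd F -> theta F = theta' (diff F).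
Proof.
move=> k_gt1 fin theta0; have [s [ss sE]] := fin.
pose al := flatten [seq [seq l.2.2 | l <- p.2] | p <- s].
pose e := atom (fun i : 'I_(size al) => nth 0 al i).
have e1 : \sum_j e j = 1 := atom_sum _.
have eo i j : i != j -> e i * e j = 0 by exact: atom_ortho.
have al_abs a : a \in al -> absorbed e a.
  move=> /(nthP 0)[i lti <-] c; have := atom_absorb (fun i : 'I_(size al) => nth 0 al i) (Ordinal lti) c.
  by rewrite /= -/e => ->; case: (c _); [right|left].
exists (fun F => theta (residue iota e F)).
  exact: finitary_comp fin (@finitary_residue _ _ _).
move=> F FM; pose F' w := diff (primitive iota e F) w + residue iota e (diff F) w.
have E s' : all (fun p => size p.2 == k) s' ->
    {subset flatten [seq [seq l.2.2 | l <- p.2] | p <- s'] <= al} ->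
    \sum_(p <- s') boolr_smul p.1 (F p.2) = \sum_(p <- s') boolr_smul p.1 (F' p.2).
  elim: s' => [|p s' IH] /=; first by rewrite !big_nil.
  move=> /andP[/eqP sp ss'] al_s; rewrite !big_cons IH //; last first.
    by move=> a as_; apply: al_s; rewrite mem_cat as_ orbT.
  congr (boolr_smul _ _ + _); case: p sp al_s => b [|x [|y r]] /= sp al_s.
  - by rewrite -sp in k_gt1.
  - by rewrite -sp in k_gt1.
  by apply: primitiveP => //; apply: al_abs; apply: al_s; rewrite /= !inE eqxx ?orbT.
rewrite sE E // -sE (finitary_add fin) theta0 ?add0r //; exact: multiadd_primitive.
Qed.

(** Functionals [theta'] chosen separately for each word would not depend additively on the word. A
    linear section of the map from [theta'] to its composite with [diff] makes [S F] multiadditive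
    for every [F]. *)
Lemma splitting_step k (theta : seq letter -> (seq letter -> Y) -> Y) :
  (forall F, multiadd F -> multiadd (theta^~ F)) ->
  (forall w, size w = k -> exists2 theta', finitary k.+1 theta' &
     forall F, multiadd F -> theta w F = theta' (diff F)) ->
  exists S, [/\ finitary_op k.+1 k S, forall F, multiadd (S F) &
    forall F w, multiadd F -> size w = k -> S (diff F) w = theta w F].
Proof.
move=> theta_add theta_ex; pose U := (seq letter -> Y) -> Y.
(* Functionals are compared on multiadditive cochains only, because the factorization holds only
   there. *)
pose W := {F : seq letter -> Y | multiadd F} -> Y.
pose D (t : U) : W := fun p => t (diff (sval p)).
have [|t t'|t t'|s [sD sP]] := @linear_section_exists U W (finitary k.+1) D.
- exact: finitary0.
- exact: finitaryD.
- by apply: funext => p.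
pose tw w : W := fun p => theta w (sval p).
have twP w : size w = k -> exists2 t, finitary k.+1 t & D t = tw w.
  move=> /theta_ex[t tfin tE]; exists t => //; apply: funext => p.
  by rewrite /tw (tE _ (svalP p)).
exists (fun F w => if size w == k then s (tw w) F else 0); split.
- move=> w sw; have [t tfin tE] := twP w sw.
  by have [+ _] := sP t tfin; rewrite tE sw eqxx.
- move=> F u a b c v h.
  have sz x : size (u ++ x :: v) = size (u ++ c :: v) by rewrite !size_cat.
  rewrite !sz; case: eqP => [ek|_]; last by rewrite addr0.
  have -> : tw (u ++ c :: v) = tw (u ++ a :: v) + tw (u ++ b :: v).
    by apply: funext => p; exact: (theta_add _ (svalP p)).
  have mem x : [set D t | t in finitary k.+1]%classic (tw (u ++ x :: v)).
    by have [|t tfin tE] := twP (u ++ x :: v); [rewrite sz|exists t].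
  by rewrite (sD _ _ (mem a) (mem b)).
- move=> F w FM sw; rewrite sw eqxx; have [t tfin tE] := twP w sw.
  have [_] := sP t tfin; rewrite tE => /(congr1 (fun f : W => f (exist _ F FM))).
  by [].
Qed.

(** The Euler derivation, multiplication by the degree. The cohomology class of a cocycle [F] in
    length one is the multiple of it by [F [:: t 0]], its value at the unit placed in degree 1. *)
Let euler (w : seq letter) : Y := if w is [:: x] then iota x.2.2 *+ x.1.+1 else 0.

Let t n : letter := lone V A n.

Let smulMn n b (y : Y) : boolr_smul (b *+ n) y = boolr_smul b y *+ n.
Proof. exact: mulrnAl. Qed.

Let diff_tpow F n : F [:: t n] =
  F [:: t 0] *+ n.+1 + \sum_(i < n) diff F [:: t 0; t i].
Proof.
elim: n => [|n IH]; first by rewrite big_ord0 addr0.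
rewrite big_ord_recr mulrS /= diff_cons rdiff_cons2 rdiff1 /boolr_act /= rmorph1 !boolr_smul1.
have -> : lmul (t 0) (t n) = t n.+1 by rewrite /lmul /= mul1r.
by rewrite IH; char2.
Qed.

Let finitary_euler x : exists2 theta', finitary 2 theta' & forall F, multiadd F ->
  F [:: x] + boolr_smul (euler [:: x]) (F [:: t 0]) = theta' (diff F).
Proof.
pose x0 : letter := (0%N, x.2).
exists (fun G => G [:: x0; x0] + G [:: x0; t 0] + if x.1 is n.+1 then
    boolr_smul (iota x.2.2) (\sum_(i < n) G [:: t 0; t i]) + G [:: x0; t n] else 0).
  apply: finitaryD; first by apply: finitaryD; exact: finitary_eval.
  case: x.1 => [|n]; first exact: finitary0.
  apply: finitaryD; last exact: finitary_eval.
  by apply: finitaryZ; apply: finitary_sum => i; exact: finitary_eval.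
move=> F FM; rewrite /euler smulMn.
(* By idempotence the words [[:: x0; x0]] and [[:: x0; t 0]] have the same product, so the merging
   terms of the two differentials cancel. *)
have -> : diff F [:: x0; x0] + diff F [:: x0; t 0] = F [:: x0] + boolr_smul (iota x.2.2) (F [:: t 0]).
  rewrite !diff_cons !rdiff_cons2 !rdiff1 /boolr_act /= rmorph1 boolr_smul1.
  have -> : lmul x0 (t 0) = lmul x0 x0 by rewrite /lmul /= mulr1 boolr_idem.
  by char2.
case: x @x0 => -[|n] x x0; first by rewrite addr0 mulr1n.
have -> : F [:: (n.+1, x)] = F [:: lmul x0 (t n)].
  by apply: (multiadd_lval [::]); rewrite //= /lval /= mulr1.
rewrite [X in _ = _ + X](_ : _ = boolr_smul (iota x.2) (\sum_(i < n) diff F [:: t 0; t i])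
    + (boolr_smul (iota x.2) (F [:: t n]) + (F [:: lmul x0 (t n)] + F [:: x0]))); last first.
  by congr (_ + _); rewrite diff_cons rdiff_cons2 rdiff1 /boolr_act /= rmorph1 boolr_smul1.
have := diff_tpow F n => /(congr1 (boolr_smul (iota x.2))).
rewrite boolr_smulDr => ->; rewrite [(_, _).1]/=.
have -> : boolr_smul (iota x.2) (F [:: t 0] *+ n.+1) = boolr_smul (iota x.2) (F [:: t 0]) *+ n.+1.
  exact: (mulrnAr (iota x.2 : B)).
by rewrite [_ *+ n.+2]mulrS [(_, _).2]/=; char2.
Qed.

Let diff_euler c w : size w = 2 -> diff (fun v => boolr_smul (euler v) c) w = 0.
Proof.
case: w => [|x [|y [|]]] // _.
rewrite diff_cons rdiff_cons2 rdiff1 /euler !smulMn /boolr_act.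
have E (a : B) (z : Y) n : boolr_smul a (z *+ n) = boolr_smul a z *+ n by exact: mulrnAr.
rewrite !E rmorphM boolr_smulA (boolr_smulC (iota y.2.2)).
move: (boolr_smul _ _) => z; rewrite -!mulrnDr.
have -> : (y.1.+1 + ((x.1 + y.1).+2 + x.1.+1) = (x.1 + y.1 + 2) * 2)%N by lia.
by rewrite mulnC mulrnA mulr2n addF2 mul0rn.
Qed.

(** The correction by [euler] is a cocycle, so removing it from [G] does not change [diff G]. *)
Let splitting_base : exists S, [/\ finitary_op 2 1 S,
  forall F, multiadd F -> multiadd (S F) &
  forall G w, multiadd G -> size w = 2 -> diff (S (diff G)) w = diff G w].
Proof.
have [|[|x [|y w]] // _|S [Sfin SM SP]] :=
    @splitting_step 1 (fun w F => F w + boolr_smul (euler w) (F [:: t 0])).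
- move=> F FM; apply: multiadditiveD => // -[|z u] a b c v h /=.
    case: v => [|y v]; last by rewrite !boolr_smul0l addr0.
    have [ea eb _] := h.
    by rewrite (ladd2 h) rmorphD ea eb mulrnDl boolr_smulDl.
  by case: u => *; rewrite !boolr_smul0l addr0.
exists S; split=> // G w GM sw.
rewrite (@eq_diff _ _ _ _ _ _ (fun v => G v + boolr_smul (euler v) (G [:: t 0]))) => [|v sv].
  by rewrite boolr_diffD diff_euler // addr0.
by rewrite SP //; apply/eqP; rewrite -eqSS sv sw.
Qed.

(** An operator with diff S diff = diff is a generalized inverse of the differential. If [S] is one
    in length [j], the functionals [F w + diff (S F) w] kill coboundaries and hence have the form
    [S' (diff F) w]; then [S'] is a generalized inverse in length [j.+1]. On a cocycle [S' (diff F)]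
    vanishes, which leaves [F = diff (S F)]. *)
Theorem boolean_exact k F : (1 < k)%N -> multiadd F ->
  (forall w, size w = k.+1 -> diff F w = 0) ->
  exists2 G, multiadd G & forall w, size w = k -> diff G w = F w.
Proof.
move=> k_gt1 FM dF0.
have step j : (1 < j)%N -> (exists S, [/\ finitary_op j j.-1 S,
      forall F, multiadd F -> multiadd (S F) &
      forall G w, multiadd G -> size w = j -> diff (S (diff G)) w = diff G w]) ->
    exists S S', [/\ finitary_op j.+1 j S', forall F, multiadd F -> multiadd (S' F),
      forall F, multiadd F -> multiadd (S F) &
      forall F w, multiadd F -> size w = j -> S' (diff F) w = F w + diff (S F) w].
  move=> j_gt1 [S [Sfin SM SP]].
  have [||S' [S'fin S'M S'P]] := @splitting_step j (fun w F => F w + diff (S F) w).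
  - by move=> G GM; apply: multiadditiveD => //; apply: multiadd_boolr_diff; exact: SM.
  - move=> w sw; apply: finitary_exact => // [|G GM].
      apply: finitaryD; first exact: finitary_eval.
      by apply: finitary_comp (finitary_diff (n := j.-1) _) Sfin; rewrite prednK // ltnW.
    by rewrite SP // addF2.
  by exists S, S'; split=> // G; rewrite ?S'P.
have claim j : (1 < j)%N -> exists S, [/\ finitary_op j j.-1 S,
      forall F, multiadd F -> multiadd (S F) &
      forall G w, multiadd G -> size w = j -> diff (S (diff G)) w = diff G w].
  elim: j => // -[//|[_ _|j /(_ isT) IH _]]; first exact: splitting_base.
  have [S [S' [S'fin S'M SM SP]]] := step j.+2 isT IH.
  exists S'; split=> // G w GM sw.
  rewrite (@eq_diff _ _ _ _ _ _ (fun v => G v + diff (S G) v)) => [|v sv].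
    by rewrite boolr_diffD boolr_diff_diff addr0.
  by rewrite SP //; apply/eqP; rewrite -eqSS sv sw.
have [S [S' [S'fin _ SM SP]]] := step k k_gt1 (claim k k_gt1).
exists (S F) => [|w sw]; first exact: SM.
have S'0 : S' (diff F) w = 0.
  rewrite (finitary_local (S'fin w sw) (G := fun=> 0)); last exact: dF0.
  exact: (finitary_const0 (S'fin w sw)).
by have := SP F w FM sw; rewrite S'0 => E; rewrite -[LHS]add0r E; char2.
Qed.
End BooleanExactness.

(** * Exactness for the connected sum *)

Section Model.
Variables (V : lmodType F2) (A B : booleanRingType) (iota : {rmorphism A -> B}).
Local Notation letter := (letter V A).
Local Notation lmul := (@lmul V A).
Local Notation ladd := (@ladd V A).
Notation multiadd := (multiadditive ladd).
Notation mergesum := (rdiff lmul (fun=> fun=> 0)).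

(* [V_* \sqcap B_*] with its homogeneous components glued together: the degree
   0 part, and then [V] and [B]. *)
Local Notation Y := ((F2^o * (V * boolr_vect B))%type : lmodType F2).

Definition in_degree (t : int) (y : Y) : Prop := match t with
  | Posz 0 => y.2 = 0
  | Posz 1 => y.1 = 0
  | Posz _ => y.1 = 0 /\ y.2.1 = 0
  | Negz _ => y = 0 end.

(** The scalar component is multiplied by the value of [l], the component in [V] is annihilated.
    Left and right action coincide because the algebra is commutative. *)
Definition model_act (l : letter) (y : Y) : Y :=
  (0, ((y.1 : F2) *: (lval l).1,
       boolr_smul (iota l.2.2) ((y.1 : F2) *: (1 : boolr_vect B) + y.2.2))).

Lemma model_actD l : {morph model_act l : y z / y + z}.
Proof.
move=> y z; congr (_, (_, _)); rewrite /= ?addr0 ?scalerDl //.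
by rewrite -boolr_smulDr; congr boolr_smul; char2.
Qed.

Lemma model_actM l m y : model_act (lmul l m) y = model_act l (model_act m y).
Proof.
congr (_, (_, _)); rewrite /= ?scaler0 ?scale0r ?add0r //.
by rewrite rmorphM boolr_smulA.
Qed.

Lemma model_actC l m y : model_act l (model_act m y) = model_act m (model_act l y).
Proof.
by congr (_, (_, _)); rewrite /= ?scale0r ?add0r // boolr_smulC.
Qed.

Lemma model_actMr l m y : model_act (lmul l m) y = model_act m (model_act l y).
Proof. by rewrite model_actM model_actC. Qed.

Lemma model_act_add a b c y : ladd a b c -> model_act c y = model_act a y + model_act b y.
Proof.
move=> h; congr (_, (_, _)); rewrite /= ?addr0 //; last by rewrite (ladd2 h) rmorphD boolr_smulDl.
by have [_ _ ->] := h; rewrite /= scalerDr.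
Qed.

Lemma in_degree0 t : in_degree t 0.
Proof. by case: t => [[|[|n]]|n]. Qed.

Lemma in_degreeD t y z : in_degree t y -> in_degree t z -> in_degree t (y + z).
Proof.
case: t => [[|[|n]]|n] /=; [move=> -> ->|move=> -> ->|move=> [-> ->] [-> ->]|move=> -> ->];
  by rewrite ?addr0.
Qed.

Lemma in_degree_act t l y : in_degree t y -> in_degree (l.1.+1%:Z + t) (model_act l y).
Proof.
case: t => [[|n]|n] yt.
- by case: l => -[|e] x //=; rewrite scaler0.
- rewrite /in_degree -PoszD addSn addnS; split=> //=.
  have -> : y.1 = 0 by case: n yt => // n [].
  by rewrite scale0r.
- rewrite yt (_ : model_act l 0 = 0); first exact: in_degree0.
  exact: morphD0 (model_actD l).
Qed.

Notation mdiff := (wdiff lmul model_act model_act).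

Definition model_homogeneous (s : int) (F : seq letter -> Y) :=
  forall w, in_degree ((weight w)%:Z + s) (F w).

Let model_koszul_exact (s : int) k F : (0 < k)%N -> multiadd F -> model_homogeneous s F ->
  (forall w, size w = k.+1 -> mdiff F w = 0) ->
  (forall w, size w = k -> koszul_proj F w = 0) ->
  exists G, [/\ multiadd G, model_homogeneous s G & forall w, size w = k -> mdiff G w = F w].
Proof.
move=> k_gt0 FM Fh dF0 RF0.
pose hom n y := in_degree (n%:Z + s) y.
have := @koszul_exact V A Y model_act model_act model_actD model_actD model_actM model_actMr
  model_actC model_act_add model_act_add hom _ _ _ _ k F k_gt0 FM Fh dF0 RF0.
apply=> [n|n x y|n l y|n l y].
- exact: in_degree0.
- exact: in_degreeD.
- by move=> /(in_degree_act l); rewrite /hom PoszD addrA.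
- by move=> /(in_degree_act l); rewrite /hom PoszD addrA.
Qed.

Let inc (b : boolr_vect B) : Y := (0, (0, b)).

Let inc_diff G w : mdiff (fun v => inc (G v)) w =
  inc (wdiff lmul (boolr_act iota) (boolr_act iota) G w).
Proof.
have incD : {morph inc : x y / x + y} by move=> x y; congr (_, (_, _)); rewrite /= addr0.
have inc_act l b : inc (boolr_act iota l b) = model_act l (inc b).
  by congr (_, (_, _)); rewrite /= ?scale0r // add0r.
rewrite /wdiff incD -(rdiff_morph _ incD inc_act); congr (_ + _).
by case: w => // x w; rewrite -inc_act.
Qed.

Let model_boolean_exact (s : int) k F : (1 < k)%N -> 1 < k%:Z + s -> multiadd F ->
  model_homogeneous s F -> (forall w, size w = k.+1 -> mdiff F w = 0) ->
  exists G, [/\ multiadd G, model_homogeneous s G & forall w, size w = k -> mdiff G w = F w].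
Proof.
move=> k_gt1 c_gt1 FM Fh dF0; pose F' w := (F w).2.2.
have FE w : size w = k -> F w = inc (F' w).
  move=> sw; have := Fh w; have : 1 < (weight w)%:Z + s by rewrite /weight sw; lia.
  rewrite /inc /F'; case: (_ + s) => [[|[|n]]|n] //= _ [].
  by case: (F w) => c [v b] /= -> ->.
have F'M : multiadd F' by move=> u a b c v h; rewrite /F' (FM _ _ _ _ _ h).
have [|G' G'M dG'] := boolean_exact k_gt1 F'M (iota := iota).
  move=> w sw; have := dF0 w sw; rewrite (@eq_diff _ _ _ _ _ _ (fun v => inc (F' v))) => [|v sv].
    by rewrite inc_diff => -[].
  by apply: FE; apply/eqP; rewrite -eqSS sv sw.
(* On words of length [k - 1] the degree is at least [k - 1 + s > 0], where values in [B] are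
   allowed; shorter words could have degree 0 or less. *)
exists (fun w => if (size w).+1 == k then inc (G' w) else 0); split.
- move=> u a b c v h.
  have sz x : size (u ++ x :: v) = size (u ++ c :: v) by rewrite !size_cat.
  rewrite !sz; case: eqP => _; last by rewrite addr0.
  by rewrite (G'M _ _ _ _ _ h); congr (_, (_, _)); rewrite /= addr0.
- move=> w; case: eqP => [sw|_]; last exact: in_degree0.
  have : 0 < (weight w)%:Z + s by rewrite /weight; lia.
  by case: (_ + s) => [[|[|n]]|n].
- move=> w sw; rewrite (@eq_diff _ _ _ _ _ _ (fun v => inc (G' v))) => [|v sv].
    by rewrite inc_diff dG' // FE.
  by rewrite sv sw eqxx.
Qed.

Hypothesis iota_inj : injective iota.
Hypothesis A_large : forall s : seq A, (size s <= 4)%N -> exists a, a \notin s.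

(** Each step of the projection keeps the next letter or moves its value to the left and puts 1 in
    its place. Hence right actions after the projection only involve the original last letter and
    1. *)
Lemma koszul_proj_last (P : Y -> Prop) (F : seq letter -> Y) l w :
  P 0 -> (forall x y, P x -> P y -> P (x + y)) ->
  (forall u, size u = (size w).+1 -> excess u = 0%N ->
     last l u = last l w \/ last l u = lone _ _ 0 -> P (F u)) ->
  excess (l :: w) = 0%N -> P (koszul_proj_cons F l w).
Proof.
move=> P0 PD; elim: w F l => [|m w IH] F l PF ex /=.
  by case: l PF ex => -[|e] x PF // _; apply: PF => //; left.
have [l0 m0] : l.1 = 0%N /\ m.1 = 0%N by move: ex; rewrite !excess_cons; lia.
have mE : lraise l.1 m = m by rewrite /lraise l0 add0n -surjective_pairing.
have exw : excess w = 0%N by move: ex; rewrite !excess_cons; lia.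
apply: PD; apply: IH; rewrite ?mE ?l0 ?m0 ?excess_cons ?m0 //= => -[//|x u] [su] eu lu;
  apply: PF; rewrite //= ?su //.
by case: lu => /= ->; [case: (w) => [|z v]; [right|left]|right].
Qed.

Lemma koszul_proj_morph (h : Y -> Y) (F : seq letter -> Y) l w : {morph h : x y / x + y} ->
  koszul_proj_cons (fun v => h (F v)) l w = h (koszul_proj_cons F l w).
Proof.
move=> hD; elim: w F l => [|m w IH] F l /=; first by case: l.1 => //; rewrite (morphD0 hD).
by rewrite hD !IH.
Qed.

Let small_span (z b : A) (c1 c2 : F2) : b + z *+ c1 + 1 *+ c2 = 0 ->
  b \in [:: 0; 1; z; 1 + z].
Proof.
move=> e; have -> : b = z *+ c1 + 1 *+ c2.
  by rewrite -[LHS]addr0 -(boolr_addrr (z *+ c1 + 1 *+ c2)) addrA (addrA b) e add0r.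
by case: (F2_cases c1) (F2_cases c2) => -> [] -> /=;
  rewrite ?mulr0n ?mulr1n ?addr0 ?add0r !inE ?eqxx ?orbT // addrC eqxx ?orbT.
Qed.

Let diff_cons' F a b : mdiff F [:: a; b] =
  model_act a (F [:: b]) + (F [:: lmul a b] + model_act b (F [:: a])).
Proof. by []. Qed.

(* In total degree 0 the cocycle condition puts [a (c1 + c2 y)], for the values
   [c1], [c2] of the projected cochain at [y :: r] and [1 :: r] and for every [a]
   in [A], into the span of [1] and of the last letter, which has at most four
   elements; hence [c1 = c2 = 0]. *)
Let koszul_proj_0 (s : int) k F : (0 < k)%N -> k%:Z + s = 0 -> multiadd F ->
  model_homogeneous s F -> (forall w, size w = k.+1 -> mdiff F w = 0) ->
  forall w, size w = k -> koszul_proj F w = 0.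
Proof.
move=> k_gt0 c0 FM Fh dF0.
pose x (a : A) : letter := (0%N, (0, a)); pose one := x 1.
(* The projection annihilates merging sums, so the cocycle condition survives as a relation between
   the actions of the first and last letters. *)
have actE w : size w = k.+1 -> koszul_proj (fun v => mdiff F v + mergesum F v) w = 0.
  case: w => [//|l w] sw; rewrite /= koszul_proj_consD.
  have /= -> := koszul_proj_mergesum F (l :: w); rewrite addr0.
  apply: (koszul_proj_closed (P := fun y => y = 0) _ _ (w := l :: w)) => [//|_ _ -> ->|u su _ _];
    rewrite ?addr0 //.
  by apply: dF0; rewrite su.
have F_deg0 w : size w = k -> excess w = 0%N -> (F w).2 = 0.
  move=> sw ew; have := Fh w; rewrite /weight sw ew addn0 c0; exact.
pose R w := koszul_proj F w.
have R_deg0 w : size w = k -> (R w).2 = 0.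
  move=> sw; apply: (koszul_proj_closed (P := fun y => y.2 = 0)) => [//|y z /= -> ->|u su eu _].
    by rewrite addr0.
  by apply: F_deg0; rewrite ?su.
have R_span a y r : size (y :: r) = k -> excess (y :: r) = 0%N ->
    a *+ (R (y :: r)).1 + (a * y.2.2) *+ (R (one :: r)).1 \in
    [:: 0; 1; (last y r).2.2; 1 + (last y r).2.2].
  move=> sr er; have [y0 er0] : y.1 = 0%N /\ excess r = 0%N by move: er; rewrite excess_cons; lia.
  pose rho v := if v is z :: u then model_act (last z u) (F (belast z u)) else 0.
  pose lam v := if v is z :: u then model_act z (F u) else 0.
  have E v : mdiff F v + mergesum F v = lam v + rho v.
    rewrite /wdiff; case: v => [|z u]; first by rewrite !rdiff_nil !addr0.
    by rewrite /= lastI rdiff_rcons; char2.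
  have := actE [:: x a, y & r]; rewrite (_ : (fun v => _) = fun v => lam v + rho v); last exact: funext.
  rewrite [koszul_proj _ _]koszul_proj_consD => /(_ (congr1 S sr)).
  (* The first step of the projection makes the first letter [x a] or [lprod (x a) y]; the rest of
     the word is projected independently. *)
  have -> : koszul_proj_cons lam (x a) (y :: r) = model_act (x a) (R (y :: r))
      + model_act (lprod (x a) y) (R (one :: r)).
    rewrite /R /= -(koszul_proj_morph _ _ _ (model_actD (x a))) -(koszul_proj_morph _ _ _ (model_actD (lprod (x a) y))).
    have -> : lraise 0 y = y by rewrite /lraise add0n -surjective_pairing.
    by rewrite y0.
  have [c1 [c2 ->]] : exists c1 c2 : F2, koszul_proj_cons rho (x a) (y :: r) =
      model_act (last y r) (c1, 0) + model_act one (c2, 0).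
    have act0 l (c : F2) : model_act l (c, 0) + model_act l (c, 0) = 0 by exact: addF2.
    apply: (koszul_proj_last (P := fun z => exists c1 c2 : F2, z =
      model_act (last y r) (c1, 0) + model_act one (c2, 0))).
    - by exists 0, 0; rewrite !(morphD0 (@model_actD _)) addr0.
    - move=> _ _ [c1 [c2 ->]] [c1' [c2' ->]]; exists (c1 + c1'), (c2 + c2').
      have D l (c c' : F2) : model_act l (c + c', 0) = model_act l (c, 0) + model_act l (c', 0).
        by rewrite -model_actD; congr (model_act l (_, _)); rewrite addr0.
      by rewrite !D; char2.
    - move=> [|z u] // [su] eu lu; rewrite /rho.
      have FE : F (belast z u) = ((F (belast z u)).1, 0).
        have : (F (belast z u)).2 = 0.
          apply: F_deg0; first by rewrite size_belast su -sr.
          by move: eu; rewrite lastI excess_rcons; lia.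
        by case: (F _) => c d /= ->.
      rewrite FE; case: lu => /= ->; first by exists (F (belast z u)).1, 0;
        rewrite [X in _ = _ + X](morphD0 (@model_actD _)) addr0.
      by exists 0, (F (belast z u)).1; rewrite [X in _ = X + _](morphD0 (@model_actD _)) add0r.
    - by rewrite /excess /= y0 -/(excess r) er0.
  have RE u : size u = k -> R u = ((R u).1, 0).
    by move=> su; have := R_deg0 u su; case: (R u) => c d /= ->.
  rewrite (RE (y :: r)) // (RE (one :: r)) // => /(congr1 (fun z : Y => z.2.2)).
  have act2 l (c : F2) : (model_act l (c, 0)).2.2 = iota (l.2.2 *+ c).
    by rewrite /= addr0 /boolr_smul rmorphMn; exact: mulr_natr.
  rewrite -[LHS]/((model_act (x a) ((R (y :: r)).1, 0)).2.2
    + (model_act (lprod (x a) y) ((R (one :: r)).1, 0)).2.2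
    + ((model_act (last y r) (c1, 0)).2.2 + (model_act one (c2, 0)).2.2)).
  rewrite !act2 -[LHS]/((iota _ : B) + iota _ + (iota _ + iota _)) -!rmorphD.
  rewrite -[RHS]/(0 : B) -(rmorph0 iota) => /iota_inj; rewrite addrA.
  exact: small_span.
have span_large z : exists a : A, a \notin [:: 0; 1; z; 1 + z] by exact: A_large.
have R_zero y r : size (y :: r) = k -> excess (y :: r) = 0%N -> (R (one :: r)).1 = 0 ->
    (R (y :: r)).1 = 0.
  move=> sr er b0; have [a anot] := span_large (last y r).2.2.
  have := R_span a y r sr er; rewrite b0 mulr0n addr0.
  by case: (F2_cases (R (y :: r)).1) => -> //; rewrite mulr1n (negPf anot).
have R_one r : size (one :: r) = k -> excess (one :: r) = 0%N -> (R (one :: r)).1 = 0.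
  (* For [k = 1] the relation [R_span] at the letter 1 is a tautology. The cocycle conditions at
     [[:: x b; x b]] and [[:: x b; one]] are compared instead: the merged letters agree, and [b]
     times the value at 1 falls into the span of 1. *)
  case: r => [|z r] sr er.
    have [b bnot] := span_large 0.
    have FE u : size u = k -> excess u = 0%N -> F u = ((F u).1, 0).
      by move=> su eu; have := F_deg0 u su eu; case: (F u) => c d /= ->.
    have := dF0 [:: x b; x b] (congr1 S sr); have := dF0 [:: x b; one] (congr1 S sr).
    rewrite !diff_cons' => E1 E2.
    have xx : lmul (x b) one = lmul (x b) (x b) by rewrite /lmul /= mulr1 boolr_idem.
    have E : model_act (x b) (F [:: one]) + model_act one (F [:: x b]) = 0.
      by rewrite -[LHS]addr0 -{1}E2 -[RHS]E1 xx; char2.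
    move: E; rewrite (FE [:: one]) // (FE [:: x b]) // => /(congr1 (fun z : Y => z.2.2)).
    have act2 l (c : F2) : (model_act l (c, 0)).2.2 = iota (l.2.2 *+ c).
      by rewrite /= addr0 /boolr_smul rmorphMn; exact: mulr_natr.
    rewrite -[LHS]/((model_act (x b) ((F [:: one]).1, 0)).2.2
      + (model_act one ((F [:: x b]).1, 0)).2.2) !act2 /R /=.
    rewrite -[LHS]/((iota _ : B) + iota _) -rmorphD -[RHS]/(0 : B) -(rmorph0 iota) => /iota_inj.
    case: (F2_cases (F [:: one]).1) => // -> e; case/negP: bnot.
    by apply: (@small_span 0 b 0 (F [:: x b]).1); rewrite mul0rn addr0 -[b]mulr1n.
  (* Otherwise [R_span] is used with a first letter [b] outside the span of 1 and the last letter: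
     if the value at 1 were nonzero, [b] or [1 + b] would lie in this span. *)
  have [b bnot] := span_large (last z r).2.2.
  have := R_span 1 (x b) (z :: r) sr er.
  case: (F2_cases (R [:: one, z & r]).1) => // ->.
  rewrite mulr1n mul1r [last _ _]/= [(x b).2.2]/=; move: (last z r).2.2 bnot => c bnot.
  case: (F2_cases (R [:: x b, z & r]).1) => ->; rewrite ?mulr0n ?mulr1n ?add0r ?(negPf bnot) // => bin.
  suff : b \in [:: 0; 1; c; 1 + c] by rewrite (negPf bnot).
  have -> : b = 1 + (1 + b) by rewrite addrA boolr_addrr add0r.
  move: bin; rewrite !inE => /or4P[] /eqP ->.
  - by rewrite addr0 eqxx orbT.
  - by rewrite boolr_addrr eqxx.
  - by rewrite eqxx !orbT.
  - by rewrite addrA boolr_addrr add0r eqxx !orbT.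
move=> [|y r] sw; first by rewrite -sw in k_gt0.
have [er|er] := eqVneq (excess (y :: r)) 0%N; last first.
  apply: (@koszul_proj_closed V A Y (fun z => z = 0)) => [//|_ _ -> ->|u _ _ ex].
    by rewrite addr0.
  by rewrite ex in er.
have ex1 : excess (one :: r) = 0%N by move: er; rewrite !excess_cons /=; lia.
have := R_zero y r sw er (R_one r _ ex1); have := R_deg0 (y :: r) sw.
by rewrite -/(R (y :: r)); case: (R _) => c d /= -> ->.
Qed.

Theorem model_exact (s : int) k F : (0 < k)%N -> s < 0 -> k%:Z <> 1 - s -> multiadd F ->
  model_homogeneous s F -> (forall w, size w = k.+1 -> mdiff F w = 0) ->
  exists G, [/\ multiadd G, model_homogeneous s G & forall w, size w = k -> mdiff G w = F w].
Proof.
move=> k_gt0 s_lt0 ks FM Fh dF0.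
(* Here [k > 1] follows from [s < 0]. In the other case the value 1 is excluded by [ks], and the
   projection has to be shown to vanish. *)
have [c_gt1|c_le1] := Order.TotalTheory.ltP 1 (k%:Z + s); first by apply: model_boolean_exact => //; lia.
apply: model_koszul_exact => //.
have [c0|c0] := eqVneq (k%:Z + s) 0; first exact: (koszul_proj_0 k_gt0 c0 FM Fh dF0).
move=> w sw; apply: (@koszul_proj_closed V A Y (fun z => z = 0)) => [//|_ _ -> ->|u su eu _].
  by rewrite addr0.
have := Fh u; rewrite /weight su sw eu addn0.
by have : (k%:Z + s < 0)%R; [lia|case: (k%:Z + s)].
Qed.

End Model.

(** * Reinstating units *)

Section UnitalModel.
Variables (V : lmodType F2) (A B : booleanRingType) (iota : {rmorphism A -> B}).
Local Notation letter := (letter V A).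
Local Notation oletter := (option letter).
Local Notation Y := ((F2^o * (V * boolr_vect B))%type : lmodType F2).
Local Notation act := (@model_act V A B iota).
Implicit Types (w u v : seq oletter) (l : oletter).

Definition odegree l : nat := if l is Some x then x.1.+1 else 0.
Definition odegrees w : nat := \sum_(l <- w) odegree l.

Definition omultiadd := (multiadditive (oadd (@ladd V A))).
Notation odiff := (wdiff (omul (@lmul V A)) (oact act) (oact act)).

Definition omodel_homogeneous (s : int) (F : seq oletter -> Y) :=
  forall w, in_degree ((odegrees w)%:Z + s) (F w).

Lemma odegrees_Some (w : seq letter) : odegrees (map Some w) = weight w.
Proof.
rewrite /odegrees /weight; elim: w => [|x w IH]; first by rewrite big_nil.
by rewrite big_cons IH /= excess_cons; lia.
Qed.

Lemma unit_homotopy_closed (P : Y -> Prop) (F : seq oletter -> Y) w : P 0 ->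
  (forall u, size u = (size w).+1 -> odegrees u = odegrees w -> P (F u)) ->
  P (unit_homotopy F w).
Proof.
move=> P0; elim: w F => [//|[x|] w IH] F PF /=; last first.
  by apply: PF; rewrite //= /odegrees !big_cons.
apply: IH => u su eu; apply: PF; first by rewrite /= su.
by move: eu; rewrite /odegrees !big_cons => ->.
Qed.

Let pmapK w : all isSome w -> map Some (pmap id w) = w.
Proof. by elim: w => [|[x|] w IH] //= /IH ->. Qed.

Hypothesis iota_inj : injective iota.
Hypothesis A_large : forall s : seq A, (size s <= 4)%N -> exists a, a \notin s.

Theorem unital_model_exact (s : int) k (F : seq oletter -> Y) :
  (0 < k)%N -> s < 0 -> k%:Z <> 1 - s -> omultiadd F ->
  omodel_homogeneous s F -> (forall w, size w = k.+1 -> odiff F w = 0) ->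
  exists G, [/\ omultiadd G, omodel_homogeneous s G & forall w, size w = k -> odiff G w = F w].
Proof.
move=> k_gt0 s_lt0 ks FM Fh dF0; pose f (w : seq letter) := F (map Some w).
have actD := @model_actD V A B iota.
have [|||g [gM gh dg]] := @model_exact V A B iota iota_inj A_large s k f k_gt0 s_lt0 ks.
- by move=> u a b c v h; rewrite /f !map_cat; exact: FM.
- by move=> w; rewrite -odegrees_Some; exact: Fh.
- by move=> w sw; rewrite -diff_unit_free dF0 // size_map.
(* The homotopy treats the words with a unit; the primitive on unit-free words is extended by zero,
   and [diff_normalized] keeps its differential zero on words with a unit. *)
pose G' w := if all isSome w then g (pmap id w) else 0.
exists (fun w => unit_homotopy F w + G' w); split.
- apply: multiadditiveD; first exact: multiadditive_unit_homotopy.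
  move=> u [a|] [b|] [c|] v // h; rewrite /G' !all_cat /=.
  case: andP => _; last by rewrite addr0.
  have E x : pmap id (u ++ Some x :: v) = pmap id u ++ x :: pmap id v.
    by elim: u => [|[y|] u IH] //=; rewrite IH.
  by rewrite !E; exact: gM.
- move=> w; apply: in_degreeD.
    apply: unit_homotopy_closed => [|u _ <-]; [exact: in_degree0|exact: Fh].
  rewrite /G'; case: ifP => [aw|_]; last exact: in_degree0.
  by rewrite -{1}(pmapK aw) odegrees_Some; exact: gh.
move=> w sw; rewrite diffD; [|exact: oactD..].
have := unit_homotopyP (@lmul V A) actD actD F w.
have -> : unit_homotopy (odiff F) w = 0.
  apply: (unit_homotopy_closed (P := fun y => y = 0)) => // u su _.
  by apply: dF0; rewrite su sw.
rewrite addr0 => ->; have -> : odiff G' w = if all isSome w then F w else 0.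
  case: ifP => aw; last first.
    apply: (diff_normalized _ actD actD) => [v|]; rewrite /G' ?aw //.
    by move=> /negPf ->.
  rewrite -{1}(pmapK aw) diff_unit_free.
  rewrite (@eq_diff _ _ _ _ _ _ g) => [|v _].
    by rewrite dg ?/f ?pmapK // -sw -{2}(pmapK aw) size_map.
  rewrite /G' all_map (eq_all (a2 := xpredT)) // all_predT.
  by congr g; elim: v => //= x v ->.
by rewrite -addrA addF2 addr0.
Qed.

End UnitalModel.

(** * Hochschild cochains as word functions *)

Section LetterElements.
Variables (V : lmodType F2) (A : booleanRingType).
Local Notation letter := (letter V A).
Local Notation Q := (VB V A).

Definition dual_in e (v : V) : dual_gr V e :=
  match e return dual_gr V e with 0 => v | _ => 0 end.
Definition dual_out e : dual_gr V e -> V :=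
  match e return dual_gr V e -> V with 0 => id | _ => fun=> 0 end.

Definition letter_elt (l : letter) : Q (Posz l.1.+1) :=
  (dual_in l.1 l.2.1, l.2.2 : boolr_vect A).
Definition elt_letter e (x : Q (Posz e.+1)) : letter := (e, (dual_out x.1, x.2)).

Definition unletter (l : option letter) : hmg Q :=
  if l is Some x then Tagged (gr Q) (letter_elt x) else Tagged (gr Q) (gone Q).

Lemma dual_outK e (v : dual_gr V e) : dual_in e (dual_out v) = v.
Proof. by case: e v => [|e] v //=; rewrite [RHS]thinmx0. Qed.

Lemma elt_letterK e (x : Q (Posz e.+1)) : letter_elt (elt_letter x) = x.
Proof. by case: x => v a; rewrite /letter_elt /= dual_outK. Qed.

Lemma letter_eltK (l : letter) : elt_letter (letter_elt l) = (l.1, lval l).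
Proof. by case: l => -[|e] [v a]. Qed.

Lemma letter_elt_mul (l m : letter) (k : nat) (e : Posz l.1.+1 + Posz m.1.+1 = Posz k.+1) :
  gmul e (letter_elt l) (letter_elt m) = (0, (l.2.2 * m.2.2 : A) : boolr_vect A).
Proof.
have e' : (l.1.+1 + m.1.+1 = k.+1)%N := congr1 absz e.
exact: (umul_pos e e').
Qed.

Lemma hmulE (P : galg) (i j k : int) (e : i + j = k) (a : P i) (b : P j) :
  hmul (Tagged (gr P) a) (Tagged (gr P) b) = Tagged (gr P) (gmul e a b).
Proof. by case: k / e. Qed.

Lemma unletter_mul l m : unletter (omul (@lmul V A) l m) = hmul (unletter l) (unletter m).
Proof.
case: l m => [l|] [m|] /=.
- have e : Posz l.1.+1 + Posz m.1.+1 = Posz (l.1 + m.1).+2 by rewrite -PoszD addSn addnS.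
  by rewrite (hmulE e) letter_elt_mul.
- by rewrite (hmulE (addr0 (Posz l.1.+1))) gmul1r.
- by rewrite (hmulE (add0r (Posz m.1.+1))) gmul1l.
- by rewrite (hmulE (add0r 0)) gmul1l.
Qed.

Lemma unletter_tag l : tag (unletter l) = (odegree l)%:Z.
Proof. by case: l. Qed.

Lemma letter_elt_add (a b c : letter) (ea : a.1 = c.1) (eb : b.1 = c.1) : ladd a b c ->
  exists e (x y : Q e), [/\ unletter (Some a) = Tagged (gr Q) x,
    unletter (Some b) = Tagged (gr Q) y & unletter (Some c) = Tagged (gr Q) (x + y)].
Proof.
case: a b c ea eb => [n [v a]] [n' [v' a']] [e [v'' a'']] /= -> -> [_ _ h].
exists (Posz e.+1), (letter_elt (e, (v, a))), (letter_elt (e, (v', a'))); split=> //.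
congr Tagged; case: e h => [|e] [] /=; first by move=> -> ->.
by move=> _ ->; congr pair; rewrite /= addr0.
Qed.

Definition zero_letter : option letter := Some (0%N, 0).

(** The zero of degree 0 and the elements of negative degree become the zero letter of degree 1: the
    degree is wrong, but multiadditive functions vanish there in any case. *)
Definition hletter (q : hmg Q) : option letter :=
  match q with
  | existT (Posz 0) c => if (c : F2) == 0 then zero_letter else None
  | existT (Posz e.+1) x => Some (elt_letter x)
  | existT (Negz _) _ => zero_letter
  end.

Lemma hletterP (q : hmg Q) : q = unletter (hletter q) \/ q = Tagged (gr Q) (0 : Q (tag q)).
Proof.
case: q => -[[|e]|n] x /=.
- have [->|x0] := eqVneq (x : F2) 0; [by right|left].
  by congr existT; case: (x : F2) x0 => [[|[|i]]] // lt2 _; apply/val_inj.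
- by left; rewrite elt_letterK.
- by right; rewrite [x]ugr_negz0.
Qed.

Lemma oadd_zero_letter : oadd (@ladd V A) zero_letter zero_letter zero_letter.
Proof. exact: ladd_zero. Qed.

End LetterElements.

Section MergeSum.
Variables (L : Type) (mul : L -> L -> L) (Y : lmodType F2) (x0 : L).

Definition merge_at i (w : seq L) :=
  take i w ++ mul (nth x0 w i) (nth x0 w i.+1) :: drop i.+2 w.

Lemma size_merge_at n i w : size w = n.+1 -> (i < n)%N -> size (merge_at i w) = n.
Proof. by move=> sw lti; rewrite size_cat /= size_drop size_take sw ltnS ltnW //; lia. Qed.

Lemma nth_merge_at n i w j : size w = n.+1 -> (i < n)%N ->
  nth x0 (merge_at i w) j = if (j < i)%N then nth x0 w j
    else if j == i then mul (nth x0 w i) (nth x0 w i.+1) else nth x0 w j.+1.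
Proof.
move=> sw lti; rewrite nth_cat size_takel; last by rewrite sw; lia.
case: ltnP => [ltj|]; first by rewrite nth_take.
rewrite leq_eqVlt => /orP[/eqP <-|ltj]; first by rewrite subnn eqxx.
rewrite gtn_eqF // (_ : (j - i)%N = (j - i.+1).+1) /=; last by lia.
by rewrite nth_drop; congr nth; lia.
Qed.

Lemma mergesumE n (F : seq L -> Y) w : size w = n.+1 ->
  rdiff mul (fun=> fun=> 0) F w = \sum_(i < n) F (merge_at i w).
Proof.
elim: n F w => [|n IH] F [|x [|y r]] //; first by rewrite big_ord0.
move=> [sr]; by rewrite rdiff_cons2 big_ord_recl IH //= ?sr // /merge_at /= drop0.
Qed.

End MergeSum.

Section Bridge.
Variables (V : lmodType F2) (A B : booleanRingType) (iota : {rmorphism A -> B}).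
Local Notation letter := (letter V A).
Local Notation Q := (VB V A).
Local Notation Y := ((F2^o * (V * boolr_vect B))%type : lmodType F2).
Local Notation act := (@model_act V A B iota).
Notation odiff := (wdiff (omul (@lmul V A)) (oact act) (oact act)).

Variable M : gbimod Q.
Variables (enc : forall t, M t -> Y) (dec : forall t, Y -> M t).
Arguments enc : clear implicits.
Arguments dec : clear implicits.
Hypothesis encD : forall t, {morph enc t : x y / x + y}.
Hypothesis decD : forall t, {morph dec t : x y / x + y}.
Hypothesis encK : forall t x, dec t (enc t x) = x.
Hypothesis decK : forall t y, in_degree t y -> enc t (dec t y) = y.
Hypothesis enc_degree : forall t x, in_degree t (enc t x).
Hypothesis enc_lact : forall l (j k : int) (e : tag (unletter l) + j = k) x,
  enc k (lact e (tagged (unletter l)) x) = oact act l (enc j x).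
Hypothesis enc_ract : forall l (j k : int) (e : j + tag (unletter l) = k) x,
  enc k (ract e x (tagged (unletter l))) = oact act l (enc j x).

Definition word_args n (w : seq (option letter)) : 'I_n -> hmg Q :=
  fun i => unletter (nth None w i).
Arguments word_args : clear implicits.

Lemma hdeg_word_args n w : size w = n -> hdeg (word_args n w) = (odegrees w)%:Z.
Proof.
move=> <-; rewrite /hdeg /odegrees (big_nth None) big_mkord.
rewrite (big_morph Posz PoszD (erefl _)).
by apply: eq_bigr => i _; rewrite unletter_tag.
Qed.

Definition word_cochain n s (f : cochain M n s) (w : seq (option letter)) : Y :=
  if size w == n then enc _ (f (word_args n w) _ erefl) else 0.

Lemma precochain_eq n s (f : precochain M n s) a b t u (ea : hdeg a + s = t) (eb : hdeg b + s = u) :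
  a = b -> enc t (f a t ea) = enc u (f b u eb).
Proof.
move=> ab; case: b / ab eb => eb; have tu : t = u by rewrite -ea -eb.
by case: u / tu eb => eb; rewrite (Prop_irrelevance ea eb).
Qed.

Lemma word_cochainE n s (f : cochain M n s) w t e : size w = n ->
  word_cochain f w = enc t (f (word_args n w) t e).
Proof. by move=> sw; rewrite /word_cochain sw eqxx; exact: precochain_eq. Qed.

Lemma word_cochain_homogeneous n s (f : cochain M n s) :
  omodel_homogeneous s (word_cochain f).
Proof.
move=> w; rewrite /word_cochain; case: eqP => [sw|_]; last exact: in_degree0.
by rewrite -(hdeg_word_args sw); exact: enc_degree.
Qed.

Lemma word_cochain_multiadd n s (f : cochain M n s) : omultiadd (word_cochain f).
Proof.
move=> u [a|] [b|] [c|] v // h.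
have sz x : size (u ++ x :: v) = size (u ++ Some c :: v) by rewrite !size_cat.
rewrite /word_cochain !sz; case: eqP => sw; last by rewrite addr0.
have [ea eb _] := h; have [j [x [y [ax ay axy]]]] := letter_elt_add ea eb h.
have lti : (size u < n)%N by rewrite -sw size_cat /=; lia.
pose i := Ordinal lti; pose p := word_args n (u ++ Some c :: v).
have E l z : unletter l = Tagged (gr Q) z ->
    word_args n (u ++ l :: v) = [eta p with i |-> Tagged (gr Q) (z : Q j)].
  move=> lz; apply: functional_extensionality_dep => k; rewrite /= /p /word_args -val_eqE /=.
  rewrite !nth_cat; case: ltnP => [ltk|lek]; first by rewrite ltn_eqF.
  case: eqP => [->|/eqP nk]; first by rewrite subnn.
  by rewrite -[(k - _)%N]prednK // subn_gt0 ltn_neqAle eq_sym nk.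
have e0 z : hdeg [eta p with i |-> Tagged (gr Q) (z : Q j)] + s =
    hdeg [eta p with i |-> Tagged (gr Q) x] + s by congr (_ + _); exact: hdeg_with.
have axy' : unletter (Some c) = Tagged (gr Q) (1 *: x + y) by rewrite scale1r.
rewrite (precochain_eq f erefl (e0 _) (E _ _ axy')).
rewrite (precochain_eq f erefl (e0 x) (E _ _ ax)) (precochain_eq f erefl (e0 y) (E _ _ ay)).
by rewrite (cochainP f _ (e0 x) (e0 y)) scale1r encD.
Qed.

Lemma word_cochain_diff n s (f : cochain M n s) w t e : size w = n.+1 ->
  enc t (hdiff f (word_args n.+1 w) t e) = odiff (word_cochain f) w.
Proof.
move=> sw; rewrite /= /hdiff_fun !encD.
have [l [u [v [m [wl wm su sv]]]]] := split_ends sw.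
have left q b (e' : tag q + (hdeg b + s) = t) : q = unletter l -> b = word_args n u ->
    enc t (lact e' (tagged q) (f b _ erefl)) = oact act l (word_cochain f u).
  by move=> eq eb; subst q b; rewrite enc_lact (word_cochainE f _ su).
have right q b (e' : hdeg b + s + tag q = t) : q = unletter m -> b = word_args n v ->
    enc t (ract e' (f b _ erefl) (tagged q)) = oact act m (word_cochain f v).
  by move=> eq eb; subst q b; rewrite enc_ract (word_cochainE f _ sv).
rewrite left; last 2 first.
- by rewrite /word_args wl.
- by apply: functional_extensionality_dep => i; rewrite /htail /word_args wl.
rewrite right; last 2 first.
- by rewrite /word_args /= wm nth_rcons sv ltnn eqxx.
- apply: functional_extensionality_dep => i.
  by rewrite /hinit /word_args /= wm nth_rcons sv ltn_ord.
have -> : odiff (word_cochain f) w = oact act l (word_cochain f u)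
    + (\sum_(i < n) word_cochain f (merge_at (omul (@lmul V A)) None i w)
    + oact act m (word_cochain f v)).
  by rewrite -(mergesumE _ None _ sw) wm -rdiff_rcons -wm wl.
rewrite addrA; congr (_ + _ + _).
rewrite (big_morph _ (@encD t) (morphD0 (@encD t))); apply: eq_bigr => i _.
have lti := ltn_ord i.
have ew : hmerge i (word_args n.+1 w) = word_args n (merge_at (omul (@lmul V A)) None i w).
  apply: functional_extensionality_dep => j; rewrite /hmerge /word_args (nth_merge_at _ _ _ sw) //.
  rewrite -val_eqE /= /bump /= add1n; case: ltngtP => // ->.
  by rewrite unletter_mul.
have e' := hmerge_deg i e; rewrite ew in e'.
rewrite (word_cochainE f e' (size_merge_at _ _ sw lti)).
exact: precochain_eq.
Qed.

Lemma cochain_zero n s (f : cochain M n s) a t e i :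
  a i = Tagged (gr Q) (0 : Q (tag (a i))) -> f a t e = 0.
Proof.
move=> ai; pose z : Q (tag (a i)) := 1 *: 0 + 0.
have z0 : z = 0 by rewrite /z scaler0 addr0.
have ea : a = [eta a with i |-> Tagged (gr Q) z].
  by apply: functional_extensionality_dep => j /=; case: eqP => [->|//]; rewrite z0.
have e' : hdeg [eta a with i |-> Tagged (gr Q) z] + s = t by rewrite -ea.
have e0 : hdeg [eta a with i |-> Tagged (gr Q) (0 : Q (tag (a i)))] + s = t by rewrite -z0.
transitivity (f _ t e'); first exact: (@precochain_congr _ _ _ _ f).
rewrite (cochainP f e' e0 e0); set y : M t := f _ _ _.
by rewrite scale1r addF2.
Qed.

Definition args_word n (a : 'I_n -> hmg Q) := [seq hletter (a i) | i <- enum 'I_n].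

Lemma size_args_word n (a : 'I_n -> hmg Q) : size (args_word a) = n.
Proof. by rewrite size_map size_enum_ord. Qed.

Lemma nth_args_word n (a : 'I_n -> hmg Q) (i : 'I_n) : nth None (args_word a) i = hletter (a i).
Proof. by rewrite (nth_map i) ?size_enum_ord // nth_ord_enum. Qed.

Lemma args_word_upd n (a : 'I_n -> hmg Q) (i : 'I_n) z : args_word [eta a with i |-> z] =
  take i (args_word a) ++ hletter z :: drop i.+1 (args_word a).
Proof.
have sz : size (take i (args_word a)) = i by rewrite size_takel // size_args_word ltnW.
apply: (@eq_from_nth _ None) => [|j].
  by rewrite size_cat /= size_drop sz !size_args_word; have := ltn_ord i; lia.
rewrite size_args_word => ltj; rewrite -[j]/(val (Ordinal ltj)) nth_args_word /= -val_eqE /=.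
rewrite nth_cat sz; case: ltngtP => [ji|ij|->].
- by rewrite nth_take // -[j]/(val (Ordinal ltj)) nth_args_word.
- rewrite (_ : (j - i)%N = (j - i.+1).+1) /=; last by lia.
  rewrite nth_drop subnKC // -[X in nth _ _ X]/(val (Ordinal ltj)) nth_args_word.
  by congr hletter.
- by rewrite subnn.
Qed.

Lemma omultiadd_zero (G : seq (option letter) -> Y) u v :
  omultiadd G -> G (u ++ zero_letter _ _ :: v) = 0.
Proof. by move=> GM; apply: (multiadditive_zero _ _ GM); exact: oadd_zero_letter. Qed.

Lemma omultiadd_hletter (G : seq (option letter) -> Y) u v j (x y : Q j) : omultiadd G ->
  G (u ++ hletter (Tagged (gr Q) (x + y)) :: v) =
  G (u ++ hletter (Tagged (gr Q) x) :: v) + G (u ++ hletter (Tagged (gr Q) y) :: v).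
Proof.
move=> GM; have G0 := omultiadd_zero u v GM.
case: j x y => [[|e]|n] x y /=; last by rewrite G0 addr0.
  by case: (F2_cases x) => ->; case: (F2_cases y) => ->;
    rewrite ?addr0 ?add0r ?eqxx ?G0 ?addr0 ?add0r ?addF2.
apply: GM; split=> //=; case: e x y => [|e] x y; congr pair.
by rewrite /= addr0.
Qed.

Definition cochain_of_word n s (G : seq (option letter) -> Y) (GM : omultiadd G) :
  cochain M n s.
Proof.
exists (fun a t _ => dec t (G (args_word a))) => a i j c x y t _ _ _.
rewrite !args_word_upd omultiadd_hletter // decD; congr (_ + _).
case: (F2_cases c) => ->; last by rewrite !scale1r.
rewrite !scale0r.
have := omultiadd_hletter (take i (args_word a)) (drop i.+1 (args_word a)) (0 : Q j) 0 GM.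
by rewrite addr0 addF2 => ->; rewrite (morphD0 (@decD t)).
Defined.

(** A family of homogeneous elements either comes from a word or has a zero entry, and in the second
    case both cochains vanish. *)
Lemma cochain_ext n s (f g : cochain M n s) :
  (forall w t e, size w = n -> f (word_args n w) t e = g (word_args n w) t e) -> f = g.
Proof.
move=> fg; apply: cochain_eq => a t e.
have [[i ai]|na] := pselect (exists i, a i = Tagged (gr Q) (0 : Q (tag (a i)))).
  by rewrite !(cochain_zero _ e ai).
have ea : a = word_args n (args_word a).
  apply: functional_extensionality_dep => i; rewrite /word_args nth_args_word.
  by case: (hletterP (a i)) => // ai; case: na; exists i.
by move: (e); rewrite ea => e'; apply: fg; rewrite size_args_word.
Qed.

Lemma omultiadd_letter_eltK (G : seq (option letter) -> Y) w : omultiadd G ->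
  G (map (fun l => hletter (unletter l)) w) = G w.
Proof.
move=> GM; have : forall u, G (u ++ map (fun l => hletter (unletter l)) w) = G (u ++ w).
  elim: w => [//|l w IH] u /=.
  rewrite -cat_rcons IH cat_rcons; case: l => [l|] //=.
  rewrite letter_eltK (GM u (Some (l.1, 0)) (Some (l.1, lval l)) (Some l)).
    suff -> : G (u ++ Some (l.1, 0) :: w) = 0 by rewrite add0r.
    by apply: (multiadditive_zero _ _ GM); exact: (@ladd_zero V A l.1).
  by split=> //; case: l => -[|e] [v a]; exact: (esym (add0r _)).
by move/(_ [::]).
Qed.

Theorem HH_eq0 k s :
  (forall F, omultiadd F -> omodel_homogeneous s F ->
    (forall w, size w = k.+2 -> odiff F w = 0) ->
    exists G, [/\ omultiadd G, omodel_homogeneous s G & forall w, size w = k.+1 -> odiff G w = F w]) ->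
  forall x : HH k.+1 s M, x = 0.
Proof.
move=> exact x; pose z := cohom_repr x; pose f : cochain M k.+1 s := val z.
have df0 : hdiff f = 0 by apply/eqP; exact: (cocycle_valP z).
have [||w sw|G [GM Gh dG]] := exact (word_cochain f).
- exact: word_cochain_multiadd.
- exact: word_cochain_homogeneous.
- by rewrite -(word_cochain_diff f (erefl : hdeg (word_args k.+2 w) + s = _) sw) df0 (morphD0 (@encD _)).
pose g := cochain_of_word k s GM.
have gG w : size w = k -> word_cochain g w = G w.
  move=> sw; have ew : args_word (word_args k w) = map (fun l => hletter (unletter l)) w.
    apply: (@eq_from_nth _ None) => [|i]; rewrite size_args_word ?size_map // => lti.
    by rewrite -[i]/(val (Ordinal lti)) nth_args_word (nth_map None) // sw.
  rewrite /word_cochain sw eqxx /= ew omultiadd_letter_eltK // decK //.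
  by rewrite hdeg_word_args.
have dg : hdiff g = f.
  apply: cochain_ext => w t e sw; rewrite -[LHS]encK -[RHS]encK; congr (dec t _).
  rewrite (word_cochain_diff g e sw) -(word_cochainE f e sw) -dG //.
  by apply: eq_diff => v sv; apply: gG; apply/eqP; rewrite -eqSS sv sw.
rewrite -(cohom_reprK x) -[RHS](raddf0 (@cohom_class _ _ _ _ (@hdiff Q M k s) (@hdiff Q M k.+1 s))).
by apply/cohom_class_eq; exists g; rewrite subr0; exact: dg.
Qed.

End Bridge.

Section Encoding.
Variables (V : lmodType F2) (A B : booleanRingType) (iota : {rmorphism A -> B}).
Local Notation Y := ((F2^o * (V * boolr_vect B))%type : lmodType F2).
Local Notation act := (@model_act V A B iota).
Local Notation Q := (VB V B).

Definition encode (t : int) : Q t -> Y := match t return Q t -> Y with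
  | Posz 0 => fun c => (c, 0)
  | Posz e.+1 => fun x => (0, (dual_out x.1, x.2))
  | Negz _ => fun=> 0 end.

Definition decode (t : int) : Y -> Q t := match t return Y -> Q t with
  | Posz 0 => fun y => y.1
  | Posz e.+1 => fun y => (dual_in e y.2.1, y.2.2)
  | Negz _ => fun=> 0 end.
Arguments encode : clear implicits.
Arguments decode : clear implicits.

Lemma encodeD t : {morph encode t : x y / x + y}.
Proof.
case: t => [[|e]|n] x y /=; rewrite ?addr0 //; congr (_, _); rewrite /= ?addr0 //.
by congr (_, _); case: e x y => [|e] x y //=; rewrite addr0.
Qed.

Lemma decodeD t : {morph decode t : x y / x + y}.
Proof.
case: t => [[|e]|n] x y /=; rewrite ?addr0 //; congr (_, _).
by case: e => [|e] //=; rewrite addr0.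
Qed.

Lemma encodeK t x : decode t (encode t x) = x.
Proof.
case: t x => [[|e]|n] x //=; last by rewrite [RHS]thinmx0.
by rewrite dual_outK; case: x.
Qed.

Lemma decodeK t y : in_degree t y -> encode t (decode t y) = y.
Proof.
by case: t y => [[|[|e]]|n] [c [v b]] /=; [move=> ->|move=> ->|case=> -> ->|move=> ->].
Qed.

Lemma encode_degree t x : in_degree t (encode t x).
Proof. by case: t x => [[|[|e]]|n] x. Qed.

Definition letter_image (l : letter V A) : Q (Posz l.1.+1) :=
  (dual_in l.1 l.2.1, iota l.2.2 : boolr_vect B).

Let encode_image c l : encode (Posz l.1.+1) (c *: letter_image l) = act l (c, 0).
Proof.
congr (_, (_, _)); first by case: l => -[|e] x //=; rewrite scaler0.
by rewrite /= addr0 /boolr_smul; exact: (esym (mulr_natr _ _)).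
Qed.

Let encode_product l k (b : boolr_vect B) : (l.1 < k)%N ->
  encode (Posz k.+1) (0, boolr_smul (iota l.2.2) b) = act l (0, (0, b)).
Proof.
case: k => // k _; congr (_, (_, _)); rewrite /= ?scale0r ?add0r //.
Qed.

Lemma encode_umull l (j k : int) (e : Posz l.1.+1 + j = k) (x : Q j) :
  encode k (umul e (letter_image l) x) = act l (encode j x).
Proof.
case: j e x => [[|n]|n] e x.
- have ek : Posz l.1.+1 = k by rewrite -e addr0.
  by case: k / ek e => e; rewrite umul_0r encode_image.
- case: k e => [[|k]|k] e; [discriminate e| |discriminate e].
  have e' : (l.1.+1 + n.+1 = k.+1)%N := congr1 absz e.
  have lk : (l.1 < k)%N by move: e' => /=; lia.
  rewrite (umul_pos e e') [LHS](encode_product _ lk).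
  by congr (_, (_, _)); rewrite /= ?scale0r.
- rewrite umul_negr (morphD0 (@encodeD k)) (morphD0 (@model_actD V A B iota l)) //.
Qed.

Lemma encode_umulr l (j k : int) (e : j + Posz l.1.+1 = k) (x : Q j) :
  encode k (umul e x (letter_image l)) = act l (encode j x).
Proof.
case: j e x => [[|n]|n] e x.
- have ek : Posz l.1.+1 = k by rewrite -e add0r.
  by case: k / ek e => e; rewrite umul_0l encode_image.
- case: k e => [[|k]|k] e; [discriminate e| |discriminate e].
  have e' : (n.+1 + l.1.+1 = k.+1)%N := congr1 absz e.
  have lk : (l.1 < k)%N by move: e' => /=; lia.
  rewrite (umul_pos e e'); have := encode_product (x.2 : boolr_vect B) lk.
  rewrite /boolr_smul mulrC => E; rewrite [LHS]E.
  by congr (_, (_, _)); rewrite /= ?scale0r.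
- rewrite umul_negl (morphD0 (@encodeD k)) (morphD0 (@model_actD V A B iota l)) //.
Qed.

End Encoding.

(** * Vanishing of the Hochschild cohomology *)

Section Vanishing.
Variables (V : lmodType F2) (A B : booleanRingType) (iota : {rmorphism A -> B}).
Hypothesis iota_inj : injective iota.
Hypothesis A_large : forall s : seq A, (size s <= 4)%N -> exists a, a \notin s.
Local Notation Q := (VB V B).

(* [M] is [V_* \sqcap B_*] regarded as a bimodule over [V_* \sqcap A_*]. *)
Variables (M : gbimod (VB V A)) (val : forall t, M t -> Q t) (mk : forall t, Q t -> M t).
Hypothesis valD : forall t, {morph @val t : x y / x + y}.
Hypothesis mkD : forall t, {morph @mk t : x y / x + y}.
Hypothesis valK : forall t, cancel (@val t) (@mk t).
Hypothesis mkK : forall t, cancel (@mk t) (@val t).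

Lemma HH_VB_eq0 (m : int) : m < 0 ->
  (forall (l : letter V A) (j k : int) (e : Posz l.1.+1 + j = k) (x : M j),
    val (lact e (letter_elt l) x) = umul e (letter_image iota l) (val x)) ->
  (forall (l : letter V A) (j k : int) (e : j + Posz l.1.+1 = k) (x : M j),
    val (ract e x (letter_elt l)) = umul e (val x) (letter_image iota l)) ->
  forall k : nat, k%:Z <> 1 - m -> forall x : HH k m M, x = 0.
Proof.
move=> m_lt0 val_lact val_ract; pose enc t (x : M t) := encode (val x).
pose dec t y : M t := mk (decode t y).
have encD t : {morph enc t : x y / x + y} by move=> x y; rewrite /enc valD encodeD.
have encK t x : dec t (enc t x) = x by rewrite /dec /enc encodeK valK.
have deg t x : in_degree t (enc t x) by exact: encode_degree.
case=> [_|k km]; last first.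
  apply: (@HH_eq0 V A B iota M enc dec) => //.
  - by move=> t x y; rewrite /dec decodeD mkD.
  - by move=> t y yt; rewrite /enc /dec mkK decodeK.
  - move=> [l|] j k' e x; first by rewrite /enc val_lact encode_umull.
    have ek : j = k' by rewrite -e add0r.
    by case: k' / ek e => e; rewrite /enc lact1.
  - move=> [l|] j k' e x; first by rewrite /enc val_ract encode_umulr.
    have ek : j = k' by rewrite -e addr0.
    by case: k' / ek e => e; rewrite /enc ract1.
  by move=> F FM Fh dF; exact: (unital_model_exact iota_inj A_large).
(* In cohomological degree 0 a cochain is a single element of degree [m < 0]. *)
move=> x; rewrite -(cohom_reprK x); set z := cohom_repr x.
have z0 : cocycle_val z = 0.
  apply: cochain_eq => a t e; rewrite -[LHS]encK -[RHS]encK.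
  have te : t = m by rewrite -e /hdeg big_ord0 add0r.
  have E y : enc t y = 0.
    have := deg t y; have : t < 0 by rewrite te.
    by case: (t) y.
  by rewrite !E.
rewrite -[RHS](raddf0 (@cohom_class _ _ _ _ _ _)).
by apply/cohom_class_eq; exists 0; rewrite subr0; exact: (esym z0).
Qed.

End Vanishing.

Lemma notin_seq (T : eqType) (x : T) (S : set T) (n : nat) (s : seq T) :
  (`I_n #<= S)%card -> (size s < n)%N -> exists2 a, S a & a \notin s.
Proof.
move=> nS sn; apply: contrapT => no.
have Ss : (S `<=` [set` s])%classic.
  by move=> a Sa; apply/negPn/negP => as_; apply: no; exists a.
have sI : ([set` s] `<=` nth x s @` `I_(size s))%classic.
  by move=> a /= /(nthP x)[i lti <-]; exists i.
have := card_le_trans nS (card_le_trans (subset_card_le Ss)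
  (card_le_trans (subset_card_le sI) (card_image_le _ _))).
by rewrite card_le_II leqNgt sn.
Qed.

Section Applications.
Variables (V : lmodType F2) (B : booleanRingType).

Lemma HH_regular_eq0 : infinite_set [set: B] -> forall m : int, m < 0 ->
  forall k : nat, k%:Z <> 1 - m -> forall x : HH k m (regular_bimod (VB V B)), x = 0.
Proof.
move=> B_inf m m_lt0 k km.
have image (l : letter V B) : letter_image idfun l = letter_elt l by [].
apply: (@HH_VB_eq0 V B B idfun _ _ (regular_bimod (VB V B)) (fun t x => x) (fun t x => x)) => //.
move=> s _; apply: contrapT => no; apply: B_inf.
apply: (@sub_finite_set _ _ [set` s]%classic) (finite_seq s) => a _ /=.
by apply/negPn/negP => an; apply: no; exists a.
Qed.

Lemma HH_subring_eq0 (A : subringClosed B) : (`I_8 #<= [set` A])%card ->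
  forall m : int, m < 0 -> forall k : nat, k%:Z <> 1 - m ->
  forall x : HH k m (VB_bimod V A), x = 0.
Proof.
move=> A_large m m_lt0 k km.
apply: (@HH_VB_eq0 V (subring A) B (val : {rmorphism subring A -> B}) _ _ (VB_bimod V A)
  (fun t x => x) (fun t x => x)) => //.
move=> s ss; have [|a Aa an] := notin_seq 0 (s := map val s) A_large.
  by rewrite size_map ltnS (leq_trans ss).
by exists (Subring Aa); apply: contra an => /(map_f val).
Qed.

End Applications.

(** * Convolution of word functions *)

Section Convolution.
Variables (L : Type) (mul : L -> L -> L) (Y : lmodType F2).
Hypothesis mulA : forall x y z, mul x (mul y z) = mul (mul x y) z.
Implicit Types (F G : seq L -> Y) (phi psi : seq L -> Y -> Y).
Notation mergesum := (rdiff mul (fun=> fun=> 0 : Y)).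

(* The sum of [phi v (F u)] over all splittings [w = u ++ v]. *)
Fixpoint conv phi F w : Y := match w with
  | [::] => phi [::] (F [::])
  | x :: w' => phi w (F [::]) + conv phi (fun v => F (x :: v)) w' end.

Definition additive_family phi := forall w, {morph phi w : x y / x + y}.

Let zeroD : forall x : L, {morph (fun=> 0 : Y) : y z / (y : Y) + z}.
Proof. by move=> x y z; rewrite addr0. Qed.

Lemma eq_conv phi F G w : (forall v, (size v <= size w)%N -> F v = G v) ->
  conv phi F w = conv phi G w.
Proof.
elim: w F G => [|x w IH] F G E /=; rewrite E //; congr (_ + _).
by apply: IH => v sv; apply: E.
Qed.

Lemma convD phi F G w : additive_family phi ->
  conv phi (fun v => F v + G v) w = conv phi F w + conv phi G w.
Proof.
move=> phiD; elim: w F G => [|x w IH] F G /=; first exact: phiD.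
by rewrite IH phiD; char2.
Qed.

Lemma convDl phi psi F w :
  conv (fun v y => phi v y + psi v y) F w = conv phi F w + conv psi F w.
Proof. by elim: w F => [|x w IH] F //=; rewrite IH; char2. Qed.

Lemma mergesum_conv phi F w : additive_family phi ->
  mergesum (conv phi F) w =
  conv phi (mergesum F) w + conv (fun v y => mergesum (phi^~ y) v) F w.
Proof.
move=> phiD; elim: w F => [|x [|y r] IH] F.
- by rewrite /= !rdiff_nil (morphD0 (phiD _)) addr0.
- by rewrite /= !rdiff_nil !rdiff1 !(morphD0 (phiD _)) !addr0.
rewrite rdiff_cons2.
have -> : mergesum (fun v => conv phi F (x :: v)) (y :: r) =
    mergesum (fun v => phi (x :: v) (F [::])) (y :: r)
    + mergesum (conv phi (fun v => F (x :: v))) (y :: r) by rewrite -rdiffD.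
rewrite IH.
pose shift v := if v is z :: u then F (mul x z :: u) else 0.
have -> : conv phi (mergesum F) [:: x, y & r] =
    phi [:: x, y & r] 0 + conv phi (fun v => mergesum F (x :: v)) (y :: r) by [].
rewrite (@eq_conv _ (fun v => mergesum F (x :: v))
   (fun v => shift v + mergesum (fun u => F (x :: u)) v)); last first.
  by case=> [|z u] _; rewrite ?rdiff_nil ?addr0 // rdiff_cons2.
rewrite convD // (morphD0 (phiD _)) add0r.
have -> : conv phi shift (y :: r) = conv phi (fun v => F (mul x y :: v)) r.
  by rewrite /= (morphD0 (phiD _)) add0r.
have -> : conv (fun v z => mergesum (phi^~ z) v) F [:: x, y & r] =
    mergesum (phi^~ (F [::])) [:: x, y & r]
    + conv (fun v z => mergesum (phi^~ z) v) (fun v => F (x :: v)) (y :: r) by [].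
rewrite rdiff_cons2.
have -> : conv phi F (mul x y :: r) = phi (mul x y :: r) (F [::])
  + conv phi (fun v => F (mul x y :: v)) r by [].
by char2.
Qed.

Lemma conv_conv phi psi F w : additive_family phi ->
  conv phi (conv psi F) w = conv (fun v y => conv phi (psi^~ y) v) F w.
Proof.
move=> phiD; elim: w F => [//|x w IH] F /=.
rewrite -IH -addrA -convD //.
Qed.

Variable D : Y -> Y.
Hypothesis DD : {morph D : x y / x + y}.
Hypothesis D_D : forall y, D (D y) = 0.

Lemma D_conv phi F w : D (conv phi F w) =
  conv phi (fun v => D (F v)) w + conv (fun v y => D (phi v y) + phi v (D y)) F w.
Proof.
elim: w F => [|x w IH] F /=; first by rewrite addrCA addF2 addr0.
by rewrite DD IH; char2.
Qed.

Lemma D_mergesum F w : D (mergesum F w) = mergesum (fun v => D (F v)) w.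
Proof. by rewrite -(rdiff_morph _ DD (ra' := fun=> fun=> 0)) // => *; exact: morphD0. Qed.

(** The twisted differential on word functions. By [nabla_nabla] its square is the convolution with
    the curvature of [phi], so that it is a differential when the curvature vanishes. *)
Definition nabla phi F w : Y := D (F w) + mergesum F w + conv phi F w.

Definition curvature_op phi w y : Y := D (phi w y) + phi w (D y)
  + mergesum (phi^~ y) w + conv phi (phi^~ y) w.

Lemma nablaD phi F G w : additive_family phi ->
  nabla phi (fun v => F v + G v) w = nabla phi F w + nabla phi G w.
Proof. by move=> phiD; rewrite /nabla DD rdiffD // convD //; char2. Qed.

Lemma nabla_nabla phi F w : additive_family phi ->
  nabla phi (nabla phi F) w = conv (curvature_op phi) F w.
Proof.
move=> phiD; rewrite {1}/nabla.
have -> : mergesum (nabla phi F) w = mergesum (fun v => D (F v)) w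
    + mergesum (mergesum F) w + mergesum (conv phi F) w by rewrite -!rdiffD.
have -> : conv phi (nabla phi F) w = conv phi (fun v => D (F v)) w
    + conv phi (mergesum F) w + conv phi (conv phi F) w by rewrite -!convD.
have -> : conv (curvature_op phi) F w = conv (fun v y => D (phi v y) + phi v (D y)) F w
    + conv (fun v y => mergesum (phi^~ y) v) F w + conv (fun v y => conv phi (phi^~ y) v) F w.
  by rewrite -!convDl.
rewrite rdiff_rdiff // -conv_conv // mergesum_conv // /nabla !DD D_D D_conv D_mergesum.
by char2.
Qed.

End Convolution.

(** * The total space of a differential graded algebra *)

Section Total.
Variable G : int -> lmodType F2.

(** The product of all components. Values of a word function have degrees depending on the word; in
    one ambient space [rdiff] and [conv] apply without transport, and the degree becomes the
    predicate [homog]. *)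
Definition tot : Type := forall i, G i.
Implicit Types x y z : tot.

HB.instance Definition _ := gen_eqMixin tot.
HB.instance Definition _ := gen_choiceMixin tot.

Lemma totP x y : (forall i, x i = y i) -> x = y.
Proof. exact: functional_extensionality_dep. Qed.

Definition tot_add x y : tot := fun i => x i + y i.
Definition tot_opp x : tot := fun i => - x i.
Definition tot_zero : tot := fun i => 0.
Definition tot_scale (c : F2) x : tot := fun i => c *: x i.

Fact tot_addA : associative tot_add.
Proof. by move=> x y z; apply: totP => i; exact: addrA. Qed.
Fact tot_addC : commutative tot_add.
Proof. by move=> x y; apply: totP => i; exact: addrC. Qed.
Fact tot_add0 : left_id tot_zero tot_add.
Proof. by move=> x; apply: totP => i; exact: add0r. Qed.
Fact tot_addN : left_inverse tot_zero tot_opp tot_add.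
Proof. by move=> x; apply: totP => i; exact: addNr. Qed.
HB.instance Definition _ := GRing.isZmodule.Build tot tot_addA tot_addC tot_add0 tot_addN.

Fact tot_scaleA b c x : tot_scale b (tot_scale c x) = tot_scale (b * c) x.
Proof. by apply: totP => i; exact: scalerA. Qed.
Fact tot_scale1 : left_id 1 tot_scale.
Proof. by move=> x; apply: totP => i; exact: scale1r. Qed.
Fact tot_scaleDr : right_distributive tot_scale +%R.
Proof. by move=> b x y; apply: totP => i; exact: scalerDr. Qed.
Fact tot_scaleDl x : {morph tot_scale^~ x : b c / b + c}.
Proof. by move=> b c; apply: totP => i; exact: scalerDl. Qed.
HB.instance Definition _ := GRing.Zmodule_isLmodule.Build F2 tot
  tot_scaleA tot_scale1 tot_scaleDr tot_scaleDl.

Lemma totD x y i : (x + y) i = x i + y i. Proof. by []. Qed.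

Definition homog (n : int) x := forall i, i <> n -> x i = 0.

Lemma homog0 n : homog n 0. Proof. by []. Qed.
Lemma homogD n x y : homog n x -> homog n y -> homog n (x + y).
Proof. by move=> hx hy i ni; rewrite totD hx // hy // addr0. Qed.

Definition at_deg (n : int) (a : G n) : tot := fun i =>
  if pselect (n = i) is left e then ecast j (G j) e a else 0.

Lemma at_degE n (a : G n) : at_deg a n = a.
Proof.
rewrite /at_deg; case: pselect => // e.
by rewrite (Prop_irrelevance e erefl).
Qed.

Lemma at_deg_homog n (a : G n) : homog n (at_deg a).
Proof. by move=> i ni; rewrite /at_deg; case: pselect => // e; case: ni. Qed.

Lemma homog_eq n x y : homog n x -> homog n y -> x n = y n -> x = y.
Proof.
move=> hx hy e; apply: totP => i; have [->//|ni] := pselect (i = n).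
by rewrite hx // hy.
Qed.

Lemma at_degK n x : homog n x -> at_deg (x n) = x.
Proof. by move=> hx; apply: (homog_eq (@at_deg_homog _ _) hx); rewrite at_degE. Qed.

Lemma at_degD n : {morph @at_deg n : a b / a + b}.
Proof.
move=> a b; apply: (homog_eq (@at_deg_homog _ _) (homogD (@at_deg_homog _ _) (@at_deg_homog _ _))).
by rewrite totD !at_degE.
Qed.

Lemma at_deg0 n : at_deg (0 : G n) = 0.
Proof. exact: morphD0 (@at_degD n). Qed.

End Total.

Section TotalDga.
Variable C : dga.
Implicit Types x y z : tot C.

Definition tdif y : tot C := fun t => dif C (subrK 1 t) (y (t - 1)).

(* Only the component of degree [n] of [z] acts. *)
Definition tmulr (n : int) z y : tot C := fun t => gmul (subrK n t) (y (t - n)) (z n).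
Definition tmull (n : int) (c : C n) y : tot C := fun t => gmul (subrKC n t) c (y (t - n)).

Lemma tdifE y i t (e : i + 1 = t) : tdif y t = dif C e (y i).
Proof.
have ei : i = t - 1 by rewrite -e addrK.
by subst i; rewrite /tdif (Prop_irrelevance e (subrK 1 t)).
Qed.

Lemma tmulrE n z y i t (e : i + n = t) : tmulr n z y t = gmul e (y i) (z n).
Proof.
have ei : i = t - n by rewrite -e addrK.
by subst i; rewrite /tmulr (Prop_irrelevance e (subrK n t)).
Qed.

Lemma tmullE n (c : C n) y i t (e : n + i = t) : tmull c y t = gmul e c (y i).
Proof.
have ei : i = t - n by rewrite -e addrC addKr.
by subst i; rewrite /tmull (Prop_irrelevance e (subrKC n t)).
Qed.

Lemma gmulDr (Q : galg) (i j k : int) (e : i + j = k) (a : Q i) : {morph gmul e a : b c / b + c}.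
Proof. by move=> b c; have := gmul_linr e a 1 b c; rewrite !scale1r. Qed.
Lemma gmulDl (Q : galg) (i j k : int) (e : i + j = k) (b : Q j) :
  {morph (fun a => gmul e a b) : a c / a + c}.
Proof. by move=> a c; have := gmul_linl e b 1 a c; rewrite !scale1r. Qed.
Lemma gmul0r (Q : galg) (i j k : int) (e : i + j = k) (a : Q i) : gmul e a (0 : Q j) = 0.
Proof. exact: morphD0 (gmulDr e a). Qed.
Lemma gmul0l (Q : galg) (i j k : int) (e : i + j = k) (b : Q j) : gmul e (0 : Q i) b = 0.
Proof. exact: morphD0 (gmulDl e b). Qed.

Lemma tdifD : {morph tdif : x y / x + y}.
Proof. by move=> x y; apply: totP => t; exact: raddfD. Qed.
Lemma tmulrDr n z : {morph tmulr n z : x y / x + y}.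
Proof. by move=> x y; apply: totP => t; exact: (gmulDl (subrK n t) (z n)). Qed.
Lemma tmulrDl n y z z' : tmulr n (z + z') y = tmulr n z y + tmulr n z' y.
Proof. by apply: totP => t; exact: gmulDr. Qed.
Lemma tmullDr n (c : C n) : {morph tmull c : x y / x + y}.
Proof. by move=> x y; apply: totP => t; exact: gmulDr. Qed.
Lemma tmullDl n y (c c' : C n) : tmull (c + c') y = tmull c y + tmull c' y.
Proof. by apply: totP => t; exact: (gmulDl _ (y _)). Qed.

Lemma tdif0 : tdif 0 = 0. Proof. exact: morphD0 tdifD. Qed.
Lemma tmulr0 n z : tmulr n z 0 = 0. Proof. exact: morphD0 (@tmulrDr n z). Qed.
Lemma tmul0r n y : tmulr n 0 y = 0.
Proof. by apply: totP => t; exact: gmul0r. Qed.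
Lemma tmull0 n (c : C n) : tmull c 0 = 0. Proof. exact: morphD0 (@tmullDr n c). Qed.

Lemma tdif_tdif y : tdif (tdif y) = 0.
Proof. by apply: totP => t; exact: difK. Qed.

Lemma tdif_mulr n z y : tdif (tmulr n z y) = tmulr n z (tdif y) + tmulr (n + 1) (tdif z) y.
Proof.
apply: totP => t; rewrite totD.
have e : (t - 1 - n) + n = t - 1 by lia.
have e1 : (t - n) + n = t by lia.
have e2 : (t - 1 - n) + (n + 1) = t by lia.
have ei : (t - 1 - n) + 1 = t - n by lia.
rewrite (tdifE _ (subrK 1 t)) (tmulrE z y e) (tmulrE z _ e1) (tmulrE (tdif z) y e2).
by rewrite (tdifE y ei) (tdifE z erefl) (difM e ei erefl (subrK 1 t) e1 e2).
Qed.

Lemma tmulr_closed n z y : tdif z = 0 -> tdif y = 0 -> tdif (tmulr n z y) = 0.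
Proof. by move=> dz dy; rewrite tdif_mulr dz dy tmulr0 tmul0r addr0. Qed.

Lemma tdif_mull n (c : C n) y :
  tdif (tmull c y) = tmull (dif C erefl c) y + tmull c (tdif y).
Proof.
apply: totP => t; rewrite totD.
have e : n + (t - 1 - n) = t - 1 by lia.
have e1 : (n + 1) + (t - 1 - n) = t by lia.
have e2 : n + (t - n) = t by lia.
have ei : (t - 1 - n) + 1 = t - n by lia.
rewrite (tdifE _ (subrK 1 t)) (tmullE c y e) (tmullE c _ e2) (tmullE _ y e1).
by rewrite (tdifE y ei) (difM e erefl ei (subrK 1 t) e1 e2).
Qed.

Lemma tmulrA n n' z z' y : tmulr n' z' (tmulr n z y) = tmulr (n + n') (tmulr n' z' z) y.
Proof.
apply: totP => t.
have e1 : (t - n' - n) + n = t - n' by lia.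
have e4 : (t - n' - n) + (n + n') = t by lia.
rewrite (tmulrE z' _ (subrK n' t)) (tmulrE z y e1) (tmulrE (tmulr n' z' z) y e4).
by rewrite (tmulrE z' z erefl) (gmulA e1 (subrK n' t) erefl e4).
Qed.

Lemma tmull_mulr n n' (c : C n) z y : tmull c (tmulr n' z y) = tmulr n' z (tmull c y).
Proof.
apply: totP => t.
have e1 : n + (t - n - n') = t - n' by lia.
have e3 : (t - n - n') + n' = t - n by lia.
have e4 : n + (t - n) = t by lia.
rewrite (tmullE c _ e4) (tmulrE z y e3) (tmulrE z _ (subrK n' t)) (tmullE c y e1).
by rewrite (gmulA e1 (subrK n' t) e3 e4).
Qed.

Lemma tmullA n n' m (e : n + n' = m) (c : C n) (c' : C n') y :
  tmull (gmul e c c') y = tmull c (tmull c' y).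
Proof.
apply: totP => t.
have e2 : m + (t - m) = t by lia.
have e3 : n' + (t - m) = t - n by lia.
have e4 : n + (t - n) = t by lia.
by rewrite (tmullE _ y e2) (tmullE c _ e4) (tmullE c' y e3) (gmulA e e2 e3 e4).
Qed.

Lemma tmull1 y : tmull (gone C) y = y.
Proof. by apply: totP => t; rewrite (tmullE _ y (add0r t)) gmul1l. Qed.

Lemma homog_dif n y : homog n y -> homog (n + 1) (tdif y).
Proof. by move=> hy t nt; rewrite /tdif hy ?raddf0 //; lia. Qed.

Lemma homog_mulr m n z y : homog m y -> homog (m + n) (tmulr n z y).
Proof. by move=> hy t nt; rewrite /tmulr hy ?gmul0l //; lia. Qed.

Lemma homog_mull m n (c : C n) y : homog m y -> homog (n + m) (tmull c y).
Proof. by move=> hy t nt; rewrite /tmull hy ?gmul0r //; lia. Qed.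

Definition tone : tot C := at_deg (gone C).

Lemma tmulr_one n z : homog n z -> tmulr n z tone = z.
Proof.
move=> hz; apply: (@homog_eq _ n) => //.
  by rewrite -[n in homog n]add0r; apply: homog_mulr; exact: at_deg_homog.
by rewrite (tmulrE _ _ (add0r n)) /tone at_degE gmul1l.
Qed.

Lemma tmull_one n (c : C n) : tmull c tone = at_deg c.
Proof.
apply: (@homog_eq _ n); last by rewrite (tmullE _ _ (addr0 n)) /tone !at_degE gmul1r.
  by rewrite -[n in homog n]addr0; apply: homog_mull; exact: at_deg_homog.
exact: at_deg_homog.
Qed.

Lemma tdif_one : tdif tone = 0.
Proof.
apply: (homog_eq (homog_dif (@at_deg_homog _ _ _))) => //.
rewrite (tdifE _ erefl) /tone at_degE.
exact: (dgcocycleP (dgcocycle1 C)).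
Qed.

Lemma tdif_at n k (e : n + 1 = k) (a : C n) : tdif (at_deg a) = at_deg (dif C e a).
Proof.
case: k / e; apply: (homog_eq (homog_dif (@at_deg_homog _ _ _)) (@at_deg_homog _ _ _)).
by rewrite (tdifE _ erefl) !at_degE.
Qed.

Definition tproj (n : int) y : tot C := at_deg (y n).

Lemma tdif_proj n y : tdif (tproj n y) = tproj (n + 1) (tdif y).
Proof. by rewrite /tproj (tdif_at erefl) (tdifE y erefl). Qed.

End TotalDga.

(** * Twisting elements *)

Section ConvolutionSplit.
Variables (L : Type) (Y : lmodType F2).

Lemma eq_conv_split (phi psi : seq L -> Y -> Y) (F G : seq L -> Y) w :
  (forall u v, w = u ++ v -> phi v (F u) = psi v (G u)) -> conv phi F w = conv psi G w.
Proof.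
elim: w F G => [|x w IH] F G E /=; first exact: (E [::] [::]).
rewrite (E [::] (x :: w)) //; congr (_ + _).
by apply: IH => u v ew; apply: (E (x :: u)); rewrite ew.
Qed.

Lemma conv_split0 (phi : seq L -> Y -> Y) (F : seq L -> Y) w :
  (forall u v, w = u ++ v -> phi v (F u) = 0) -> conv phi F w = 0.
Proof.
move=> E; rewrite (@eq_conv_split _ (fun=> fun=> 0) _ (fun=> 0)) //.
by elim: w {E} => //= x w ->; rewrite addr0.
Qed.

Lemma conv_first (phi : seq L -> Y -> Y) (F : seq L -> Y) l w : additive_family phi ->
  F [::] = 0 -> (forall v, (size v < size w)%N -> phi v =1 fun=> 0) ->
  conv phi F (l :: w) = phi w (F [:: l]).
Proof.
move=> phiD F0 phi0 /=; rewrite F0 (morphD0 (phiD _)) add0r.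
case: w phi0 => [//|x w] phi0 /=; rewrite conv_split0 ?addr0 // => u v ew.
by apply: phi0; rewrite ew /= size_cat; lia.
Qed.

Lemma conv_last (phi : seq L -> Y -> Y) (F : seq L -> Y) l w : additive_family phi ->
  phi [::] =1 (fun=> 0) -> (forall v, (size v < size w)%N -> F v = 0) ->
  conv phi F (rcons w l) = phi [:: l] (F w).
Proof.
move=> phiD phi0; elim: w F => [|x w IH] F F0 /=; first by rewrite phi0 addr0.
by rewrite F0 // (morphD0 (phiD _)) add0r IH // => v sv; apply: F0.
Qed.

End ConvolutionSplit.

Section Twisting.
Variables (V : lmodType F2) (B : booleanRingType) (C : dga).
Local Notation letter := (letter V B).
Local Notation lmul := (@lmul V B).
Local Notation ladd := (@ladd V B).
Local Notation Y := (tot C).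
Implicit Types (F G f h : seq letter -> Y) (w : seq letter).
Notation multiadd := (multiadditive ladd).
Notation mergesum := (rdiff lmul (fun=> fun=> 0 : Y)).

(** The component of an A-infinity morphism with n arguments has degree 1 - n. A word of n letters
    has degree n plus its excess, which leaves 1 plus the excess. *)
Definition wdeg w : int := Posz (excess w).+1.

Lemma wdeg_cons l w : wdeg (l :: w) = l.1%:Z + wdeg w.
Proof. by rewrite /wdeg excess_cons; lia. Qed.

(* Right multiplication by [f w] when [f w] has degree [1 + excess w];
   [dtwist] is used for functions of one degree more, such as the curvature. *)
Definition twist f w : Y -> Y := tmulr (wdeg w) (f w).
Definition dtwist F w : Y -> Y := tmulr (wdeg w + 1) (F w).

Lemma twistD f : additive_family (twist f).
Proof. by move=> w; exact: tmulrDr. Qed.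
Lemma dtwistD f : additive_family (dtwist f).
Proof. by move=> w; exact: tmulrDr. Qed.

Lemma twistDl f h w y : twist (fun v => f v + h v) w y = twist f w y + twist h w y.
Proof. exact: tmulrDl. Qed.

Lemma twist0 f w : f w = 0 -> twist f w =1 fun=> 0.
Proof. by move=> fw y; rewrite /twist fw tmul0r. Qed.

Lemma dtwist0 f w : f w = 0 -> dtwist f w =1 fun=> 0.
Proof. by move=> fw y; rewrite /dtwist fw tmul0r. Qed.

Definition homog_fun (j : int) F := forall w, homog (j + (excess w)%:Z) (F w).

Lemma homog_fun_mergesum j F : homog_fun j F -> homog_fun (j + 1) (mergesum F).
Proof.
move=> Fh w; apply: mergesum_closed; [exact: homog0|exact: homogD|] => u _ eu.
by have := Fh u; rewrite eu; congr (homog _ _); lia.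
Qed.

Lemma homog_fun_conv j f F : homog_fun j F -> homog_fun (j + 1) (conv (twist f) F).
Proof.
move=> Fh w; elim: w j F Fh => [|l w IH] j F Fh /=.
  have := homog_mulr (n := wdeg [::]) (f [::]) (Fh [::]); congr (homog _ _). rewrite /wdeg (_ : excess [::] = 0%N) //; lia.
apply: homogD.
  have := homog_mulr (n := wdeg (l :: w)) (f (l :: w)) (Fh [::]).
  by congr (homog _ _); rewrite /wdeg (_ : excess [::] = 0%N) //; lia.
have := IH (j + l.1%:Z) (fun v => F (l :: v)).
rewrite excess_cons; have -> : j + l.1%:Z + 1 + excess w = j + 1 + (l.1 + excess w)%N by lia.
by apply=> v; have := Fh (l :: v); congr (homog _ _); rewrite excess_cons; lia.
Qed.

Lemma homog_fun_tdif j F : homog_fun j F -> homog_fun (j + 1) (fun w => tdif (F w)).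
Proof. by move=> Fh w; have := homog_dif (Fh w); congr (homog _ _); lia. Qed.

Lemma homog_fun_nabla j f F : homog_fun j F -> homog_fun (j + 1) (nabla lmul (@tdif C) (twist f) F).
Proof.
by move=> Fh w; apply: homogD; [apply: homogD|]; [exact: (homog_fun_tdif Fh)|exact: homog_fun_mergesum|exact: homog_fun_conv].
Qed.

Lemma ladd_words u v a b c : ladd a b c ->
  [/\ excess (u ++ a :: v) = excess (u ++ c :: v), excess (u ++ b :: v) = excess (u ++ c :: v),
    size (u ++ a :: v) = size (u ++ c :: v) & size (u ++ b :: v) = size (u ++ c :: v)].
Proof. by case=> ea eb _; rewrite /excess !map_cat /= ea eb !size_cat. Qed.

Lemma multiadd_conv f F : multiadd f -> multiadd F -> multiadd (conv (twist f) F).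
Proof.
have fD g u a b c v y : multiadd g -> ladd a b c -> twist g (u ++ c :: v) y =
    twist g (u ++ a :: v) y + twist g (u ++ b :: v) y.
  move=> gM h; have [ea eb _ _] := ladd_words u v h.
  by rewrite /twist /wdeg ea eb (gM _ _ _ _ _ h) tmulrDl.
move=> fM FM u a b c v h; elim: u F FM => [|x u IH] F FM /=.
  rewrite (fD f [::] _ _ _ _ _ fM h) /=.
  rewrite (@eq_conv _ _ _ _ (fun w => F (a :: w) + F (b :: w))) => [|w _].
    by rewrite convD; [char2|exact: twistD].
  exact: (FM [::]).
rewrite -!cat_cons (fD f (x :: u) _ _ _ _ _ fM h) IH; last exact: multiadditive_cons.
by char2.
Qed.

Lemma multiadd_tmergesum F : multiadd F -> multiadd (mergesum F).
Proof.
apply: multiadditive_rdiff; [exact: lmul_addr|exact: lmul_addl| |].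
  by move=> x y z; rewrite addr0.
by move=> *; rewrite addr0.
Qed.

Lemma multiadd_nabla f F : multiadd f -> multiadd F ->
  multiadd (nabla lmul (@tdif C) (twist f) F).
Proof.
move=> fM FM; apply: multiadditiveD; last exact: multiadd_conv.
apply: multiadditiveD; last exact: multiadd_tmergesum.
by move=> u a b c v h; rewrite (FM _ _ _ _ _ h) tdifD.
Qed.

(** Its vanishing is the Maurer-Cartan equation: differential of [f w], plus the values at the
    merged words, plus the products of [f u] and [f v] over the splittings of [w]. *)
Definition curvature f : seq letter -> Y := nabla lmul (@tdif C) (twist f) f.

Lemma mergesum_mulr (d : int) F w y :
  mergesum (fun v => tmulr (d + wdeg v) (F v) y) w = tmulr (d + wdeg w + 1) (mergesum F w) y.
Proof.
elim: w d F => [|x [|z r] IH] d F; rewrite ?rdiff_nil ?rdiff1 ?tmul0r //.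
rewrite !rdiff_cons2 tmulrDl; congr (_ + _).
  by congr (tmulr _ _ _); rewrite !wdeg_cons /=; lia.
rewrite (@eq_rdiff _ _ _ _ _ (fun v => tmulr (d + x.1%:Z + wdeg v) (F (x :: v)) y)).
  by rewrite IH; congr (tmulr _ _ _); rewrite !wdeg_cons; lia.
by move=> v _; rewrite wdeg_cons addrA.
Qed.

Lemma conv_mulr f (d : int) F w y : 
  conv (twist f) (fun v => tmulr (d + wdeg v) (F v) y) w =
  tmulr (d + wdeg w + 1) (conv (twist f) F w) y.
Proof.
elim: w d F => [|x w IH] d F /=; first by rewrite [LHS]tmulrA; congr (tmulr _ _ _).
rewrite tmulrDl; congr (_ + _).
  by rewrite [LHS]tmulrA; congr (tmulr _ _ _); rewrite /wdeg (_ : excess [::] = 0%N) //; lia.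
rewrite (@eq_conv _ _ _ _ (fun v => tmulr (d + x.1%:Z + wdeg v) (F (x :: v)) y)).
  by rewrite IH; congr (tmulr _ _ _); rewrite !wdeg_cons; lia.
by move=> v _; rewrite wdeg_cons addrA.
Qed.

Lemma curvature_twist f w y :
  curvature_op lmul (@tdif C) (twist f) w y = dtwist (curvature f) w y.
Proof.
rewrite /curvature_op {1}/twist tdif_mulr.
rewrite (@eq_rdiff _ _ _ _ _ (fun v => tmulr (0 + wdeg v) (f v) y)); last first.
  by move=> v _; rewrite add0r.
rewrite mergesum_mulr (@eq_conv _ _ _ _ (fun v => tmulr (0 + wdeg v) (f v) y)); last first.
  by move=> v _; rewrite add0r.
rewrite conv_mulr add0r /dtwist /curvature /nabla !tmulrDl; congr (_ + _ + _).
by rewrite addrAC addF2 add0r.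
Qed.

Lemma twisted_nabla_nabla f F w :
  nabla lmul (@tdif C) (twist f) (nabla lmul (@tdif C) (twist f) F) w =
  conv (dtwist (curvature f)) F w.
Proof.
rewrite nabla_nabla; [|exact: lmulA|exact: tdifD|exact: tdif_tdif|exact: twistD].
by apply: eq_conv_split => u v _; exact: curvature_twist.
Qed.

(** This is the square of the twisted differential applied to [f] itself. *)
Lemma bianchi f w :
  tdif (curvature f w) + mergesum (curvature f) w + conv (twist f) (curvature f) w =
  conv (dtwist (curvature f)) f w.
Proof. exact: twisted_nabla_nabla. Qed.

Lemma eq_nabla f f' F F' w :
  (forall v, (size v <= size w)%N -> f v = f' v) ->
  (forall v, (size v <= size w)%N -> F v = F' v) ->
  nabla lmul (@tdif C) (twist f) F w = nabla lmul (@tdif C) (twist f') F' w.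
Proof.
move=> Ef EF; rewrite /nabla EF //; congr (_ + _ + _).
  by apply: eq_rdiff => v sv; apply: EF; rewrite -sv.
apply: eq_conv_split => u v ew; rewrite EF ?ew ?size_cat ?leq_addr //.
by rewrite /twist Ef // ew size_cat leq_addl.
Qed.

Lemma curvatureD f h w : curvature (fun v => f v + h v) w =
  curvature f w + nabla lmul (@tdif C) (twist f) h w
  + conv (twist h) f w + conv (twist h) h w.
Proof.
rewrite /curvature /nabla tdifD rdiffD; last by move=> x y z; rewrite addr0.
rewrite convD; last exact: twistD.
have E F : conv (twist (fun v => f v + h v)) F w = conv (twist f) F w + conv (twist h) F w.
  by rewrite -convDl; apply: eq_conv_split => u v _; exact: twistDl.
by rewrite !E; char2.
Qed.

End Twisting.

Section Classes.
Variables (C : dga) (Q : galg) (theta : gmor (cohomology_algebra C) Q).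
Hypothesis theta_bij : forall i, bijective (theta i).
Implicit Types y z : tot C.

Definition mk_dgcocycle n (a : C n) (a0 : dif C erefl a = 0) : dgcocycle C n :=
  Cocycle (introT eqP a0).

(* The image in [Q] of the cohomology class of the component of degree [n] of
   [z], with junk value [0] if this component is not a cocycle. *)
Definition class_at n z : Q n :=
  if pselect (dif C erefl (z n) = 0) is left e
  then theta n (dgclass C n (mk_dgcocycle e)) else 0.

Lemma tdif_closed n z : tdif z = 0 -> dif C (erefl (n + 1)) (z n) = 0.
Proof. by move=> dz; rewrite -(tdifE z erefl) dz. Qed.

Lemma class_atE n z (c : dgcocycle C n) : cocycle_val c = z n -> class_at n z = theta n (dgclass C n c).
Proof.
move=> cz; rewrite /class_at; case: pselect => [e|[]]; last first.
  by rewrite -cz; exact: dgcocycleP.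
by congr (theta n (dgclass C n _)); apply: dgcocycle_eq; rewrite cz.
Qed.

Lemma class_atD n z z' : tdif z = 0 -> tdif z' = 0 -> class_at n (z + z') = class_at n z + class_at n z'.
Proof.
move=> dz dz'; pose c := mk_dgcocycle (tdif_closed n dz).
pose c' := mk_dgcocycle (tdif_closed n dz').
rewrite (@class_atE _ _ (c + c')) // (@class_atE _ _ c) // (@class_atE _ _ c') //.
by rewrite raddfD [LHS]raddfD.
Qed.

Lemma class_at_exact n y : class_at n (tdif y) = 0.
Proof.
pose c := mk_dgcocycle (tdif_closed n (tdif_tdif y)).
rewrite (@class_atE _ _ c) // (_ : dgclass C n c = 0) ?raddf0 //.
rewrite -(raddf0 (dgclass C n)); apply/dgclass_eq.
by exists (n - 1), (subrK 1 n), (y (n - 1)); rewrite subr0.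
Qed.

Lemma class_at0 n : class_at n 0 = 0.
Proof. by rewrite -(tdif0 C) class_at_exact. Qed.

Lemma class_at_eq0 n z : tdif z = 0 -> homog n z -> class_at n z = 0 ->
  exists2 u, homog (n - 1) u & tdif u = z.
Proof.
move=> dz hz; pose c := mk_dgcocycle (tdif_closed n dz).
rewrite (@class_atE _ _ c) // => c0.
have /dgclass_eq[i [e [u eu]]] : dgclass C n c = dgclass C n 0.
  by apply: (bij_inj (theta_bij n)); rewrite c0 !raddf0.
have ei : i = n - 1 by rewrite -e addrK.
subst i; exists (at_deg u); first exact: at_deg_homog.
by rewrite (tdif_at e) eu subr0; exact: at_degK.
Qed.

Lemma class_atM m n k (e : m + n = k) y z : tdif y = 0 -> tdif z = 0 ->
  class_at k (tmulr n z y) = gmul e (class_at m y) (class_at n z).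
Proof.
move=> dy dz; pose c := mk_dgcocycle (tdif_closed m dy).
pose c' := mk_dgcocycle (tdif_closed n dz).
rewrite (@class_atE _ y c) // (@class_atE _ z c') // -gmapM.
rewrite (@class_atE _ _ (dgcocycleM e c c')); last by rewrite (tmulrE _ _ e).
by rewrite -dgcohomM_class.
Qed.

Lemma class_at_one : class_at 0 (tone C) = gone Q.
Proof. by rewrite (@class_atE _ _ (dgcocycle1 C)) ?gmap1 // /tone at_degE. Qed.

(** Representing cocycles are chosen additively, so that they define a multiadditive function on
    letters. *)
Lemma class_at_surj : exists rep : forall n, Q n -> C n,
  [/\ forall n, {morph rep n : a b / a + b},
      forall n q, dif C (erefl (n + 1)) (rep n q) = 0
    & forall n q, class_at n (at_deg (rep n q)) = q].
Proof.
pose s' n := cid (@linear_section_exists (dgcocycle C n) (Q n) setT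
  (fun c => theta n (dgclass C n c)) I (fun _ _ _ _ => I)
  (fun c c' => etrans (congr1 (theta n) (raddfD (dgclass C n) c c')) (raddfD (theta n) _ _))).
pose s n := projT1 (s' n); pose sP n := projT2 (s' n).
have onto n q : exists c, theta n (dgclass C n c) = q.
  have [g _ gK] := theta_bij n; exists (dgrepr (g q)).
  by rewrite dgreprK gK.
have sD n a b : s n (a + b) = s n a + s n b.
  have [e _] := sP n; apply: e; [have [c <-] := onto n a|have [c <-] := onto n b]; by exists c.
exists (fun n q => cocycle_val (s n q)); split=> [n a b|n q|n q]; first by rewrite sD.
- exact: dgcocycleP.
- rewrite (@class_atE _ _ (s n q)) ?at_degE //.
  by have [c <-] := onto n q; have [_ /(_ c I)[]] := sP n.
Qed.

End Classes.

Section BooleanComponent.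
Variables (V : lmodType F2) (B : booleanRingType).
Local Notation letter := (letter V B).
Local Notation Q := (VB V B).

Definition bcomp (k : int) : Q k -> boolr_vect B :=
  match k return Q k -> boolr_vect B with Posz e.+1 => snd | _ => fun=> 0 end.

Definition bincl (k : int) : boolr_vect B -> Q k :=
  match k return boolr_vect B -> Q k with Posz e.+1 => fun b => (0, b) | _ => fun=> 0 end.

Lemma bcompD k : {morph @bcomp k : x y / x + y}.
Proof. by case: k => [[|e]|e] x y //=; rewrite addr0. Qed.

Lemma binclD k : {morph @bincl k : x y / x + y}.
Proof. by case: k => [[|e]|e] x y //=; rewrite ?addr0 //; congr pair; rewrite addr0. Qed.

Lemma bcomp_eq0 (e : nat) (x : Q (Posz e.+2)) : bcomp x = 0 -> x = 0.
Proof. by case: x => v a /= ->; congr pair; exact: thinmx0. Qed.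

Lemma bcomp_letter l : bcomp (letter_elt l) = l.2.2.
Proof. by []. Qed.

Lemma bcomp_mul (i j k : nat) (e : Posz i.+1 + Posz j.+1 = Posz k.+1)
    (x : Q (Posz i.+1)) (y : Q (Posz j.+1)) :
  bcomp (gmul e x y) = boolr_smul (bcomp x : B) (bcomp y).
Proof.
rewrite -[x]elt_letterK -[y]elt_letterK.
by rewrite (letter_elt_mul (l := elt_letter x) (m := elt_letter y) e).
Qed.

End BooleanComponent.

(** * Obstruction theory for the Maurer-Cartan equation *)

Section TwistingElement.
Variables (V : lmodType F2) (B : booleanRingType) (C : dga).
Local Notation letter := (letter V B).
Local Notation lmul := (@lmul V B).
Local Notation ladd := (@ladd V B).
Local Notation Q := (VB V B).
Local Notation Y := (tot C).
Local Notation act := (@boolr_act V B B idfun).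
Implicit Types (F G f h : seq letter -> Y) (w : seq letter).
Notation multiadd := (multiadditive ladd).
Notation mergesum := (rdiff lmul (fun=> fun=> 0)).

Variable theta : gmor (cohomology_algebra C) Q.
Hypothesis theta_bij : forall i, bijective (theta i).
Variable rep : forall n, Q n -> C n.
Hypothesis repD : forall n, {morph @rep n : a b / a + b}.
Hypothesis rep_closed : forall n q, dif C (erefl (n + 1)) (rep q) = 0.
Hypothesis class_at_rep : forall n q, class_at theta n (at_deg (rep q)) = q.

Definition rho (l : letter) : Y := at_deg (rep (letter_elt l)).

Lemma at_rep_closed n (q : Q n) : tdif (at_deg (rep q)) = 0.
Proof. by rewrite (tdif_at erefl) rep_closed at_deg0. Qed.

Lemma rho_add a b c : ladd a b c -> rho c = rho a + rho b.
Proof.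
case: a b c => [n [v a]] [n' [v' a']] [e [v'' a'']] [/= -> -> h].
rewrite /rho -at_degD -repD; congr (at_deg (rep _)).
case: e h => [|e] [] /=; first by move=> -> ->.
by move=> _ ->; congr pair; rewrite /= addr0.
Qed.

Definition bcl (k : int) (z : Y) : boolr_vect B := bcomp (class_at theta k z).

Lemma bclD k z z' : tdif z = 0 -> tdif z' = 0 -> bcl k (z + z') = bcl k z + bcl k z'.
Proof. by move=> dz dz'; rewrite /bcl class_atD // bcompD. Qed.

Lemma bcl0 k : bcl k 0 = 0.
Proof. by rewrite /bcl class_at0; exact: morphD0 (@bcompD V B k). Qed.

Lemma bcl_mull (l : letter) (e k : nat) z : (l.1 + e).+2 = k -> tdif z = 0 ->
  bcl k (tmulr (Posz e.+1) z (rho l)) = act l (bcl (Posz e.+1) z).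
Proof.
move=> <- dz; have ek : Posz l.1.+1 + Posz e.+1 = Posz (l.1 + e).+2 by lia.
by rewrite /bcl (class_atM _ ek) ?at_rep_closed // bcomp_mul class_at_rep.
Qed.

Lemma bcl_mulr (l : letter) (e k : nat) z : (e + l.1).+2 = k -> tdif z = 0 ->
  bcl k (tmulr (Posz l.1.+1) (rho l) z) = act l (bcl (Posz e.+1) z).
Proof.
move=> <- dz; have ek : Posz e.+1 + Posz l.1.+1 = Posz (e + l.1).+2 by lia.
rewrite /bcl (class_atM _ ek) ?at_rep_closed // bcomp_mul class_at_rep.
exact: (mulrC (bcomp _ : B)).
Qed.

Lemma bcl_mergesum (d : int) F w : (forall v, (size v).+1 = size w -> tdif (F v) = 0) ->
  tdif (mergesum F w) = 0 /\
  bcl (d + 1 + (excess w)%:Z) (mergesum F w) = mergesum (fun v => bcl (d + (excess v)%:Z) (F v)) w.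
Proof.
elim: w d F => [|x [|y r] IH] d F F0; rewrite ?rdiff_nil ?rdiff1 ?bcl0 ?tdif0 // !rdiff_cons2.
have [|d0 bE] := IH (d + x.1%:Z) (fun v => F (x :: v)).
  by move=> v sv; apply: F0; rewrite /= sv.
have d1 : tdif (F (lmul x y :: r)) = 0 by exact: F0.
split; first by rewrite tdifD d0 d1 addr0.
rewrite bclD //; congr (_ + _).
  by congr (bcl _ _); rewrite !excess_cons (_ : (lmul x y).1 = (x.1 + y.1).+1) //; lia.
have -> : d + 1 + excess [:: x, y & r] = d + x.1 + 1 + excess (y :: r).
  by rewrite (excess_cons x); lia.
rewrite bE; apply: eq_rdiff => v _; congr (bcl _ _); rewrite excess_cons; lia.
Qed.

(* Solutions of the Maurer-Cartan equation on words of length at most [n]: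
   multiplicative up to coherent homotopies of order [n]. *)
Definition mc_upto n f := [/\ multiadd f, homog_fun 1 f, f [::] = 0,
  forall l, f [:: l] = rho l & forall w, (size w <= n)%N -> curvature f w = 0].

(** A product over a splitting of [w] that contains a value of [h] has its other factor at the empty
    word, where both functions vanish; merges read words too short for [h]. *)
Lemma curvature_add_top N f h w : f [::] = 0 -> (0 < N)%N ->
  (forall v, size v != N -> h v = 0) -> (size w <= N)%N ->
  curvature (fun v => f v + h v) w = curvature f w + tdif (h w).
Proof.
move=> f0 N0 hN sw; rewrite curvatureD /nabla.
have h0 : h [::] = 0 by apply: hN; rewrite eq_sym -lt0n.
rewrite rdiff_eq0 => [|x y z|v sv]; [|by rewrite addr0|by apply: hN; rewrite ltn_eqF //; lia].
rewrite !conv_split0 ?addr0 // => u v ew;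
  have : (size u + size v <= N)%N by [rewrite -size_cat -ew].
- case: (size u =P N) => [<-|/eqP su _]; last by rewrite hN //; exact: morphD0 (twistD _ _).
  case: v ew => [|x v] ew /=; last by rewrite leqNgt addnS ltnS leq_addr.
  by rewrite (twist0 h0).
- case: (size v =P N) => [<-|/eqP sv _]; last by rewrite twist0 // hN.
  case: u ew => [|x u] ew /=; last by rewrite leqNgt addSn ltnS leq_addl.
  by move=> _; rewrite f0; exact: morphD0 (twistD _ _).
- case: (size u =P N) => [<-|/eqP su _]; last by rewrite hN //; exact: morphD0 (twistD _ _).
  case: v ew => [|x v] ew /=; last by rewrite leqNgt addnS ltnS leq_addr.
  by rewrite (twist0 f0).
Qed.

Section Obstruction.
Variables (n : nat) (f : seq letter -> Y).
Hypothesis n_gt0 : (0 < n)%N.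
Hypothesis f_mc : mc_upto n f.

Let fM : multiadd f. Proof. by case: f_mc. Qed.
Let fh : homog_fun 1 f. Proof. by case: f_mc. Qed.
Let f0 : f [::] = 0. Proof. by case: f_mc. Qed.
Let f1 l : f [:: l] = rho l. Proof. by case: f_mc. Qed.
Let fc w : (size w <= n)%N -> curvature f w = 0. Proof. by case: f_mc => _ _ _ _; apply. Qed.

Let Om := curvature f.
Let OmM : multiadd Om. Proof. exact: multiadd_nabla. Qed.

(** In the Bianchi identity every other term contains the curvature of a word of at most [n] letters
    or the value of [f] at the empty word. *)
Lemma curvature_closed w : size w = n.+1 -> tdif (Om w) = 0.
Proof.
move=> sw; have := bianchi f w; rewrite -/Om.
rewrite rdiff_eq0 => [|x y z|v sv]; [|by rewrite addr0|by apply: fc; rewrite -ltnS -sw -sv].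
rewrite !conv_split0 ?addr0 // => u v ew; have := congr1 size ew; rewrite size_cat sw => suv.
  case: u ew suv => [|x u] ew suv; first by rewrite f0; exact: morphD0 (dtwistD _ _).
  by apply: dtwist0; apply: fc; move: suv => /=; lia.
case: v ew suv => [|x v] ew suv; first by rewrite (twist0 f0).
rewrite (_ : Om u = 0); first exact: morphD0 (twistD _ _).
by apply: fc; move: suv => /=; lia.
Qed.

(** The class has degree at least 2, where V_* is zero, so its component in [B] is the whole
    class. *)
Definition obstruction w : boolr_vect B :=
  if size w == n.+1 then bcl (2 + (excess w)%:Z) (Om w) else 0.

Lemma multiadd_obstruction : multiadd obstruction.
Proof.
move=> u a b c v h; have [ea eb sa sb] := ladd_words u v h.
rewrite /obstruction ea eb sa sb; case: eqP => [sw|_]; last by rewrite addr0.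
by rewrite (OmM _ _ h) bclD //; apply: curvature_closed; rewrite ?sa ?sb.
Qed.

Lemma obstructionE w : size w = n.+1 -> obstruction w = bcl (2 + (excess w)%:Z) (Om w).
Proof. by rewrite /obstruction => ->; rewrite eqxx. Qed.

(* On words of length [n.+2] the Bianchi identity only involves the curvature
   of words of length [n.+1], multiplied by first or last letters. *)
Lemma obstruction_cocycle w : size w = n.+2 -> wdiff lmul act act obstruction w = 0.
Proof.
move=> sw.
have [l [u [v [m [wl wm su sv]]]]] := split_ends sw.
have := bianchi f w; rewrite -/Om.
have -> : conv (dtwist Om) f w = dtwist Om u (f [:: l]).
  rewrite wl conv_first //; first exact: dtwistD.
  by move=> r; rewrite su ltnS => sr; apply: dtwist0; exact: fc.
have -> : conv (twist f) Om w = twist f [:: m] (Om v).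
  rewrite wm conv_last //; [exact: twistD|exact: twist0|].
  by move=> r; rewrite sv ltnS; exact: fc.
rewrite !f1 /dtwist /twist !f1 => E.
have [dm bm] : tdif (mergesum Om w) = 0 /\
    bcl (2 + 1 + (excess w)%:Z) (mergesum Om w) = mergesum obstruction w.
  have [r sr|dm ->] := @bcl_mergesum 2 Om w; last split=> //.
    by apply: curvature_closed; apply/eqP; rewrite -eqSS sr sw.
  apply: eq_rdiff => r sr; rewrite obstructionE //.
  by apply/eqP; rewrite -eqSS sr sw.
have bl : bcl (2 + 1 + (excess w)%:Z) (tmulr (wdeg u + 1) (Om u) (rho l)) = act l (obstruction u).
  rewrite obstructionE // (_ : wdeg u + 1 = Posz (excess u).+2) ?wdegE; last by rewrite /wdeg; lia.
  rewrite (_ : 2 + (excess u)%:Z = Posz (excess u).+2); last by lia.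
  rewrite (_ : 2 + 1 + (excess w)%:Z = Posz (excess w).+3); last by lia.
  by apply: bcl_mull; [rewrite wl excess_cons; lia|exact: curvature_closed].
have br : bcl (2 + 1 + (excess w)%:Z) (tmulr (wdeg [:: m]) (rho m) (Om v)) = act m (obstruction v).
  rewrite obstructionE // (_ : wdeg [:: m] = Posz m.1.+1); last by rewrite /wdeg excess_cons addn0.
  rewrite (_ : 2 + (excess v)%:Z = Posz (excess v).+2); last by lia.
  rewrite (_ : 2 + 1 + (excess w)%:Z = Posz (excess w).+3); last by lia.
  by apply: bcl_mulr; [rewrite wm excess_rcons; lia|exact: curvature_closed].
have dl : tdif (tmulr (wdeg u + 1) (Om u) (rho l)) = 0.
  by apply: tmulr_closed; [exact: curvature_closed|exact: at_rep_closed].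
have dr : tdif (tmulr (wdeg [:: m]) (rho m) (Om v)) = 0.
  by apply: tmulr_closed; [exact: at_rep_closed|exact: curvature_closed].
have dO : tdif (tdif (Om w)) = 0 by exact: tdif_tdif.
have dOM : tdif (tdif (Om w) + mergesum Om w) = 0 by rewrite (tdifD (tdif (Om w))) dO dm addr0.
have := congr1 (bcl (2 + 1 + (excess w)%:Z)) E.
rewrite (bclD _ dOM dr) (bclD _ dO dm) bm bl br /bcl class_at_exact (morphD0 (@bcompD V B _)) add0r.
by rewrite (wdiff_ends _ _ _ _ wl wm) => <-; rewrite addF2.
Qed.

(** Up to an exact term the curvature compares the representative of a product with the product of
    the representatives, and [theta] is multiplicative. *)
Lemma obstruction2 l m : bcl (2 + (excess [:: l; m])%:Z) (Om [:: l; m]) = 0.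
Proof.
have -> : Om [:: l; m] = tdif (f [:: l; m]) + rho (lmul l m)
    + tmulr (Posz m.1.+1) (rho m) (rho l).
  have -> : Om [:: l; m] = tdif (f [:: l; m]) + (f [:: lmul l m] + 0)
    + (twist f [:: l; m] (f [::]) + (twist f [:: m] (f [:: l]) + twist f [::] (f [:: l; m]))) by [].
  rewrite f0 (morphD0 (twistD _ _)) (twist0 f0) !f1 addr0 add0r addr0; congr (_ + _).
  by rewrite /twist f1 /wdeg excess_cons addn0.
have -> : 2 + (excess [:: l; m])%:Z = Posz (l.1 + m.1).+2.
  by rewrite !excess_cons addn0; lia.
have dm : tdif (tmulr (Posz m.1.+1) (rho m) (rho l)) = 0.
  exact: tmulr_closed (at_rep_closed _) (at_rep_closed _).
have dl : tdif (rho (lmul l m)) = 0 by exact: at_rep_closed.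
rewrite bclD // ?bclD ?tdifD ?tdif_tdif ?dl ?addr0 //.
rewrite (bcl_mulr (e := l.1)) ?at_rep_closed //.
rewrite {1}/bcl class_at_exact (morphD0 (@bcompD V B _)) add0r.
by rewrite /bcl !class_at_rep bcomp_letter /boolr_act /boolr_smul mulrC addF2.
Qed.

Lemma obstruction_exact : exists h, [/\ multiadd h, homog_fun 1 h, forall w, tdif (h w) = 0,
  forall w, size w != n -> h w = 0 & (n = 1)%N -> forall w, h w = 0] /\
  forall w, size w = n.+1 ->
    wdiff lmul act act (fun v => bcl (1 + (excess v)%:Z) (h v)) w = obstruction w.
Proof.
(* For [n = 1] a correction would change the prescribed values on letters; the obstruction vanishes
   already and [h] is zero. *)
have [n1|n1] := eqVneq n 1%N.
  exists (fun=> 0); split.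
    split=> // [u a b c v _|w]; [by rewrite addr0|exact: tdif0].
  move=> w; rewrite n1; case: w => [|l [|m []]] // _.
  rewrite obstructionE ?n1 // obstruction2.
  transitivity (wdiff lmul act act (fun=> 0) [:: l; m]); last by apply: diff0; exact: boolr_actD.
  by apply: eq_diff => v _; exact: bcl0.
have [||G GM dG] := @boolean_exact V B B idfun n.+1 obstruction _ multiadd_obstruction.
- by rewrite ltnS.
- exact: obstruction_cocycle.
pose h w : Y := if size w == n then at_deg (rep (bincl V (1 + (excess w)%:Z) (G w))) else 0.
exists h; split.
  split=> [u a b c v H|w|w|w /negPf|/eqP]; last by rewrite (negPf n1).
  - have [ea eb sa sb] := ladd_words u v H.
    rewrite /h ea eb sa sb; case: eqP => [sw|_]; last by rewrite addr0.
    by rewrite (GM _ _ _ _ _ H) binclD repD at_degD.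
  - by rewrite /h; case: ifP => _; [exact: at_deg_homog|exact: homog0].
  - by rewrite /h; case: ifP => _; [exact: at_rep_closed|exact: tdif0].
  - by rewrite /h => ->.
move=> w sw; rewrite -dG //; apply: eq_diff => v sv.
have {}sv : size v = n by apply/eqP; rewrite -eqSS sv sw.
by rewrite /h sv eqxx /bcl class_at_rep.
Qed.

(* Changing [f] on words of length [n] by cocycles makes the curvature exact on
   words of length [n.+1]; a primitive of it is then absorbed into [f]. *)
Lemma mc_step : exists2 f', mc_upto n.+1 f' & forall w, (size w < n)%N -> f' w = f w.
Proof.
have [h [[hM hh dh hn h1] bh]] := obstruction_exact.
pose f2 w := f w + h w.
have f2M : multiadd f2 by exact: multiadditiveD.
have f2h : homog_fun 1 f2 by move=> w; apply: homogD; [exact: fh|exact: hh].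
have f20 : f2 [::] = 0 by rewrite /f2 f0 hn ?addr0 // eq_sym -lt0n.
have f2c w : (size w <= n)%N -> curvature f2 w = 0.
  by move=> sw; rewrite (curvature_add_top f0 n_gt0 hn sw) fc // dh addr0.
have f2ch : homog_fun 2 (curvature f2) by exact: (homog_fun_nabla f2 f2h).
have f2_exact w : size w = n.+1 -> exists u, tdif u = curvature f2 w.
  move=> sw.
  have [l [u [v [m [wl wm su sv]]]]] := split_ends sw.
  have h0 : h [::] = 0 by rewrite hn // eq_sym -lt0n.
  have E : curvature f2 w = Om w + mergesum h w + tmulr (wdeg [:: m]) (rho m) (h v)
      + tmulr (wdeg u) (h u) (rho l).
    rewrite curvatureD /nabla dh add0r.
    have -> : conv (twist f) h w = tmulr (wdeg [:: m]) (rho m) (h v).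
      rewrite wm conv_last; [by rewrite /twist f1|exact: twistD|exact: twist0|].
      by move=> r; rewrite sv => sr; apply: hn; rewrite ltn_eqF.
    have -> : conv (twist h) f w = tmulr (wdeg u) (h u) (rho l).
      rewrite wl conv_first; [by rewrite f1|exact: twistD|by []|].
      by move=> r; rewrite su => sr; apply: twist0; apply: hn; rewrite ltn_eqF.
    (* A product of two values of [h] needs words of length [n + n], which differs from [n.+1]
       unless [n = 1], and then [h] is zero. *)
    rewrite [conv (twist h) h w]conv_split0 ?addr0 -?addrA // => a b ew.
    have [n1|n1] := eqVneq n 1%N; first by apply: twist0; exact: h1.
    have [sa|sa] := eqVneq (size a) n; last by rewrite hn //; exact: morphD0 (twistD _ _).
    by apply: twist0; apply: hn; move: (congr1 size ew); rewrite size_cat sa sw; lia.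
  have dO : tdif (Om w) = 0 by exact: curvature_closed.
  have [dm bm] : tdif (mergesum h w) = 0 /\ _ := @bcl_mergesum 1 h w (fun v _ => dh v).
  have dr : tdif (tmulr (wdeg [:: m]) (rho m) (h v)) = 0.
    exact: tmulr_closed (at_rep_closed _) (dh v).
  have dl : tdif (tmulr (wdeg u) (h u) (rho l)) = 0.
    exact: tmulr_closed (dh u) (at_rep_closed _).
  have d1 : tdif (Om w + mergesum h w) = 0 by rewrite (tdifD (Om w)) dO dm addr0.
  have d2 : tdif (Om w + mergesum h w + tmulr (wdeg [:: m]) (rho m) (h v)) = 0.
    by rewrite (tdifD (_ + _)) d1 dr addr0.
  have d3 : tdif (curvature f2 w) = 0 by rewrite E (tdifD (_ + _)) d2 dl addr0.
  have bl : bcl (2 + (excess w)%:Z) (tmulr (wdeg u) (h u) (rho l)) = act l (bcl (1 + (excess u)%:Z) (h u)).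
    rewrite (_ : 2 + (excess w)%:Z = Posz (excess w).+2); last by lia.
    by apply: bcl_mull; rewrite ?dh // wl excess_cons.
  have br : bcl (2 + (excess w)%:Z) (tmulr (wdeg [:: m]) (rho m) (h v)) = act m (bcl (1 + (excess v)%:Z) (h v)).
    rewrite (_ : 2 + (excess w)%:Z = Posz (excess w).+2); last by lia.
    rewrite (_ : wdeg [:: m] = Posz m.1.+1); last by rewrite /wdeg excess_cons addn0.
    by apply: bcl_mulr; rewrite ?dh // wm excess_rcons.
  have c0 : bcl (2 + (excess w)%:Z) (curvature f2 w) = 0.
    rewrite E (bclD _ d2 dl) (bclD _ d1 dr) (bclD _ dO dm) bl br bm.
    rewrite -(obstructionE sw) -bh // (wdiff_ends _ _ _ _ wl wm).
    char2.
  have [||u0 _ du0] := class_at_eq0 theta_bij d3 (n := 2 + (excess w)%:Z).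
  - exact: f2ch.
  - exact: bcomp_eq0 c0.
  by exists u0.
(* A linear section of the differential keeps the primitives multiadditive. It ignores degrees,
   whence the projection [tproj] in [k]. *)
have [s [sD sP]] := @linear_section_exists Y Y setT (@tdif C) I (fun _ _ _ _ => I) (@tdifD C).
pose k w : Y := if size w == n.+1 then tproj (1 + (excess w)%:Z) (s (curvature f2 w)) else 0.
have kn w : size w != n.+1 -> k w = 0 by rewrite /k => /negPf ->.
have c2M : multiadd (curvature f2) by exact: multiadd_nabla.
have kM : multiadd k.
  move=> u a b c v H; have [ea eb sa sb] := ladd_words u v H.
  rewrite /k ea eb sa sb; case: eqP => [sw|_]; last by rewrite addr0.
  rewrite (c2M _ _ _ _ _ H) sD /tproj ?totD ?at_degD //.
    by have [|z dz] := f2_exact (u ++ a :: v); [rewrite sa|exists z].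
  by have [|z dz] := f2_exact (u ++ b :: v); [rewrite sb|exists z].
have kh : homog_fun 1 k by move=> w; rewrite /k; case: ifP => _; [exact: at_deg_homog|exact: homog0].
have f3c w : (size w <= n.+1)%N -> curvature (fun v => f2 v + k v) w = 0.
  move=> sw; rewrite (curvature_add_top f20 _ kn sw) //.
  move: sw; rewrite leq_eqVlt => /orP[/eqP sw|sw]; last first.
    by rewrite f2c // kn ?ltn_eqF // tdif0 addr0.
  rewrite /k sw eqxx tdif_proj; have [z dz] := f2_exact w sw.
  have [_ sz] := sP z I; rewrite -dz sz dz /tproj (_ : 1 + _ + 1 = 2 + (excess w)%:Z); last by lia.
  by rewrite (at_degK (f2ch w)) addF2.
exists (fun w => f2 w + k w).
  split=> //; first exact: multiadditiveD.
  - by move=> w; apply: homogD; [exact: f2h|exact: kh].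
  - by rewrite f20 kn // addr0.
  - move=> l; rewrite kn ?addr0 /f2 ?f1; last by rewrite eqSS ltn_eqF.
    have [n1|n1] := eqVneq n 1%N; first by rewrite h1 // addr0.
    by rewrite hn ?addr0 // eq_sym.
move=> w sw; rewrite /f2 (hn _ (negbT (ltn_eqF sw))) (kn _ (negbT (ltn_eqF (leqW sw)))).
by rewrite !addr0.
Qed.

End Obstruction.

Lemma mc_base : mc_upto 1 (fun w => if w is [:: l] then rho l else 0).
Proof.
split=> //.
- move=> [|x [|y u]] a b c v H /=; last by rewrite addr0.
    by case: v => [|y v]; [exact: rho_add|rewrite addr0].
  by rewrite addr0.
- move=> [|l [|m w]] //.
  by have := @at_deg_homog C _ (rep (letter_elt l)); congr (homog _ _); rewrite excess_cons addn0; lia.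
- move=> [|l [|m w]] // _; rewrite /curvature /nabla ?rdiff_nil ?rdiff1 ?at_rep_closed ?tdif0 !add0r /=.
    exact: morphD0 (twistD _ _).
  by rewrite (morphD0 (twistD _ _)) add0r twist0.
Qed.

(** Stage [n] of the construction is kept by all later stages on words of length at most [n], so the
    value at stage [size w] is final. *)
Theorem twisting_exists : exists f, [/\ multiadd f, homog_fun 1 f, f [::] = 0,
  forall l, f [:: l] = rho l & forall w, curvature f w = 0].
Proof.
have [st stP] : exists st : nat -> (seq letter -> Y) -> (seq letter -> Y), forall n f,
    mc_upto n.+1 f -> mc_upto n.+2 (st n f) /\ forall w, (size w < n.+1)%N -> st n f w = f w.
  have [|st stP] := @choice (nat * (seq letter -> Y)) (seq letter -> Y) (fun p f' =>
      mc_upto p.1.+1 p.2 -> mc_upto p.1.+2 f' /\ forall w, (size w < p.1.+1)%N -> f' w = p.2 w).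
    move=> [n f]; have [fP|nf] := pselect (mc_upto n.+1 f); last by exists f => /nf.
    by have [f' f'P f'E] := mc_step (ltn0Sn n) fP; exists f'.
  by exists (fun n f => st (n, f)) => n f; apply: (stP (n, f)).
pose F := fix F n := if n is m.+1 then st m (F m)
  else fun w => if w is [:: l] then rho l else 0.
have FP n : mc_upto n.+1 (F n).
  elim: n => [|n IH]; first exact: mc_base.
  by have [] := stP _ _ IH.
have Fstable n k w : (size w <= n)%N -> F (n + k)%N w = F n w.
  elim: k => [|k IH] sw; first by rewrite addn0.
  by rewrite addnS /= (proj2 (stP _ _ (FP _))) ?IH // ltnS (leq_trans sw) // leq_addr.
pose f w := F (size w) w.
have fE n w : (size w <= n)%N -> f w = F n w.
  by move=> sw; rewrite -(subnKC sw) Fstable.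
exists f; split=> [u a b c v H|w||l|w].
- have [_ _ sa sb] := ladd_words u v H; rewrite /f sa sb.
  by have [FM _ _ _ _] := FP (size (u ++ c :: v)); exact: FM.
- by have [_ Fh _ _ _] := FP (size w); exact: Fh.
- by have [_ _ F0 _ _] := FP 0.
- by have [_ _ _ F1 _] := FP 1; exact: F1.
- have [_ _ _ _ Fc] := FP (size w); rewrite -(Fc w (leqnSn _)).
  by apply: eq_nabla => v; exact: fE.
Qed.

End TwistingElement.

(** * A triangular differential graded algebra *)

Lemma inj_surj_bij (T U : Type) (f : T -> U) :
  injective f -> (forall y, exists x, f x = y) -> bijective f.
Proof.
by move=> fI /choice[g gK]; exists g => // x; apply: fI; rewrite gK.
Qed.

Lemma quasi_isoP (C D : dga) (f : dgmor C D) :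
  (forall k (z : D k), dif D (erefl (k + 1)) z = 0 -> exists2 x : C k,
     dif C (erefl (k + 1)) x = 0 & exists i (e : i + 1 = k) u, dif D e u = f k x - z) ->
  (forall k (x : C k), dif C (erefl (k + 1)) x = 0 ->
     (exists i (e : i + 1 = k) u, dif D e u = f k x) ->
     exists i (e : i + 1 = k) u, dif C e u = x) ->
  quasi_iso f.
Proof.
move=> surj inj k; apply: inj_surj_bij => [x y|y].
  rewrite -[x]dgreprK -[y]dgreprK !cohomology_map_class => /dgclass_eq[i [e [u eu]]].
  apply/dgclass_eq; apply: inj; last by exists i, e, u; rewrite eu raddfB.
  exact: (dgcocycleP (dgrepr x - dgrepr y) erefl).
have [x dx [i [e [u eu]]]] := surj k _ (dgcocycleP (dgrepr y) erefl).
exists (dgclass C k (mk_dgcocycle dx)); rewrite cohomology_map_class -[RHS]dgreprK.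
by apply/dgclass_eq; exists i, e, u.
Qed.

Lemma gmor_inverse (P Q : galg) (f : gmor P Q) : (forall i, bijective (f i)) ->
  exists g : gmor Q P, (forall i, cancel (f i) (g i)) /\ (forall i, cancel (g i) (f i)).
Proof.
move=> f_bij.
have ex i : exists g : Q i -> P i, cancel (f i) g /\ cancel g (f i).
  by have [g fK gK] := f_bij i; exists g.
pose g i := projT1 (cid (ex i)).
have fK i : cancel (f i) (g i) := (projT2 (cid (ex i))).1.
have gK i : cancel (g i) (f i) := (projT2 (cid (ex i))).2.
have glin i : linear (g i) by move=> c x y; apply: (bij_inj (f_bij i)); rewrite linearP !gK.
pose gl i : {linear Q i -> P i} := HB.pack (g i) (GRing.isLinear.Build F2 (Q i) (P i) *:%R (g i) (glin i)).
have g1 : gl 0 (gone Q) = gone P by rewrite -(gmap1 f) /= fK.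
have gM i j k (e : i + j = k) a b : gl k (gmul e a b) = gmul e (gl i a) (gl j b).
  by apply: (bij_inj (f_bij k)); rewrite gmapM /= !gK.
by exists (GMor g1 gM); split=> i x; [exact: fK|exact: gK].
Qed.

Section Triangular.
Variables (Q : galg) (C : dga) (X : lmodType F2) (mem : int -> X -> Prop).
Variables (d : X -> X) (la : forall i, C i -> X -> X) (ra : forall j, Q j -> X -> X).
Variable x0 : X.
Hypothesis mem0 : forall i, mem i 0.
Hypothesis memD : forall i y z, mem i y -> mem i z -> mem i (y + z).
Hypothesis dD : {morph d : y z / y + z}.
Hypothesis d_d : forall y, d (d y) = 0.
Hypothesis mem_d : forall i y, mem i y -> mem (i + 1) (d y).
Hypothesis laDr : forall i (c : C i), {morph la c : y z / y + z}.
Hypothesis laDl : forall i (c c' : C i) y, la (c + c') y = la c y + la c' y.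
Hypothesis la1 : forall y, la (gone C) y = y.
Hypothesis laM : forall i j k (e : i + j = k) (c : C i) (c' : C j) y,
  la (gmul e c c') y = la c (la c' y).
Hypothesis mem_la : forall i j (c : C i) y, mem j y -> mem (i + j) (la c y).
Hypothesis d_la : forall i (c : C i) y, d (la c y) = la (dif C erefl c) y + la c (d y).
Hypothesis raDr : forall j (q : Q j), {morph ra q : y z / y + z}.
Hypothesis raDl : forall i j (q q' : Q j) y, mem i y -> ra (q + q') y = ra q y + ra q' y.
Hypothesis ra1 : forall y, ra (gone Q) y = y.
Hypothesis raM : forall l i j k (e : i + j = k) (q : Q i) (q' : Q j) y, mem l y ->
  ra (gmul e q q') y = ra q' (ra q y).
Hypothesis mem_ra : forall i j (q : Q j) y, mem i y -> mem (i + j) (ra q y).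
Hypothesis d_ra : forall i j (q : Q j) y, mem i y -> d (ra q y) = ra q (d y).
Hypothesis laraC : forall i j (c : C i) (q : Q j) y, la c (ra q y) = ra q (la c y).
Hypothesis mem_x0 : mem 0 x0.
Hypothesis d_x0 : d x0 = 0.

Let d0 : d 0 = 0. Proof. exact: morphD0 dD. Qed.
Let la0r i (c : C i) : la c 0 = 0. Proof. exact: morphD0 (laDr c). Qed.
Let ra0r j (q : Q j) : ra q 0 = 0. Proof. exact: morphD0 (raDr q). Qed.
Let la0l i y : la (0 : C i) y = 0.
Proof. by apply: (@morphD0 _ _ (fun c : C i => la c y)) => c c'; exact: laDl. Qed.
Let ra0l i j y : mem i y -> ra (0 : Q j) y = 0.
Proof. by move=> my; have := raDl (0 : Q j) 0 my; rewrite !addF2. Qed.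

(* Triangular matrices with diagonal entries in [Q] and [C] and corner in [X],
   shifted by one; the differential is perturbed by the commutator with the
   corner [x0]. *)
Definition tri_pred (i : int) : {pred (Q i * C i * X)} := fun p => `[< mem (i - 1) p.2 >].

Fact tri_submod i : submod_closed (@tri_pred i).
Proof.
split=> [|c p q]; first by apply/asboolP; exact: mem0.
move=> /asboolP mp /asboolP mq; apply/asboolP.
case: (F2_cases c) => ->; [rewrite scale0r add0r //|rewrite scale1r; exact: memD].
Qed.
HB.instance Definition _ i :=
  GRing.isSubmodClosed.Build F2 (Q i * C i * X)%type (@tri_pred i) (@tri_submod i).

Record tri i := Tri { tri_val :> (Q i * C i * X)%type; tri_valP : tri_val \in @tri_pred i }.
HB.instance Definition _ i := [isSub for @tri_val i].
HB.instance Definition _ i := [Choice of tri i by <:].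
HB.instance Definition _ i := [SubChoice_isSubLmodule of tri i by <:].

Lemma tri_eq i (x y : tri i) : tri_val x = tri_val y -> x = y.
Proof. exact: val_inj. Qed.

Lemma tri_mem i (x : tri i) : mem (i - 1) (tri_val x).2.
Proof. exact/asboolP/(tri_valP x). Qed.

Definition mk_tri i q c y (my : mem (i - 1) y) : tri i :=
  @Tri i (q, c, y) (introT (asboolP _) my).

Fact tri_mul_mem (i j k : int) (e : i + j = k) (x : tri i) (y : tri j) :
  mem (k - 1) (la (tri_val x).1.2 (tri_val y).2 + ra (tri_val y).1.1 (tri_val x).2).
Proof.
apply: memD.
  by have := mem_la (tri_val x).1.2 (tri_mem y); congr (mem _ _); lia.
by have := mem_ra (tri_val y).1.1 (tri_mem x); congr (mem _ _); lia.
Qed.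

Definition tri_mul (i j k : int) (e : i + j = k) (x : tri i) (y : tri j) : tri k :=
  mk_tri (gmul e (tri_val x).1.1 (tri_val y).1.1) (gmul e (tri_val x).1.2 (tri_val y).1.2)
    (tri_mul_mem e x y).

Definition tri_one : tri 0 := mk_tri (gone Q) (gone C) (mem0 (0 - 1)).

Fact tri_mul_linr (i j k : int) (e : i + j = k) (a : tri i) : linear (tri_mul e a).
Proof.
apply: F2_linear => x y; apply: tri_eq; congr (_, _, _).
- exact: gmulDr.
- exact: gmulDr.
- rewrite /= laDr (raDl _ _ (tri_mem a)); exact: addrACA.
Qed.

Fact tri_mul_linl (i j k : int) (e : i + j = k) (b : tri j) : linear (fun a => tri_mul e a b).
Proof.
apply: F2_linear => x y; apply: tri_eq; congr (_, _, _).
- exact: (gmulDl e).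
- exact: (gmulDl e).
- rewrite /= laDl raDr; exact: addrACA.
Qed.

Definition tri_galg : galg.
Proof.
exists (fun i => tri i) tri_one tri_mul.
- exact: tri_mul_linr.
- exact: tri_mul_linl.
- move=> i j k ij jk l e1 e2 e3 e4 a b c; apply: tri_eq; congr (_, _, _).
  + exact: gmulA.
  + exact: gmulA.
  + rewrite /= laM raDr laDr (raM e3 _ _ (tri_mem a)) laraC; exact: addrA.
- move=> i e a; apply: tri_eq; rewrite [RHS]surjective_pairing [X in (X, _)]surjective_pairing.
  congr (_, _, _); [exact: gmul1l|exact: gmul1l|].
  by rewrite /= la1 ra0r addr0.
- move=> i e a; apply: tri_eq; rewrite [RHS]surjective_pairing [X in (X, _)]surjective_pairing.
  congr (_, _, _); [exact: gmul1r|exact: gmul1r|].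
  by rewrite /= ra1 la0r add0r.
Defined.

Fact tri_dif_mem (i k : int) (e : i + 1 = k) (x : tri i) :
  mem (k - 1) (d (tri_val x).2 + ra (tri_val x).1.1 x0 + la (tri_val x).1.2 x0).
Proof.
apply: memD; first apply: memD.
- by have := mem_d (tri_mem x); congr (mem _ _); lia.
- by have := mem_ra (tri_val x).1.1 mem_x0; congr (mem _ _); lia.
- by have := mem_la (tri_val x).1.2 mem_x0; congr (mem _ _); lia.
Qed.

Definition tri_dif_fun (i k : int) (e : i + 1 = k) (x : tri i) : tri k :=
  mk_tri 0 (dif C e (tri_val x).1.2) (tri_dif_mem e x).

Fact tri_dif_linear (i k : int) (e : i + 1 = k) : linear (tri_dif_fun e).
Proof.
apply: F2_linear => x y; apply: tri_eq; congr (_, _, _).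
- by rewrite addr0.
- exact: raddfD.
- by rewrite /= dD laDl (raDl _ _ mem_x0); char2.
Qed.
HB.instance Definition _ (i k : int) (e : i + 1 = k) :=
  GRing.isLinear.Build F2 (tri i) (tri k) *:%R (tri_dif_fun e) (tri_dif_linear e).

Definition tri_dga : dga.
Proof.
exists tri_galg (fun i k e => tri_dif_fun e : {linear tri i -> tri k}).
- move=> i j k e1 e2 x; apply: tri_eq; congr (_, _, _); first exact: difK.
  rewrite /= !dD d_d (d_ra _ mem_x0) d_la d_x0 ra0r la0r (ra0l _ mem_x0).
  by case: j / e1 e2 => e2; char2.
- move=> i j k i' j' k' e ei ej ek e1 e2 a b; apply: tri_eq; congr (_, _, _).
  + by rewrite /= gmul0l gmul0r addr0.
  + exact: difM.
  + rewrite /= !(dD, laDr, raDr) d_la (d_ra _ (tri_mem a)) laM (raM e _ _ mem_x0).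
    rewrite (ra0l _ (tri_mem a)) laraC.
    case: i' / ei e1 => e1; case: j' / ej e2 => e2; char2.
Defined.

Let d_la_deg i k (e : i + 1 = k) (c : C i) y : d (la c y) = la (dif C e c) y + la c (d y).
Proof. by case: k / e. Qed.

Definition tri_snd i (x : tri i) : C i := (tri_val x).1.2.
Fact tri_snd_linear i : linear (@tri_snd i).
Proof. exact: F2_linear. Qed.
HB.instance Definition _ i :=
  GRing.isLinear.Build F2 (tri i) (C i) *:%R (@tri_snd i) (@tri_snd_linear i).

Definition tri_to_alg : gmor tri_dga C :=
  @GMor tri_dga C (fun i => @tri_snd i : {linear tri i -> C i}) erefl
    (fun _ _ _ _ _ _ => erefl).
Definition tri_to_dga : dgmor tri_dga C :=
  @DGMor tri_dga C tri_to_alg (fun _ _ _ _ => erefl).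

Definition tri_fst i (x : tri i) : Q i := (tri_val x).1.1.
Fact tri_fst_linear i : linear (@tri_fst i).
Proof. exact: F2_linear. Qed.
HB.instance Definition _ i :=
  GRing.isLinear.Build F2 (tri i) (Q i) *:%R (@tri_fst i) (@tri_fst_linear i).

Variable theta : gmor (cohomology_algebra C) Q.
Hypothesis theta_bij : forall i, bijective (theta i).
Variable ev : forall i, X -> C i.
Hypothesis evD : forall i, {morph ev i : y z / y + z}.
Hypothesis ev_d : forall i k (e : i + 1 = k) y, mem i y -> ev k (d y) = dif C e (ev i y).
Hypothesis ev_la : forall i (c : C i), ev i (la c x0) = c.
Hypothesis ev_ra_closed : forall i (q : Q i), dif C (erefl (i + 1)) (ev i (ra q x0)) = 0.
Hypothesis ev_ra : forall i (q : Q i), class_at theta i (at_deg (ev i (ra q x0))) = q.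
Hypothesis exactX : forall i y, mem i y -> d y = 0 -> ev i y = 0 ->
  exists2 z, mem (i - 1) z & d z = y.

Let cl i (c : C i) : Q i := class_at theta i (at_deg c).

Let clD i (c c' : C i) : dif C (erefl (i + 1)) c = 0 -> dif C (erefl (i + 1)) c' = 0 ->
  cl (c + c') = cl c + cl c'.
Proof.
by move=> dc dc'; rewrite /cl at_degD class_atD // (tdif_at erefl) ?dc ?dc' at_deg0.
Qed.

Let cl_dif i k (e : i + 1 = k) (u : C i) : cl (dif C e u) = 0.
Proof. by rewrite /cl -tdif_at class_at_exact. Qed.

Let cl_eq0 i (c : C i) : dif C (erefl (i + 1)) c = 0 -> cl c = 0 ->
  exists u, dif C (subrK 1 i) u = c.
Proof.
move=> dc c0; have [|u _ du] := class_at_eq0 theta_bij _ (@at_deg_homog _ i c) c0.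
  by rewrite (tdif_at erefl) dc at_deg0.
by exists (u (i - 1)); rewrite -(tdifE u) du at_degE.
Qed.

Let difD i k (e : i + 1 = k) : {morph dif C e : a b / a + b}.
Proof. exact: raddfD. Qed.

Let tri_closed k (x : tri k) : tri_dif_fun (erefl (k + 1)) x = 0 ->
  dif C (erefl (k + 1)) (tri_snd x) = 0 /\
  d (tri_val x).2 + ra (tri_fst x) x0 + la (tri_snd x) x0 = 0.
Proof. by move=> /(congr1 (@tri_val _)) [dc dy]; split. Qed.

(** [ev] is a chain map from [X] to [C] split by the action on [x0], with acyclic kernel by
    [exactX], and [ev k (ra q x0)] represents the class [q]. Hence for a cocycle [z] of class [q]
    the elements [la z x0] and [ra q x0] differ by a coboundary, whose primitive is the corner of
    the lift. *)
Lemma tri_to_dga_quasi_iso : quasi_iso tri_to_dga.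
Proof.
apply: quasi_isoP => [k z dz|k x dx [i [e [b db]]]].
  pose q := cl z; pose r := ev k (ra q x0).
  have [||u du] := @cl_eq0 k (r + z).
  - by rewrite difD (ev_ra_closed q) dz addr0.
  - by rewrite clD ?ev_ra_closed // ?[cl r]ev_ra ?addF2.
  have mu : mem (k - 1) (la u x0) by have := mem_la u mem_x0; rewrite addr0.
  (* The coboundary [d (la u x0)] moves the difference into the kernel of [ev]. *)
  pose w := d (la u x0) + ra q x0 + la z x0.
  have mw : mem k w.
    apply: memD; first apply: memD.
    - by have := mem_d mu; rewrite subrK.
    - by have := mem_ra q mem_x0; rewrite add0r.
    - by have := mem_la z mem_x0; rewrite addr0.
  have [||y my dy] := exactX mw.
  - by rewrite /w !dD d_d (d_ra _ mem_x0) d_la dz d_x0 ra0r la0r la0l; char2.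
  - by rewrite /w !evD (ev_d (subrK 1 k) mu) !ev_la du -/r; char2.
  exists (mk_tri q z (memD mu my)).
    apply: tri_eq; congr (_, _, _); first exact: dz.
    by rewrite /= dD dy /w; char2.
  by exists (k - 1), (subrK 1 k), 0; rewrite raddf0 subrr.
have [dc dy] := tri_closed dx.
case: k / e x dx db dc dy => x dx db dc.
set c := tri_snd x in dc *; set q := tri_fst x; set y := (tri_val x).2 => dy.
have my : mem i y by have := tri_mem x; congr (mem _ _); lia.
have er : dif C erefl (ev i y) + ev (i + 1) (ra q x0) + c = 0.
  rewrite -(ev_d erefl my) -[c in LHS](ev_la c) -!evD dy.
  exact: morphD0 (@evD _).
have rq : ev (i + 1) (ra q x0) = dif C erefl (ev i y + b).
  by rewrite difD db -/c -[LHS]addr0 -er; char2.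
have q0 : q = 0 by rewrite -(ev_ra q) rq; exact: cl_dif.
(* [u] is a cocycle because [q] vanishes. Its class [q'] need not be zero and becomes the entry in
   [Q] of the primitive. *)
pose u := ev i y + b; pose q' := cl u; pose r := ev i (ra q' x0).
have du : dif C erefl u = 0.
  by rewrite -rq q0 (ra0l _ mem_x0); exact: morphD0 (@evD _).
have [||v dv] := @cl_eq0 i (u + r).
- by rewrite difD du (ev_ra_closed q') addr0.
- by rewrite clD ?ev_ra_closed // ?[cl r]ev_ra ?addF2.
have mv : mem (i - 1) (la v x0) by have := mem_la v mem_x0; rewrite addr0.
pose w := y + la b x0 + ra q' x0 + d (la v x0).
have mw : mem i w.
  apply: memD; first apply: memD; first apply: memD => //.
  - by have := mem_la b mem_x0; rewrite addr0.
  - by have := mem_ra q' mem_x0; rewrite add0r.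
  - by have := mem_d mv; rewrite subrK.
have [||z mz dz] := exactX mw.
- rewrite /w !dD d_d (d_ra _ mem_x0) d_la d_x0 ra0r la0r db -/c.
  by rewrite -[RHS]dy q0 (ra0l _ mem_x0); char2.
- by rewrite /w !evD (ev_d (subrK 1 i) mv) !ev_la dv /u -/r; char2.
exists i, erefl, (mk_tri q' b (memD mz mv)).
apply: tri_eq; rewrite [RHS]surjective_pairing [X in (X, _)]surjective_pairing.
congr (_, _, _); [exact: (esym q0)|exact: db|].
by rewrite /= dD dz /w -/y; char2.
Qed.

Variable phi : gmor Q (cohomology_algebra C).
Hypothesis thetaK : forall i, cancel (theta i) (phi i).
Hypothesis phiK : forall i, cancel (phi i) (theta i).

Definition tri_to_cohomology_fun i (x : tri i) : cohomology_algebra C i := phi i (tri_fst x).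
Fact tri_to_cohomology_linear i : linear (@tri_to_cohomology_fun i).
Proof. by move=> a x y; exact: (linearP (phi i)). Qed.
HB.instance Definition _ i := GRing.isLinear.Build F2 (tri i) (cohomology_algebra C i) *:%R
  (@tri_to_cohomology_fun i) (@tri_to_cohomology_linear i).

Definition tri_to_cohomology_alg : gmor tri_dga (zero_dga (cohomology_algebra C)) :=
  @GMor tri_dga (zero_dga (cohomology_algebra C))
    (fun i => @tri_to_cohomology_fun i : {linear tri i -> cohomology_algebra C i})
    (gmap1 phi) (fun i j k e a b => gmapM phi e (tri_fst a) (tri_fst b)).

Definition tri_to_cohomology : dgmor tri_dga (zero_dga (cohomology_algebra C)) :=
  @DGMor tri_dga (zero_dga (cohomology_algebra C)) tri_to_cohomology_alg
    (fun i k e x => raddf0 (phi k)).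

(** A class [q] lifts to the diagonal entries [q] and [c = ev k (ra q x0)]: then [ra q x0 + la c x0]
    is a cocycle in the kernel of [ev], and a primitive of it is the corner. *)
Lemma tri_to_cohomology_quasi_iso : quasi_iso tri_to_cohomology.
Proof.
apply: quasi_isoP => [k z _|k x dx [i [e [b db]]]].
  pose q := theta k z; pose c := ev k (ra q x0).
  have dc : dif C (erefl (k + 1)) c = 0 by exact: ev_ra_closed.
  have mw : mem k (ra q x0 + la c x0).
    apply: memD; first by have := mem_ra q mem_x0; rewrite add0r.
    by have := mem_la c mem_x0; rewrite addr0.
  have [||y my dy] := exactX mw.
  - by rewrite dD (d_ra _ mem_x0) d_la dc d_x0 ra0r la0r la0l !addr0.
  - by rewrite evD ev_la addF2.
  exists (mk_tri q c my).
    apply: tri_eq; congr (_, _, _); first exact: dc.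
    by rewrite /= dy; char2.
  exists (k - 1), (subrK 1 k), 0; rewrite raddf0; apply/esym/eqP; rewrite subr_eq0; apply/eqP.
  exact: thetaK.
have [dc dy] := tri_closed dx.
have q0 : tri_fst x = 0.
  have E : phi k (tri_fst x) = 0 := esym db.
  by rewrite -[LHS]phiK E raddf0.
set c := tri_snd x in dc dy; set y := (tri_val x).2 in dy.
have my : mem (k - 1) y := tri_mem x.
pose u := ev (k - 1) y.
have {}dy : d y = la c x0.
  by rewrite -[LHS]addr0 -dy q0 (ra0l _ mem_x0); char2.
have du : dif C (subrK 1 k) u = c by rewrite -(ev_d _ my) dy ev_la.
have mw : mem (k - 1) (y + la u x0).
  by apply: memD => //; have := mem_la u mem_x0; rewrite addr0.
have [||z mz dz] := exactX mw.
- by rewrite dD dy (d_la_deg (subrK 1 k)) du d_x0 la0r addr0 addF2.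
- by rewrite evD ev_la addF2.
exists (k - 1), (subrK 1 k), (mk_tri 0 u mz).
apply: tri_eq; rewrite [RHS]surjective_pairing [X in (X, _)]surjective_pairing.
congr (_, _, _); [exact: (esym q0)|exact: du|].
by rewrite /= dz (ra0l _ mem_x0) -/y; char2.
Qed.

Theorem triangular_formal : formal C.
Proof.
exists tri_dga, tri_to_dga, tri_to_cohomology.
by split; [exact: tri_to_dga_quasi_iso|exact: tri_to_cohomology_quasi_iso].
Qed.

End Triangular.

(** * Formality *)

Section Formality.
Variables (V : lmodType F2) (B : booleanRingType) (C : dga).
Local Notation letter := (letter V B).
Local Notation lmul := (@lmul V B).
Local Notation ladd := (@ladd V B).
Local Notation Q := (VB V B).
Local Notation Y := (tot C).
Implicit Types (F G : seq letter -> Y) (l m : letter) (w : seq letter).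
Notation multiadd := (multiadditive ladd).
Notation mergesum := (rdiff lmul (fun=> fun=> 0)).

Variable f : seq letter -> Y.
Hypothesis fM : multiadd f.
Hypothesis fh : homog_fun 1 f.
Hypothesis f0 : f [::] = 0.
Hypothesis fc : forall w, curvature f w = 0.

Local Notation N := (nabla lmul (@tdif C) (twist f)).

Let ND F G w : N (fun v => F v + G v) w = N F w + N G w.
Proof.
by apply: nablaD; [exact: tdifD|exact: twistD].
Qed.

Let N_N F w : N (N F) w = 0.
Proof.
rewrite twisted_nabla_nabla; apply: conv_split0 => u v _.
exact: (dtwist0 (fc v)).
Qed.

Let N0 w : N (fun=> 0) w = 0.
Proof.
rewrite -[RHS](addF2 (N (fun=> 0) w)) -ND.
by apply: eq_nabla => v _; rewrite ?addr0.
Qed.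

Definition merge_head l F w : Y := if w is x :: r then F (lmul l x :: r) else 0.

Let N_cons F l w : F [::] = 0 -> N F (l :: w) = N (fun v => F (l :: v)) w + merge_head l F w.
Proof.
move=> F0; rewrite /nabla [conv _ F _]/= F0 (morphD0 (twistD _ _)) add0r.
case: w => [|x r]; first by rewrite rdiff1 rdiff_nil !addr0.
by rewrite rdiff_cons2 [merge_head _ _ _]/=; char2.
Qed.

Let N_nil F : F [::] = 0 -> N F [::] = 0.
Proof. by move=> F0; rewrite /nabla rdiff_nil /= F0 tdif0 (morphD0 (twistD _ _)) !addr0. Qed.

Let N_merge_head F l w : F [::] = 0 -> N (merge_head l F) w = merge_head l (N F) w.
Proof.
move=> F0; case: w => [|x r]; first by rewrite N_nil.
rewrite N_cons // [RHS]N_cons //; congr (_ + _).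
by case: r => [|y r] //=; rewrite lmulA.
Qed.

Let conv_mull i (c : C i) F w :
  conv (twist f) (fun v => tmull c (F v)) w = tmull c (conv (twist f) F w).
Proof.
elim: w F => [|x w IH] F /=; first by rewrite /twist tmull_mulr.
by rewrite tmullDr IH /twist tmull_mulr.
Qed.

Let N_mull i (c : C i) F w :
  N (fun v => tmull c (F v)) w = tmull (dif C erefl c) (F w) + tmull c (N F w).
Proof.
have -> : N (fun v => tmull c (F v)) w = tdif (tmull c (F w))
    + mergesum (fun v => tmull c (F v)) w + conv (twist f) (fun v => tmull c (F v)) w by [].
rewrite tdif_mull conv_mull.
rewrite (rdiff_morph lmul (tmullDr c) (ra := fun=> fun=> 0)); last by move=> *; rewrite tmull0.
by rewrite -!addrA -!tmullDr !addrA.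
Qed.

Local Notation X := ((seq letter -> Y) * (seq letter -> Y))%type.
Implicit Types y z : X.

(* A pair [(F1, F2)] encodes a function of [(q, w)] with [q] in [Q], as on the
   bar resolution: its value is [F1 w] at [(1, w)] and [F2 (l :: w)] at [(l, w)].
   Multiplying [q] makes the right action of [Q] strict. *)
Definition xmem (j : int) y := [/\ multiadd y.1, multiadd y.2, homog_fun j y.1,
  homog_fun (j + 1) y.2 & y.2 [::] = 0].
(** The summand [y.2 w] is the merge of q = 1 with the first letter of [w]; for q = l the
    corresponding merge is contained in [nabla] applied to [y.2]. *)
Definition xdif y : X := (fun w => N y.1 w + y.2 w, N y.2).
Definition xla i (c : C i) y : X := (fun w => tmull c (y.1 w), fun w => tmull c (y.2 w)).
Definition xletter l y : X := (fun w => y.2 (l :: w), merge_head l y.2).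
Definition xra (j : int) : Q j -> X -> X := match j return Q j -> X -> X with
  | Posz 0 => fun q y => (q : F2) *: y
  | Posz e.+1 => fun q y => xletter (elt_letter q) y
  | Negz _ => fun _ _ => 0 end.
(** Its value at (q, w) is [f] of the word with q put in front, extended strictly unitally: at q = 1
    it is 1 on the empty word and 0 on all others. *)
Definition xunit : X := (fun w => if w is [::] then tone C else 0, f).
Definition xev (i : int) y : C i := y.1 [::] i.

Let xext y z : (forall w, y.1 w = z.1 w) -> (forall w, y.2 w = z.2 w) -> y = z.
Proof.
case: y z => [y1 y2] [z1 z2] /= e1 e2.
by congr pair; apply: functional_extensionality_dep.
Qed.

Let xmem0 j : xmem j 0.
Proof. by split=> // u a b c v _; rewrite addr0. Qed.

Let xmemD j y z : xmem j y -> xmem j z -> xmem j (y + z).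
Proof.
move=> [m1 m2 h1 h2 e1] [m1' m2' h1' h2' e2]; split.
- exact: multiadditiveD.
- exact: multiadditiveD.
- by move=> w; exact: homogD.
- by move=> w; exact: homogD.
- by rewrite [LHS](_ : _ = y.2 [::] + z.2 [::]) // e1 e2 addr0.
Qed.

Let xdifD : {morph xdif : y z / y + z}.
Proof.
move=> y z; apply: xext => w; last exact: ND.
by rewrite [LHS]/= ND; exact: addrACA.
Qed.

Let xdif_xdif y : xdif (xdif y) = 0.
Proof.
apply: xext => w; last exact: N_N.
by rewrite [LHS]/= (ND (N y.1)) N_N add0r addF2.
Qed.

Let xmem_dif j y : xmem j y -> xmem (j + 1) (xdif y).
Proof.
move=> [m1 m2 h1 h2 e]; split.
- by apply: multiadditiveD => //; exact: multiadd_nabla.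
- exact: multiadd_nabla.
- by move=> w; apply: homogD; [exact: homog_fun_nabla|exact: h2].
- exact: homog_fun_nabla.
- exact: N_nil.
Qed.

Let xlaDr i (c : C i) : {morph xla c : y z / y + z}.
Proof. by move=> y z; apply: xext => w; exact: tmullDr. Qed.
Let xlaDl i (c c' : C i) y : xla (c + c') y = xla c y + xla c' y.
Proof. by apply: xext => w; exact: tmullDl. Qed.
Let xla1 y : xla (gone C) y = y.
Proof. by apply: xext => w; exact: tmull1. Qed.
Let xlaM i j k (e : i + j = k) (c : C i) (c' : C j) y :
  xla (gmul e c c') y = xla c (xla c' y).
Proof. by apply: xext => w; exact: tmullA. Qed.

Let multiadd_mull i (c : C i) F : multiadd F -> multiadd (fun w => tmull c (F w)).
Proof. by move=> FM u a b c' v h; rewrite (FM _ _ _ _ _ h) tmullDr. Qed.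

Let homog_fun_mull j i (c : C i) F : homog_fun j F -> homog_fun (i + j) (fun w => tmull c (F w)).
Proof. by move=> Fh w; rewrite -addrA; apply: homog_mull; exact: Fh. Qed.

Let xmem_la i j (c : C i) y : xmem j y -> xmem (i + j) (xla c y).
Proof.
move=> [m1 m2 h1 h2 e]; split; [exact: multiadd_mull|exact: multiadd_mull|exact: homog_fun_mull| |].
  by rewrite -addrA; exact: homog_fun_mull.
by rewrite /= e tmull0.
Qed.

Let xdif_la i (c : C i) y : xdif (xla c y) = xla (dif C erefl c) y + xla c (xdif y).
Proof.
apply: xext => w; last exact: N_mull.
by rewrite [LHS]/= N_mull -addrA -tmullDr.
Qed.

Let xletterD l : {morph xletter l : y z / y + z}.
Proof. by move=> y z; apply: xext => // -[|x r] //; rewrite [RHS]addr0. Qed.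

Let xraDr j (q : Q j) : {morph xra q : y z / y + z}.
Proof.
case: j q => [[|e]|n] q y z /=; [exact: scalerDr|exact: xletterD|by rewrite addr0].
Qed.

Let xletter_add j a b c y : ladd a b c -> xmem j y ->
  xletter c y = xletter a y + xletter b y.
Proof.
move=> h [_ m2 _ _ _]; apply: xext => [w|[|x r]]; first exact: (m2 [::]).
  by rewrite [RHS]addr0.
exact: (m2 [::] _ _ _ r (lmul_addl x h)).
Qed.

Let elt_letter_add e (q q' : Q (Posz e.+1)) :
  ladd (elt_letter q) (elt_letter q') (elt_letter (q + q')).
Proof. by split=> //; case: e q q' => [|e] q q' //=; rewrite /lval /=; congr pair; rewrite /= addr0. Qed.

Let xraDl i j (q q' : Q j) y : xmem i y -> xra (q + q') y = xra q y + xra q' y.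
Proof.
case: j q q' => [[|e]|n] q q' my /=; [exact: scalerDl| |by rewrite addr0].
exact: (xletter_add (elt_letter_add q q') my).
Qed.

Let xra0l i j y : xmem i y -> xra (0 : Q j) y = 0.
Proof. by move=> my; have := xraDl (0 : Q j) 0 my; rewrite !addF2. Qed.

Let xra0r j (q : Q j) : xra q 0 = 0.
Proof. exact: morphD0 (@xraDr j q). Qed.

Let xra1 y : xra (gone Q) y = y.
Proof. exact: scale1r. Qed.

Let xletterM l m y : xletter (lmul l m) y = xletter m (xletter l y).
Proof. by apply: xext => [w|[|x r]] //=; rewrite lmulA. Qed.

Let xraM t i j k (e : i + j = k) (q : Q i) (q' : Q j) y : xmem t y ->
  xra (gmul e q q') y = xra q' (xra q y).
Proof.
move=> my; case: i e q => [[|i]|i] e q.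
- have ek : j = k by rewrite -e add0r.
  case: k / ek e => e; rewrite [gmul _ _ _](umul_0l e (q : F2)) [xra q y]/=.
  by case: (F2_cases q) => ->; rewrite ?scale1r // !scale0r (xra0l _ my) xra0r.
- case: j e q' => [[|j]|j] e q'.
  + have ek : Posz i.+1 = k by rewrite -e addr0.
    case: k / ek e => e; rewrite [gmul _ _ _](umul_0r e q (q' : F2)) [RHS]/=.
    by case: (F2_cases q') => ->; rewrite ?scale1r // !scale0r (xra0l _ my).
  + have ek : Posz (i + j).+2 = k by rewrite -e; lia.
    case: k / ek e => e.
    have -> : gmul e q q' = letter_elt (lmul (elt_letter q) (elt_letter q')).
      rewrite -[q in LHS]elt_letterK -[q' in LHS]elt_letterK.
      exact: (letter_elt_mul (l := elt_letter q) (m := elt_letter q') e).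
    rewrite -[RHS]xletterM; congr xletter.
  + by rewrite [gmul _ _ _]umul_negr (xra0l _ my).
- by rewrite [gmul _ _ _]umul_negl (xra0l _ my) [xra q y]/= xra0r.
Qed.

Let xmem_letter i l y : xmem i y -> xmem (i + (l.1.+1)%:Z) (xletter l y).
Proof.
move=> [m1 m2 h1 h2 e]; split=> //.
- exact: multiadditive_cons.
- move=> [|x u] a b c v h /=; first exact: (m2 [::] _ _ _ v (lmul_addr l h)).
  exact: (m2 (lmul l x :: u)).
- by move=> w; have := h2 (l :: w); congr (homog _ _); rewrite excess_cons; lia.
- move=> [|x r]; first exact: homog0.
  have := h2 (lmul l x :: r); congr (homog _ _); rewrite !excess_cons.
  by rewrite (_ : (lmul l x).1 = (l.1 + x.1).+1) //; lia.
Qed.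

Let xmem_ra i j (q : Q j) y : xmem i y -> xmem (i + j) (xra q y).
Proof.
move=> my; case: j q => [[|e]|n] q /=; last exact: xmem0.
  by rewrite addr0; case: (F2_cases q) => ->; rewrite ?scale0r ?scale1r.
exact: (xmem_letter (elt_letter q) my).
Qed.

Let xdif0 : xdif 0 = 0. Proof. exact: morphD0 xdifD. Qed.

Let xdif_ra i j (q : Q j) y : xmem i y -> xdif (xra q y) = xra q (xdif y).
Proof.
move=> [_ _ _ _ e]; case: j q => [[|n]|n] q /=; last exact: xdif0.
  by case: (F2_cases q) => ->; rewrite ?scale0r ?scale1r.
apply: xext => w; last exact: N_merge_head.
by rewrite [RHS]N_cons.
Qed.

Let xla0 i (c : C i) : xla c 0 = 0. Proof. exact: morphD0 (@xlaDr i c). Qed.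

Let xlaraC i j (c : C i) (q : Q j) y : xla c (xra q y) = xra q (xla c y).
Proof.
case: j q => [[|n]|n] q /=; last exact: xla0.
  by case: (F2_cases q) => ->; rewrite ?scale0r ?scale1r.
by apply: xext => [w|[|x r]] //=; rewrite tmull0.
Qed.

Let xmem_unit : xmem 0 xunit.
Proof.
split=> //; first by move=> [|x u] a b c v h; rewrite addr0.
by move=> [|x w]; [exact: at_deg_homog|exact: homog0].
Qed.

(** The second component is the Maurer-Cartan equation. In the first one the unit at the empty word
    contributes 1 times [f w] through the convolution, which cancels the summand [f w]. *)
Let xdif_unit : xdif xunit = 0.
Proof.
apply: xext => w; last exact: fc.
pose F w : Y := if w is [::] then tone C else 0.
have -> : (xdif xunit).1 w = N F w + f w by [].
have -> : N F w = tdif (F w) + mergesum F w + conv (twist f) F w by [].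
have -> : tdif (F w) = 0 by case: w => [|x w]; [exact: tdif_one|exact: tdif0].
have -> : mergesum F w = 0.
  case: w => [|x [|y r]] //.
  by apply: rdiff_eq0 => [a u v|[|z u] //]; rewrite addr0.
have -> : conv (twist f) F w = f w.
  have fw v : twist f v (tone C) = f v.
    apply: tmulr_one; have := @fh v; congr (homog _ _); rewrite /wdeg; lia.
  case: w => [|x w]; first exact: fw.
  rewrite [LHS]/= fw conv_split0 ?addr0 // => u v _.
  exact: morphD0 (twistD _ _).
by rewrite !add0r addF2.
Qed.

Let xevD i : {morph xev i : y z / y + z}.
Proof. by []. Qed.

Let xev_dif i k (e : i + 1 = k) y : xmem i y -> xev k (xdif y) = dif C e (xev i y).
Proof.
move=> [_ _ _ _ y20].
have -> : xev k (xdif y) = (tdif (y.1 [::]) + 0 + twist f [::] (y.1 [::]) + y.2 [::]) k by [].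
by rewrite y20 (twist0 f0) !addr0 (tdifE _ e).
Qed.

Let xev_la i (c : C i) : xev i (xla c xunit) = c.
Proof. by rewrite /xev /= tmull_one at_degE. Qed.

Variable theta : gmor (cohomology_algebra C) Q.
Hypothesis theta_bij : forall i, bijective (theta i).
Variable rep : forall n, Q n -> C n.
Hypothesis rep_closed : forall n q, dif C (erefl (n + 1)) (rep q) = 0.
Hypothesis class_at_rep : forall n q, class_at theta n (at_deg (rep q)) = q.
Hypothesis f1 : forall l, f [:: l] = at_deg (rep (letter_elt l)).

Let xev_ra0 (q : Q 0) : xev 0 (xra q xunit) = (q : F2) *: gone C.
Proof.
rewrite [xra _ _]/=; case: (F2_cases q) => ->; rewrite ?scale0r ?scale1r //.
exact: at_degE.
Qed.

Let xev_ra_pos e (q : Q (Posz e.+1)) : xev (Posz e.+1) (xra q xunit) = rep q.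
Proof. by rewrite /xev /= f1 elt_letterK at_degE. Qed.

Let xev_ra_closed i (q : Q i) : dif C (erefl (i + 1)) (xev i (xra q xunit)) = 0.
Proof.
case: i q => [[|e]|n] q; [rewrite xev_ra0|by rewrite xev_ra_pos rep_closed|exact: raddf0].
case: (F2_cases q) => ->; rewrite ?scale0r ?scale1r; first exact: raddf0.
exact: (dgcocycleP (dgcocycle1 C)).
Qed.

Let xev_ra i (q : Q i) : class_at theta i (at_deg (xev i (xra q xunit))) = q.
Proof.
case: i q => [[|e]|n] q; [rewrite xev_ra0|by rewrite xev_ra_pos|].
  case: (F2_cases q) => ->; rewrite ?scale0r ?scale1r; first by rewrite at_deg0 class_at0.
  exact: class_at_one.
by rewrite [RHS]ugr_negz0 at_deg0 class_at0.
Qed.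

(** The extra degeneracy of the bar resolution: [xdif y = 0] says that [y.2] is [nabla] of [y.1], so
    the pair with components zero and [y.1] is a primitive. The condition on [xev] makes [y.1]
    vanish at the empty word, as is required of a second component. *)
Let xexact i y : xmem i y -> xdif y = 0 -> xev i y = 0 ->
  exists2 z, xmem (i - 1) z & xdif z = y.
Proof.
move=> [m1 m2 h1 h2 e2] dy e1; exists (fun=> 0, y.1).
  split=> //=; first by move=> u a b c v _; rewrite addr0.
    by rewrite subrK.
  by rewrite -(at_degK (h1 [::])) addr0 [X in at_deg X]e1 at_deg0.
apply: xext => w; first by rewrite [LHS]/= N0 add0r.
have E : N y.1 w + y.2 w = 0 := congr1 (fun z => z.1 w) dy.
by rewrite [LHS]/= -[LHS]addr0 -(addF2 (y.2 w)) addrA E add0r.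
Qed.

Variable phi : gmor Q (cohomology_algebra C).
Hypothesis thetaK : forall i, cancel (theta i) (phi i).
Hypothesis phiK : forall i, cancel (phi i) (theta i).

Theorem twisting_formal : formal C.
Proof.
exact: (@triangular_formal Q C _ xmem xdif xla xra xunit xmem0 xmemD xdifD xdif_xdif
  xmem_dif xlaDr xlaDl xla1 xlaM xmem_la xdif_la xraDr xraDl xra1 xraM xmem_ra xdif_ra
  xlaraC xmem_unit xdif_unit theta theta_bij xev xevD xev_dif xev_la xev_ra_closed xev_ra
  xexact phi thetaK phiK).
Qed.

End Formality.

Theorem VB_intrinsically_formal (V : lmodType F2) (B : booleanRingType) :
  intrinsically_formal (VB V B).
Proof.
move=> C [theta theta_bij].
have [rep [repD rep_closed class_at_rep]] := class_at_surj theta_bij.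
have [f [fM fh f0 f1 fc]] := twisting_exists theta_bij repD rep_closed class_at_rep.
have [phi [thetaK phiK]] := gmor_inverse theta_bij.
exact: (twisting_formal fM fh f0 fc theta_bij rep_closed class_at_rep f1 thetaK phiK).
Qed.

Theorem theorem9p14 (V : lmodType F2) (B : booleanRingType)
    (A : subringClosed B) :
  infinite_set [set: B] ->
  (`I_8 #<= [set` A])%card ->
  (forall m : int, m < 0 -> forall k : nat, k%:Z <> 1 - m ->
     forall x : HH k m (VB_bimod V A), x = 0)
  /\ (forall n : nat, (3 <= n)%N ->
     forall x : HH n (2 - n%:Z) (regular_bimod (VB V B)), x = 0)
  /\ intrinsically_formal (VB V B).
Proof.
move=> B_inf A_large; split; first exact: HH_subring_eq0.
(* Here [n + (2 - n) = 2], which is not the excluded value 1. *)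
split=> [n n_ge3|]; first by apply: HH_regular_eq0 => //; lia.
exact: VB_intrinsically_formal.
Qed.
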